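(* Let $g^{ij}(u)$ be a flat nondegenerate (pseudo-Riemannian) contravariant metric in local coordinates $u=(u^1,\dots,u^n)$, with Levi-Civita connection $\nabla$ and Christoffel symbols $\Gamma^j_{sk}$, let $$J^{ij}=g^{ij}\frac{d}{dx}-g^{is}\Gamma^j_{sk}u^k_x ,$$ and let $h(u)$ be a function. Consider the Hamiltonian system of hydrodynamic type $$u^i_t=\upsilon^i_j(u)u^j_x=J^{ij}\frac{\partial h}{\partial u^j}=(\nabla^i\nabla_j h)\,u^j_x .$$ Let $B(u)\,dx+A(u)\,dt$ be a conservation law of this system, with $B$ nowhere zero, and perform the reciprocal transformation $d\tilde x=B(u)\,dx+A(u)\,dt$, $\tilde t=t$, under which the system takes the form $$u^i_t=\tilde\upsilon^i_j(u)u^j_{\tilde x},\qquad \tilde\upsilon^i_j=B\,\nabla^i\nabla_j h-A\,\delta^i_j .$$ Then this transformed system is Hamiltonian, $$u^i_t=\tilde J^{ij}\frac{\partial\tilde h}{\partial u^j},$$ with the nonlocal Hamiltonian operator $$\tilde J^{ij}=\tilde g^{ij}\frac{d}{d\tilde x}-\tilde g^{is}\tilde\Gamma^j_{sk}u^k_{\tilde x}+\tilde w^i_k u^k_{\tilde x}\Big(\frac{d}{d\tilde x}\Big)^{-1}u^j_{\tilde x}+u^i_{\tilde x}\Big(\frac{d}{d\tilde x}\Big)^{-1}\tilde w^j_k u^k_{\tilde x}$$ and the Hamiltonian density $\tilde h(u)=h(u)/B(u)$. Here $\tilde g^{ij}=B^2g^{ij}$, $\tilde\Gamma$ denotes the Christoffel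 symbols of the Levi-Civita connection of $\tilde g$, and $$\tilde w^i_j=B\,\nabla^i\nabla_j B-\tfrac12(\nabla B)^2\,\delta^i_j,\qquad (\nabla B)^2=g^{ij}\,\partial_iB\,\partial_jB .$$ Moreover, the metric $\tilde g$ is conformally flat with curvature tensor $$\tilde R^{ij}_{kl}=\tilde w^i_k\delta^j_l+\tilde w^j_l\delta^i_k-\tilde w^j_k\delta^i_l-\tilde w^i_l\delta^j_k .$$
   Context: Summation over repeated indices is understood; everything is local and smooth; $\partial_i=\partial/\partial u^i$ and $\nabla^i=g^{ij}\nabla_j$. Conservation law. A pair $B(u)\,dx+A(u)\,dt$ is a conservation law of $u^i_t=\upsilon^i_ju^j_x$ if this 1-form is closed on solutions of the system, i.e. $\partial_jA=(\partial_iB)\,\upsilon^i_j$. Curvature convention. The sign of $R^{ij}_{kl}$ is such that a metric of constant curvature $c$ has $R^{ij}_{kl}=c(\delta^i_k\delta^j_l-\delta^i_l\delta^j_k)$; the index is raised with the metric in question. Inverse derivative. $(d/d\tilde x)^{-1}$ is the formal inverse of the total derivative $d/d\tilde x$: if $\tilde w^j_k u^k_{\tilde x}\partial_j\tilde h=\frac{d}{d\tilde x}F(u)$, then $(d/d\tilde x)^{-1}$ of it is $F$, which is defined up to an additive constant. Equalities of the form $u^i_t=\tilde J^{ij}\partial_j\tilde h$ are understood for an appropriate choice of these integration constants. Hamiltonian operator. An operator is Hamiltonian if the bracket $\{F,G\}=\int \frac{\delta F}{\delta u^i}J^{ij}\frac{\delta G}{\delta u^j}\,dx$ is skew-symmetric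 and satisfies the Jacobi identity. The following known criterion is used for nonlocal operators of hydrodynamic type $$J^{ij}=g^{ij}\frac{d}{dx}-g^{is}\Gamma^j_{sk}u^k_x+\sum_\alpha\varepsilon^\alpha w^i_{(\alpha)k}u^k_x\Big(\frac{d}{dx}\Big)^{-1}w^j_{(\alpha)s}u^s_x,\qquad \varepsilon^\alpha=\pm1,$$ with $\Gamma$ the Levi-Civita connection of the nondegenerate metric $g$: it is Hamiltonian if and only if $g_{ik}w^k_{(\alpha)j}=g_{jk}w^k_{(\alpha)i}$, $\nabla_kw^i_{(\alpha)j}=\nabla_jw^i_{(\alpha)k}$, $R^{ij}_{kl}=\sum_\alpha\varepsilon^\alpha\big(w^i_{(\alpha)k}w^j_{(\alpha)l}-w^i_{(\alpha)l}w^j_{(\alpha)k}\big)$, and the affinors $w_{(\alpha)}$ pairwise commute. For an operator whose nonlocal tail is $w^i_ku^k_x(d/dx)^{-1}u^j_x+u^i_x(d/dx)^{-1}w^j_ku^k_x$ (which is brought to the preceding form by polarization) the conditions become: $g_{ik}w^k_j=g_{jk}w^k_i$, $\nabla_kw^i_j=\nabla_jw^i_k$, and $R^{ij}_{kl}=w^i_k\delta^j_l+w^j_l\delta^i_k-w^j_k\delta^i_l-w^i_l\delta^j_k$. *)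

(* Defs.v *)
From HB Require Import structures.
From mathcomp Require Import all_boot all_order all_algebra.
From mathcomp Require Import all_classical all_reals all_analysis.
Set Implicit Arguments.
Unset Strict Implicit.
Unset Printing Implicit Defensive.
Import Order.TTheory GRing.Theory Num.Theory.
Import numFieldNormedType.Exports.
Local Open Scope classical_set_scope.
Local Open Scope ring_scope.

(* Points of R^n and covectors are row vectors 'rV[R]_n;
   tensors with two indices are matrix-valued functions of the point, the first
   index being the row. *)

Section Tensors.
Context {R : realType} {n : nat}.
Implicit Types (U : set 'rV[R]_n) (f : 'rV[R]_n -> R) (p : 'rV[R]_n).
Implicit Types (g w : 'rV[R]_n -> 'M[R]_n) (i j k l s : 'I_n).

Definition partial i f p : R := 'D_(delta_mx 0 i) f p.

Fixpoint differentiable_upto (m : nat) U f : Prop :=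
  (forall p, U p -> differentiable f p) /\
  match m with
  | 0%N => True
  | m'.+1 => forall i, differentiable_upto m' U (partial i f)
  end.

Definition smooth_on U f : Prop := forall m, differentiable_upto m U f.

Definition gradient f p : 'rV[R]_n := \row_i partial i f p.

(* g is always the contravariant metric g^{ij}; its inverse is g_{ij}. *)
Definition metric_on U g : Prop :=
  (forall i j, smooth_on U (fun p => g p i j)) /\
  (forall p, U p -> (g p)^T = g p /\ g p \in unitmx).

Definition lower g p : 'M[R]_n := invmx (g p).

(* christoffel g j s k is Gamma^j_{sk} of the Levi-Civita connection. *)
Definition christoffel g j s k p : R :=
  2^-1 * \sum_l g p j l *
    (partial s (fun q => lower g q l k) p + partial k (fun q => lower g q l s) p
     - partial l (fun q => lower g q s k) p).

(* curvature g i j k l is R^{ij}_{kl} = g^{js} R^i_{skl}, with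
   R^i_{skl} = d_k Gamma^i_{ls} - d_l Gamma^i_{ks} + ... ; with this sign a
   metric of constant curvature c has
   R^{ij}_{kl} = c (delta^i_k delta^j_l - delta^i_l delta^j_k). *)
Definition curvature g i j k l p : R :=
  \sum_s g p j s *
    (partial k (christoffel g i l s) p - partial l (christoffel g i k s) p
     + \sum_m (christoffel g i k m p * christoffel g m l s p
               - christoffel g i l m p * christoffel g m k s p)).

Definition flat_metric_on U g : Prop :=
  metric_on U g /\ forall p, U p -> forall i j k l, curvature g i j k l p = 0.

Definition conformally_flat_on U g : Prop :=
  forall p, U p -> exists V (lambda : 'rV[R]_n -> R),
    [/\ open V, V p /\ V `<=` U, smooth_on V lambda,
        forall q, V q -> 0 < lambda q
      & flat_metric_on V (fun q => lambda q *: g q)].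

(* The affinor nabla^i nabla_j f. *)
Definition hessian_up g f p : 'M[R]_n := \matrix_(i, j)
  \sum_s g p i s *
    (partial s (partial j f) p - \sum_k christoffel g k s j p * partial k f p).

Definition grad_sq g f p : R :=
  \sum_i \sum_j g p i j * partial i f p * partial j f p.

(* The 1-form B dx + A dt is closed on the solutions of u_t = v(u) u_x. *)
Definition conservation_law U (v : 'rV[R]_n -> 'M[R]_n) (B A : 'rV[R]_n -> R) :
    Prop :=
  forall p, U p -> forall j,
    partial j A p = \sum_i partial i B p * v p i j.

End Tensors.

Section Operators.
Context {R : realType} {n : nat}.
Implicit Types (U : set 'rV[R]_n) (g w : 'rV[R]_n -> 'M[R]_n).
Implicit Types (u v xi : R -> 'rV[R]_n).

Definition dx u x : 'rV[R]_n := \row_i derive1 (fun y => u y 0 i) x.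

Definition smooth_path u : Prop :=
  forall i m x, derivable (derive1n m (fun y => u y 0 i)) x 1.

Definition path_in U u : Prop := smooth_path u /\ forall x, U (u x).

Definition local_op g u xi x : 'rV[R]_n := \row_i
  (\sum_j g (u x) i j * dx xi x 0 j
   - \sum_s \sum_j \sum_k
       g (u x) i s * christoffel g j s k (u x) * dx u x 0 k * xi x 0 j).

(* The arguments of (d/dx)^{-1} in the two nonlocal terms. *)
Definition density1 u xi x : R := \sum_j dx u x 0 j * xi x 0 j.
Definition densityw w u xi x : R :=
  \sum_j (\sum_k w (u x) j k * dx u x 0 k) * xi x 0 j.

(* The operator
     g^{ij} d/dx - g^{is} Gamma^j_{sk} u^k_x
       + w^i_k u^k_x (d/dx)^{-1} u^j_x + u^i_x (d/dx)^{-1} w^j_k u^k_x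
   applied to xi, for the values P and Q of (d/dx)^{-1} (u^j_x xi_j) and
   (d/dx)^{-1} (w^j_k u^k_x xi_j). *)
Definition nonlocal_op_with g w u xi (P Q : R -> R) x : 'rV[R]_n := \row_i
  (local_op g u xi x 0 i
   + (\sum_k w (u x) i k * dx u x 0 k) * P x + dx u x 0 i * Q x).

(* v(u) u_x = J dh/du, where (d/dx)^{-1} is the formal inverse of the total
   derivative: P and Q are functions of u only whose total derivatives are the
   two densities, i.e. some choice of the integration constants. *)
Definition hamiltonian_form U (v : 'rV[R]_n -> 'M[R]_n) g w
    (h : 'rV[R]_n -> R) : Prop :=
  exists P Q : 'rV[R]_n -> R,
    [/\ smooth_on U P, smooth_on U Q
      & forall u, path_in U u -> forall x,
        [/\ is_derive x (1 : R) (P \o u) (density1 u (gradient h \o u) x),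
            is_derive x (1 : R) (Q \o u) (densityw w u (gradient h \o u) x)
          & forall i, \sum_j v (u x) i j * dx u x 0 j =
              nonlocal_op_with g w u (gradient h \o u) (P \o u) (Q \o u) x 0 i]].

(* In the bracket the integration constant of (d/dx)^{-1} is the one for which
   (d/dx)^{-1} is skew-symmetric on functions of bounded support. *)
Definition dx_inv (f : R -> R) (x : R) : R :=
  2^-1 * (\int[lebesgue_measure]_(y in `]-oo, x]) f y
          - \int[lebesgue_measure]_(y in `[x, +oo[) f y).

Definition nonlocal_op g w u xi : R -> 'rV[R]_n :=
  nonlocal_op_with g w u xi
    (dx_inv (density1 u xi)) (dx_inv (densityw w u xi)).

(* The phase space: U-valued paths that are constant near +oo and near -oo
   (not necessarily equal constants). Tangent vectors have bounded support, so
   that u + s v stays in U for small s. *)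
Definition field U u : Prop :=
  path_in U u /\ exists M : R, forall x, M < `|x| -> dx u x = 0.

Definition test_field v : Prop :=
  smooth_path v /\ exists M : R, forall x, M < `|x| -> v x = 0.

Definition affine_family (m : nat) u (v : 'I_m -> R -> 'rV[R]_n)
    (s : 'rV[R]_m) : R -> 'rV[R]_n :=
  fun x => u x + \sum_a s 0 a *: v a x.

Definition pairing xi v : R :=
  \int[lebesgue_measure]_x (\sum_i xi x 0 i * v x 0 i).

(* d/ds F[u + s v] exists at s = 0 and is equal to c. *)
Definition first_variation (F : (R -> 'rV[R]_n) -> R) u v (c : R) : Prop :=
  is_derive (0 : R) (1 : R) (fun s : R => F (fun x => u x + s *: v x)) c.

(* F is a functional on the phase space with variational derivative
   dF u = delta F / delta u, supported in a window of x independent of u and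
   depending smoothly on x and on the parameters of a finite-dimensional family
   of fields (the last coordinate of y is x, the other ones are the
   parameters). Integrals of smooth densities f(x, u, u_x, u_xx, ...) that
   vanish for x outside a bounded interval are of this kind. *)
Definition has_variational_derivative U (F : (R -> 'rV[R]_n) -> R)
    (dF : (R -> 'rV[R]_n) -> R -> 'rV[R]_n) : Prop :=
  [/\ forall u v, field U u -> test_field v ->
        first_variation F u v (pairing (dF u) v),
      exists M : R, forall u, field U u -> forall x, M < `|x| -> dF u x = 0
    & forall (m : nat) u (v : 'I_m -> R -> 'rV[R]_n),
        field U u -> (forall a, test_field (v a)) ->
        forall i, smooth_on
          [set y : 'rV[R]_(m + 1) | field U (affine_family u v (lsubmx y))]
          (fun y => dF (affine_family u v (lsubmx y)) (rsubmx y 0 0) 0 i)].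

Definition bracket (J : (R -> 'rV[R]_n) -> (R -> 'rV[R]_n) -> R -> 'rV[R]_n)
    (dF dG : (R -> 'rV[R]_n) -> R -> 'rV[R]_n) u : R :=
  pairing (dF u) (J u (dG u)).

(* Skew-symmetry and Jacobi identity of {F, G} = \int dF J dG dx. The bracket
   {{F, G}, H} = \int (delta {F, G} / delta u) J dH dx is the first variation
   of {F, G} along J dH. *)
Definition hamiltonian_operator U
    (J : (R -> 'rV[R]_n) -> (R -> 'rV[R]_n) -> R -> 'rV[R]_n) : Prop :=
  (forall F G dF dG, has_variational_derivative U F dF ->
     has_variational_derivative U G dG ->
     forall u, field U u -> bracket J dF dG u = - bracket J dG dF u) /\
  (forall F G H dF dG dH, has_variational_derivative U F dF ->
     has_variational_derivative U G dG -> has_variational_derivative U H dH ->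
     forall u, field U u -> exists a b c : R,
       [/\ first_variation (bracket J dF dG) u (J u (dH u)) a,
           first_variation (bracket J dG dH) u (J u (dF u)) b,
           first_variation (bracket J dH dF) u (J u (dG u)) c
         & a + b + c = 0]).

End Operators.

Section ReciprocalTransformations.
Context {R : realType} {n : nat}.
Implicit Types (u : R * R -> 'rV[R]_n) (W : set (R * R)) (A B : 'rV[R]_n -> R).

(* The first coordinate of R * R is the space variable, the second is time. *)
Definition d_space (f : R * R -> R) (z : R * R) : R := 'D_((1, 0) : R * R) f z.
Definition d_time (f : R * R -> R) (z : R * R) : R := 'D_((0, 1) : R * R) f z.

Definition differentiable_into (U : set 'rV[R]_n) W u : Prop :=
  forall z, W z -> U (u z) /\ forall i, differentiable (fun y => u y 0 i) z.

Definition solves (v : 'rV[R]_n -> 'M[R]_n) W u : Prop :=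
  forall z, W z -> forall i,
    d_time (fun y => u y 0 i) z =
    \sum_j v (u z) i j * d_space (fun y => u y 0 j) z.

(* ut is u in the independent variables (xt, t), where
   d xt = B(u) dx + A(u) dt along u. *)
Definition reciprocal_pair B A W u (Wt : set (R * R)) (ut : R * R -> 'rV[R]_n) :
    Prop :=
  exists xt : R * R -> R,
    [/\ forall z, W z -> [/\ differentiable xt z, d_space xt z = B (u z)
                           & d_time xt z = A (u z)],
        Wt = [set (xt z, z.2) | z in W]
      & forall z, W z -> ut (xt z, z.2) = u z].

End ReciprocalTransformations.

(* Main.v *)
(* The Levi-Civita connection of B^2 g differs from that of g by an explicit
   tensor, so that its curvature follows from the flatness of g by matrix
   algebra; the same computation gives the symmetry and the Codazzi equation of
   the affinor.

   For the Jacobi identity, differentiate {F, G} = \int xi J eta along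
   v = J zeta, with xi, eta, zeta the variational derivatives of F, G, H. The
   terms containing second variations cancel in the cyclic sum, because J is
   skew-symmetric and second variations are symmetric. What remains is the
   integral of a trivector density. By the Gauss and Codazzi equations it is, up
   to the x-derivative of a function of bounded support, an algebraic expression
   in J xi, J eta and v, whose cyclic sum vanishes pointwise.

   For the Hamiltonian form, the potentials of the two densities are h / B and
   (dh, dB) - A - h (dB, dB) / (2 B); the conservation law gives the derivative
   of the second one. *)
Require Import Defs.
From HB Require Import structures.
From mathcomp Require Import all_boot all_order all_algebra.
From mathcomp Require Import all_classical all_reals all_analysis.
From mathcomp Require Import ring lra.
Set Implicit Arguments.
Unset Strict Implicit.
Unset Printing Implicit Defensive.
Import Order.TTheory GRing.Theory Num.Theory.
Import numFieldNormedType.Exports.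
Local Open Scope classical_set_scope.
Local Open Scope ring_scope.

(** * Smooth functions on open sets *)

(** The tails do not preserve bounded support: beyond the window of its argument, [dx_inv f] is plus
    or minus half of the total integral. Two facts keep this harmless. In the operator the tails are
    multiplied by [u_x], so [J xi] is again an admissible direction; and a product of two such
    primitives has equal values at both ends, so integration by parts leaves no boundary term.

    The bracket has to be differentiated through [dx_inv] under an outer integral. To this end
    difference quotients are shown to converge uniformly in [x], a property stable under sums,
    products of bounded functions, [dx_inv] and integration over a fixed window.

    The function split off from the trivector density is chosen to take the derivative off [v]. In
    what remains there is no [v_x], and derivatives of the covectors enter only as covariant
    derivatives along the path.

    Tensors are handled without indices: [Gamma] contracted with a direction is a matrix, and the
    Gauss and Codazzi equations become matrix equations tested on row vectors. *)

Lemma near_eq_differentiable (K : numFieldType) (V W : normedModType K)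
    (f g : V -> W) (p : V) :
  (\near p, f p = g p) -> differentiable f p -> differentiable g p.
Proof.
move=> fgp /diff_locallyP [cf Hf].
have fgh : \forall h \near (0 : V), f (h + p) = g (h + p).
  by have := fgp; rewrite (near_shift 0 p) subr0; exact.
have Hg : g \o shift p = cst (g p) + 'd f p +o_ 0 id.
  apply/eqaddoP => e e0; have /eqaddoP/(_ e e0) := Hf.
  apply: filterS2 fgh => h fgh Hfe.
  have -> : (g \o shift p - (cst (g p) + 'd f p)) h = g (h + p) - (g p + 'd f p h) by [].
  by rewrite -fgh -(nbhs_singleton fgp).
by apply/diff_locallyP; rewrite (diff_unique cf Hg).
Qed.

(** Both difference quotients are the same function of [h]; directional derivatives are thereby
    reduced to one-variable calculus and the mean value theorem. *)
Lemma is_derive_line (R : numFieldType) (V W : normedModType R) (f : V -> W)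
    (a v : V) (s : R) (df : W) :
  is_derive (a + s *: v) v f df -> is_derive s (1 : R) (fun r => f (a + r *: v)) df.
Proof.
have E : (fun h : R => h^-1 *: (((fun r => f (a + r *: v)) \o shift s) (h *: (1 : R)) -
      f (a + s *: v))) =
    (fun h => h^-1 *: ((f \o shift (a + s *: v)) (h *: v) - f (a + s *: v))).
  apply/funext => h /=; congr (_ *: (f _ - _)).
  by rewrite [h *: (1 : R)]mulr1 scalerDl addrCA.
move=> [dfa <-]; split; first by rewrite /derivable /= E.
by rewrite /derive /= E.
Qed.

Section ChainRule.
Context {R : realType} {W : normedModType R} {n : nat}.

Lemma differentiable_rV (phi : W -> 'rV[R]_n) (p : W) :
  (forall j, differentiable (fun q => phi q 0 j) p) -> differentiable phi p.
Proof.
move=> dphi.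
have -> : phi = \sum_(j < n) (fun q => phi q 0 j *: delta_mx 0 j).
  apply/funext => q; rewrite fct_sumE {1}(row_sum_delta (phi q)).
  by apply: eq_bigr => j _.
by apply: differentiable_sum => j; exact: differentiableZl.
Qed.

Lemma differentiable_comp_rV (phi : W -> 'rV[R]_n) (f : 'rV[R]_n -> R) (p : W) :
  (forall j, differentiable (fun q => phi q 0 j) p) ->
  differentiable f (phi p) -> differentiable (f \o phi) p.
Proof. by move=> dphi df; apply: differentiable_comp => //; exact: differentiable_rV. Qed.

Lemma derive_comp_rV (phi : W -> 'rV[R]_n) (f : 'rV[R]_n -> R) (p v : W) :
  (forall j, differentiable (fun q => phi q 0 j) p) ->
  differentiable f (phi p) ->
  'D_v (f \o phi) p = \sum_j partial j f (phi p) * 'D_v (fun q => phi q 0 j) p.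
Proof.
move=> dphi df; have dP := differentiable_rV dphi.
rewrite deriveE; last exact: differentiable_comp.
rewrite diff_comp //=.
have -> : 'd phi p v = \row_j 'D_v (fun q => phi q 0 j) p.
  rewrite -deriveE // derive_mx; last exact: diff_derivable.
  by apply/rowP => j; rewrite !mxE.
rewrite [X in 'd f _ X]row_sum_delta linear_sum /=; apply: eq_bigr => j _.
by rewrite linearZ /= mxE /partial (deriveE _ df) [RHS]mulrC.
Qed.

End ChainRule.

Section Smooth.
Context {R : realType} {n : nat}.
Implicit Types (U V : set 'rV[R]_n) (f g : 'rV[R]_n -> R) (p : 'rV[R]_n).

Lemma differentiable_uptoW m U f :
  differentiable_upto m.+1 U f -> differentiable_upto m U f.
Proof.
elim: m f => [|m IH] f [df Hf]; first by split.
by split=> // i; apply: IH; exact: Hf.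
Qed.

Lemma smooth_onW U f p : smooth_on U f -> U p -> differentiable f p.
Proof. by move=> /(_ 0%N) [df _] /df. Qed.

Lemma smooth_on_partial U f i : smooth_on U f -> smooth_on U (partial i f).
Proof. by move=> sf m; have [_] := sf m.+1; exact. Qed.

Lemma smooth_onI U f : (forall p, U p -> differentiable f p) ->
  (forall i, smooth_on U (partial i f)) -> smooth_on U f.
Proof. by move=> df sf [|m]; split => // i; exact: sf. Qed.

Lemma smooth_on_sub U V f : V `<=` U -> smooth_on U f -> smooth_on V f.
Proof.
move=> VU sf m; elim: m f sf => [|m IH] f sf; split => //.
- by move=> p /VU; exact: smooth_onW.
- by move=> p /VU; exact: smooth_onW.
- by move=> i; apply: IH; exact: smooth_on_partial.
Qed.

Lemma partial_eq_on U f g i p : open U -> (forall q, U q -> f q = g q) -> U p ->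
  partial i f p = partial i g p.
Proof.
move=> oU fg Up; apply: near_eq_derive.
by near=> q; apply: fg; near: q; exact: open_nbhs_nbhs.
Unshelve. all: by end_near. Qed.

Lemma differentiable_eq_on U f g p : open U -> (forall q, U q -> f q = g q) ->
  U p -> differentiable f p -> differentiable g p.
Proof.
move=> oU fg Up; apply: near_eq_differentiable.
by near=> q; apply: fg; near: q; exact: open_nbhs_nbhs.
Unshelve. all: by end_near. Qed.

Lemma smooth_on_eq U f g : open U -> (forall q, U q -> f q = g q) ->
  smooth_on U f -> smooth_on U g.
Proof.
move=> oU fg sf m; elim: m f g fg sf => [|m IH] f g fg sf; split => //.
- by move=> p Up; apply: (differentiable_eq_on oU fg Up); exact: smooth_onW sf Up.
- by move=> p Up; apply: (differentiable_eq_on oU fg Up); exact: smooth_onW sf Up.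
- move=> i; apply: IH (smooth_on_partial i sf) => q Uq.
  exact: partial_eq_on fg Uq.
Qed.

(** The version at a fixed order, needed inside the inductions below: there the partial derivatives
    of a sum, product or inverse agree with the expected expression only on [U]. *)
Lemma differentiable_upto_eq m U f g : open U -> (forall q, U q -> f q = g q) ->
  differentiable_upto m U f -> differentiable_upto m U g.
Proof.
move=> oU; elim: m f g => [|m IH] f g fg [df Hf]; split => //.
- by move=> p Up; apply: (differentiable_eq_on oU fg Up); exact: df.
- by move=> p Up; apply: (differentiable_eq_on oU fg Up); exact: df.
- move=> i; apply: IH (Hf i) => q Uq; exact: partial_eq_on fg Uq.
Qed.

Lemma partial_cst i (c : R) p : partial i (fun=> c) p = 0.
Proof. exact: derive_cst. Qed.

Lemma partialD i f g p : differentiable f p -> differentiable g p ->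
  partial i (fun q => f q + g q) p = partial i f p + partial i g p.
Proof. by move=> df dg; rewrite /partial deriveD //; exact: diff_derivable. Qed.

Lemma partialN i f p : differentiable f p ->
  partial i (fun q => - f q) p = - partial i f p.
Proof. by move=> df; rewrite /partial deriveN //; exact: diff_derivable. Qed.

Lemma partialM i f g p : differentiable f p -> differentiable g p ->
  partial i (fun q => f q * g q) p = partial i f p * g p + f p * partial i g p.
Proof.
move=> df dg; rewrite /partial deriveM; try exact: diff_derivable.
by rewrite /GRing.scale /= addrC [g p * _]mulrC.
Qed.

Lemma partialV i f p : differentiable f p -> f p != 0 ->
  partial i (fun q => (f q)^-1) p = - (f p) ^- 2 * partial i f p.
Proof. by move=> df f0; rewrite /partial deriveV //; exact: diff_derivable. Qed.

Lemma partial_coord i j p : partial i (fun q => q 0 j) p = (j == i)%:R.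
Proof.
rewrite /partial deriveE; last exact: differentiable_coord.
have lin : linear (fun q : 'rV[R]_n => q 0 j : R).
  by move=> a q r; rewrite !mxE.
pose lM := GRing.isLinear.Build _ _ _ _ _ lin.
pose L : {linear 'rV[R]_n -> R} := HB.pack (fun q : 'rV[R]_n => q 0 j : R) lM.
have -> : (fun q : 'rV[R]_n => q 0 j : R) = L by [].
rewrite diff_lin; last exact: coord_continuous.
by rewrite /= mxE eqxx.
Qed.

Lemma smooth_on_cst U (c : R) : smooth_on U (fun=> c).
Proof.
move=> m; elim: m c => [|m IH] c; split => // i.
have -> : partial i (fun _ : 'rV[R]_n => c) = (fun=> 0).
  by apply/funext => p; exact: partial_cst.
exact: IH.
Qed.

Lemma differentiable_uptoD m U f g : open U ->
  differentiable_upto m U f -> differentiable_upto m U g ->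
  differentiable_upto m U (fun q => f q + g q).
Proof.
move=> oU; elim: m f g => [|m IH] f g [df Hf] [dg Hg]; split => //.
- by move=> p Up; apply: differentiableD; [exact: df|exact: dg].
- by move=> p Up; apply: differentiableD; [exact: df|exact: dg].
- move=> i; apply: differentiable_upto_eq (IH _ _ (Hf i) (Hg i)) => // q Uq.
  by rewrite partialD //; [exact: df|exact: dg].
Qed.

Lemma differentiable_uptoN m U f : open U ->
  differentiable_upto m U f -> differentiable_upto m U (fun q => - f q).
Proof.
move=> oU; elim: m f => [|m IH] f [df Hf]; split => //.
- by move=> p Up; apply: differentiableN; exact: df.
- by move=> p Up; apply: differentiableN; exact: df.
- move=> i; apply: differentiable_upto_eq (IH _ (Hf i)) => // q Uq.
  by rewrite partialN //; exact: df.
Qed.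

(** The Leibniz rule contains the factors themselves next to their partial derivatives, so both
    factors are also used one order lower. *)
Lemma differentiable_uptoM m U f g : open U ->
  differentiable_upto m U f -> differentiable_upto m U g ->
  differentiable_upto m U (fun q => f q * g q).
Proof.
move=> oU; elim: m f g => [|m IH] f g; first last.
  move=> Hf Hg; have Hf' := differentiable_uptoW Hf.
  have Hg' := differentiable_uptoW Hg.
  case: Hf Hg => df Hf [dg Hg]; split.
    by move=> p Up; apply: differentiableM; [exact: df|exact: dg].
  move=> i; apply: differentiable_upto_eq
    (differentiable_uptoD oU (IH _ _ (Hf i) Hg') (IH _ _ Hf' (Hg i))) => // q Uq.
  by rewrite partialM //; [exact: df|exact: dg].
move=> [df _] [dg _]; split => // p Up.
by apply: differentiableM; [exact: df|exact: dg].
Qed.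

(** The derivative of [1 / f] is [- f' / f ^ 2], in which [1 / f] occurs again at the lower
    order. *)
Lemma differentiable_uptoV m U f : open U -> (forall p, U p -> f p != 0) ->
  differentiable_upto m U f -> differentiable_upto m U (fun q => (f q)^-1).
Proof.
move=> oU f0; elim: m => [|m IH]; first last.
  move=> Hf; have Hf' := differentiable_uptoW Hf.
  case: Hf => df Hf; split.
    by move=> p Up; apply: differentiableV; [exact: df|exact: f0].
  move=> i.
  have HV := IH Hf'; have HV2 := differentiable_uptoM oU HV HV.
  have := differentiable_uptoM oU (differentiable_uptoN oU HV2) (Hf i).
  apply: differentiable_upto_eq => // q Uq.
  by rewrite partialV; [rewrite -invfM -expr2|exact: df|exact: f0].
move=> [df _]; split => // p Up.
by apply: differentiableV; [exact: df|exact: f0].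
Qed.

Lemma smooth_onD U f g : open U -> smooth_on U f -> smooth_on U g ->
  smooth_on U (fun q => f q + g q).
Proof. by move=> oU sf sg m; exact: differentiable_uptoD. Qed.

Lemma smooth_onN U f : open U -> smooth_on U f -> smooth_on U (fun q => - f q).
Proof. by move=> oU sf m; exact: differentiable_uptoN. Qed.

Lemma smooth_onB U f g : open U -> smooth_on U f -> smooth_on U g ->
  smooth_on U (fun q => f q - g q).
Proof. by move=> oU sf sg; apply: smooth_onD => //; exact: smooth_onN. Qed.

Lemma smooth_onM U f g : open U -> smooth_on U f -> smooth_on U g ->
  smooth_on U (fun q => f q * g q).
Proof. by move=> oU sf sg m; exact: differentiable_uptoM. Qed.

Lemma smooth_onV U f : open U -> (forall p, U p -> f p != 0) ->
  smooth_on U f -> smooth_on U (fun q => (f q)^-1).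
Proof. by move=> oU f0 sf m; exact: differentiable_uptoV. Qed.

Lemma smooth_on_sum U (I : Type) (r : seq I) (P : pred I) (F : I -> 'rV[R]_n -> R) :
  open U -> (forall i, P i -> smooth_on U (F i)) ->
  smooth_on U (fun q => \sum_(i <- r | P i) F i q).
Proof.
move=> oU sF; elim: r => [|i r IH].
  have -> : (fun q => \sum_(i <- [::] | P i) F i q) = fun=> 0.
    by apply/funext => q; rewrite big_nil.
  exact: smooth_on_cst.
have -> : (fun q => \sum_(i <- i :: r | P i) F i q) =
    fun q => (if P i then F i q else 0) + \sum_(i <- r | P i) F i q.
  by apply/funext => q; rewrite big_cons; case: ifP; rewrite ?add0r.
apply: smooth_onD => //; have [Pi|_] := boolP (P i); first exact: sF.
exact: smooth_on_cst.
Qed.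

Lemma smooth_on_prod U (I : Type) (r : seq I) (F : I -> 'rV[R]_n -> R) :
  open U -> (forall i, smooth_on U (F i)) ->
  smooth_on U (fun q => \prod_(i <- r) F i q).
Proof.
move=> oU sF; elim: r => [|i r IH].
  have -> : (fun q => \prod_(i <- [::]) F i q) = fun=> 1.
    by apply/funext => q; rewrite big_nil.
  exact: smooth_on_cst.
have -> : (fun q => \prod_(i <- i :: r) F i q) =
    fun q => F i q * \prod_(i <- r) F i q.
  by apply/funext => q; rewrite big_cons.
exact: smooth_onM.
Qed.

Lemma smooth_on_coord U j : smooth_on U (fun q => q 0 j).
Proof.
apply: smooth_onI => [p _|i]; first exact: differentiable_coord.
have -> : partial i (fun q : 'rV[R]_n => q 0 j) = fun=> (j == i)%:R.
  by apply/funext => q; exact: partial_coord.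
exact: smooth_on_cst.
Qed.

Lemma smooth_on_det U m (M : 'rV[R]_n -> 'M[R]_m) : open U ->
  (forall i j, smooth_on U (fun q => M q i j)) -> smooth_on U (fun q => \det (M q)).
Proof.
move=> oU sM; rewrite /determinant.
apply: smooth_on_sum => // s _; apply: smooth_onM => //; first exact: smooth_on_cst.
by apply: smooth_on_prod.
Qed.

(** Cramer's rule: cofactors and determinant are polynomials in the entries of [M]. *)
Lemma smooth_on_invmx U m (M : 'rV[R]_n -> 'M[R]_m) i j : open U ->
  (forall p, U p -> M p \in unitmx) ->
  (forall i j, smooth_on U (fun q => M q i j)) ->
  smooth_on U (fun q => invmx (M q) i j).
Proof.
move=> oU uM sM.
apply: (@smooth_on_eq _ (fun q => (\det (M q))^-1 * \adj (M q) i j)) => //.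
  by move=> q Uq; rewrite /invmx uM // [RHS]mxE.
apply: smooth_onM => //.
  by apply: smooth_onV; [|move=> p /uM; rewrite unitmxE unitfE|exact: smooth_on_det].
apply: (@smooth_on_eq _ (fun q => (-1) ^+ (j + i) *
    \det (row' j (col' i (M q))))) => //.
  by move=> q Uq; rewrite mxE /cofactor.
apply: smooth_onM => //; first exact: smooth_on_cst.
apply: smooth_on_det => // k l.
by under eq_fun do rewrite !mxE; exact: sM.
Qed.

End Smooth.

Section SmoothComp.
Context {R : realType} {m n : nat}.

(** By the chain rule a partial derivative of [f \o phi] is a sum of products of
    [partial j f \o phi] with derivatives of [phi]. The induction hypothesis covers the first
    factors because it is stated for all smooth [f]. *)
Lemma smooth_on_comp (V : set 'rV[R]_m) (U : set 'rV[R]_n)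
    (phi : 'rV[R]_m -> 'rV[R]_n) (f : 'rV[R]_n -> R) : open V ->
  (forall q, V q -> U (phi q)) ->
  (forall j, smooth_on V (fun q => phi q 0 j)) ->
  smooth_on U f -> smooth_on V (f \o phi).
Proof.
move=> oV VU sphi sf k; elim: k f sf => [|k IH] f sf.
  split => // q Vq; apply: differentiable_comp_rV.
    by move=> j; exact: smooth_onW (sphi j) Vq.
  exact: smooth_onW sf (VU _ Vq).
split.
  move=> q Vq; apply: differentiable_comp_rV.
    by move=> j; exact: smooth_onW (sphi j) Vq.
  exact: smooth_onW sf (VU _ Vq).
move=> i.
apply: (@differentiable_upto_eq _ _ _ _ (fun q => \sum_j (partial j f \o phi) q *
    partial i (fun r => phi r 0 j) q)) => //.
  move=> q Vq; rewrite [RHS]derive_comp_rV //.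
    by move=> j; exact: smooth_onW (sphi j) Vq.
  exact: smooth_onW sf (VU _ Vq).
have {}IH := fun j => IH _ (smooth_on_partial j sf).
have sp j : differentiable_upto k V (partial i (fun r => phi r 0 j)).
  exact: smooth_on_partial.
(* The sum is taken apart term by term, since only differentiability up to order [k] is available
   for the summands here. *)
elim: (index_enum _) => [|j r IHr].
  apply: (@differentiable_upto_eq _ _ _ _ (fun=> 0)) => //.
    by move=> q _; rewrite big_nil.
  exact: smooth_on_cst.
apply: (@differentiable_upto_eq _ _ _ _ (fun q => (partial j f \o phi) q *
    partial i (fun r => phi r 0 j) q + \sum_(j <- r) (partial j f \o phi) q *
    partial i (fun r => phi r 0 j) q)) => //.
  by move=> q _; rewrite big_cons.
by apply: differentiable_uptoD => //; apply: differentiable_uptoM.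
Qed.

End SmoothComp.

(** * Equality of mixed second derivatives *)

Section Schwarz.
Context {R : realType}.
Implicit Types (F a b c d : R -> R -> R).

(** The mean value theorem is applied in the first variable to [F s k - F s 0], then in the second
    variable to [a s]. *)
Lemma second_difference F a c (k : R) : 0 < k ->
  (forall s t : R, 0 <= s <= k -> 0 <= t <= k -> is_derive s (1 : R) (F ^~ t) (a s t)) ->
  (forall s t : R, 0 <= s <= k -> 0 <= t <= k -> is_derive t (1 : R) (a s) (c s t)) ->
  exists st : R * R, [/\ 0 <= st.1 <= k, 0 <= st.2 <= k &
    F k k - F k 0 - (F 0 k - F 0 0) = c st.1 st.2 * k ^+ 2].
Proof.
move=> k0 Fa ac.
have k00 : 0 <= k <= k by rewrite (ltW k0) lexx.
have k01 : 0 <= (0 : R) <= k by rewrite (ltW k0) lexx.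
have dD s : 0 <= s <= k -> is_derive s (1 : R) (fun s => F s k - F s 0) (a s k - a s 0).
  by move=> sk; apply: is_deriveB; exact: Fa.
have [s /itvP sP Es] : exists2 s, s \in `]0, k[%R &
    (F k k - F k 0) - (F 0 k - F 0 0) = (a s k - a s 0) * (k - 0).
  apply: (@MVT _ (fun s => F s k - F s 0)) => // [s /itvP sP|].
    by apply: dD; rewrite !sP.
  apply: derivable_within_continuous => s /itvP sP.
  by have [] := dD s; rewrite ?sP.
have sk : 0 <= s <= k by rewrite !sP.
have [t /itvP tP Et] : exists2 t, t \in `]0, k[%R & a s k - a s 0 = c s t * (k - 0).
  apply: MVT => // [t /itvP tP|]; first by apply: ac => //; rewrite !tP.
  apply: derivable_within_continuous => t /itvP tP.
  by have [] := ac s t sk; rewrite ?tP.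
exists (s, t); split => //=; first by rewrite !tP.
by rewrite Es Et subr0 expr2 mulrA.
Qed.

(** The second difference over a square of side [k] is [k ^ 2] times a value of [c] and also [k ^ 2]
    times a value of [d]; for small [k] this contradicts [c0 <> d0]. The form with two real
    variables serves twice: for partial derivatives and for second variations of functionals. *)
Lemma schwarz F a b c d (e c0 d0 : R) : 0 < e ->
  (forall s t : R, `|s| < e -> `|t| < e -> is_derive s (1 : R) (F ^~ t) (a s t)) ->
  (forall s t : R, `|s| < e -> `|t| < e -> is_derive t (1 : R) (F s) (b s t)) ->
  (forall s t : R, `|s| < e -> `|t| < e -> is_derive t (1 : R) (a s) (c s t)) ->
  (forall s t : R, `|s| < e -> `|t| < e -> is_derive s (1 : R) (b ^~ t) (d s t)) ->
  (forall eps : R, 0 < eps -> exists2 del : R, 0 < del & forall s t : R, `|s| < del -> `|t| < del ->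
    `|c s t - c0| < eps /\ `|d s t - d0| < eps) ->
  c0 = d0.
Proof.
move=> e0 Fa Fb ac bd cont; apply: contrapT => /eqP cd.
have n0 : 0 < `|c0 - d0| / 2 by rewrite divr_gt0 // normr_gt0 subr_eq0.
have [del del0 H] := cont _ n0.
(* The half makes the closed square of side [k] lie inside both open neighbourhoods. *)
pose k := Num.min e del / 2.
have m0 : 0 < Num.min e del by rewrite lt_min e0 del0.
have k0 : 0 < k by rewrite divr_gt0.
have km : k < Num.min e del by rewrite /k ltr_pdivrMr // ltr_pMr // ltr1n.
have small s : 0 <= s <= k -> `|s| < e /\ `|s| < del.
  move=> /andP[s0 sk]; rewrite ger0_norm //.
  by have := le_lt_trans sk km; rewrite lt_min => /andP[].
have [|| [s t] /= [sk tk Ec]] := @second_difference F a c k k0.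
- by move=> s t /small[? _] /small[? _]; exact: Fa.
- by move=> s t /small[? _] /small[? _]; exact: ac.
(* The same second difference with the two variables exchanged. *)
have [|| [t' s'] /= [tk' sk' Ed]] :=
  @second_difference (fun t s => F s t) (fun t s => b s t) (fun t s => d s t) k k0.
- by move=> s'' t' /small[? _] /small[? _]; exact: Fb.
- by move=> s'' t' /small[? _] /small[? _]; exact: bd.
have cdE : c s t = d s' t'.
  apply: (@mulIf _ (k ^+ 2)); first by rewrite expf_neq0 // gt_eqF.
  by rewrite -Ec -Ed; ring.
have [_ sd] := small _ sk; have [_ td] := small _ tk.
have [_ sd'] := small _ sk'; have [_ td'] := small _ tk'.
have [H1 _] := H _ _ sd td; have [_ H2] := H _ _ sd' td'.
have : `|c0 - d0| < `|c0 - d0|.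
  rewrite {1}(_ : c0 - d0 = (d s' t' - d0) - (c s t - c0)); last first.
    by rewrite cdE; ring.
  apply: le_lt_trans (ler_normB _ _) _.
  by rewrite [ltRHS]splitr ltrD.
by rewrite ltxx.
Qed.

End Schwarz.

Section PartialsCommute.
Context {R : realType} {n : nat}.

Lemma partialC (U : set 'rV[R]_n) f i j p : open U -> smooth_on U f -> U p ->
  partial i (partial j f) p = partial j (partial i f) p.
Proof.
move=> oU sf Up.
pose line (s t : R) : 'rV[R]_n := p + s *: delta_mx 0 j + t *: delta_mx 0 i.
have line00 : line 0 0 = p by rewrite /line !scale0r !addr0.
have cline : continuous (fun z : R * R => line z.1 z.2).
  move=> z; apply: cvgD; first apply: cvgD; first exact: cvg_cst.
    by apply: cvgZr_tmp; exact: cvg_fst.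
  by apply: cvgZr_tmp; exact: cvg_snd.
have nearline (P : set 'rV[R]_n) : (\forall q \near p, P q) -> exists2 e : R, 0 < e &
    forall s t : R, `|s| < e -> `|t| < e -> P (line s t).
  move=> Pp; have := cline (0, 0) P; rewrite /= line00 => /(_ Pp).
  move=> [[A B] /= [/nbhs_ballP[ea ea0 HA] /nbhs_ballP[eb eb0 HB]] AB].
  exists (Num.min ea eb); first by rewrite lt_min ea0 eb0.
  move=> s t; rewrite !lt_min => /andP[sa _] /andP[_ tb].
  apply: (AB (s, t)); split => /=; [apply: HA|apply: HB];
    by rewrite -ball_normE /ball_ /= sub0r normrN.
have [e e0 He] := nearline _ (open_nbhs_nbhs (conj oU Up)).
have dline1 g (s t : R) : smooth_on U g -> `|s| < e -> `|t| < e ->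
    is_derive s (1 : R) (fun s => g (line s t)) (partial j g (line s t)).
  move=> sg se te.
  have -> : (fun s => g (line s t)) =
      fun s => g ((p + t *: delta_mx 0 i) + s *: delta_mx 0 j).
    by apply/funext => r; rewrite /line addrAC.
  apply: is_derive_line; rewrite -addrA [_ + s *: _]addrC addrA.
  apply: derivableP; apply: diff_derivable.
  exact: smooth_onW sg (He _ _ se te).
have dline2 g (s t : R) : smooth_on U g -> `|s| < e -> `|t| < e ->
    is_derive t (1 : R) (fun t => g (line s t)) (partial i g (line s t)).
  move=> sg se te; apply: is_derive_line.
  apply: derivableP; apply: diff_derivable.
  exact: smooth_onW sg (He _ _ se te).
have sj := smooth_on_partial j sf; have si := smooth_on_partial i sf.
have H1 (s t : R) : `|s| < e -> `|t| < e ->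
  is_derive s (1 : R) (fun s => f (line s t)) (partial j f (line s t)) by exact: dline1.
have H2 (s t : R) : `|s| < e -> `|t| < e ->
  is_derive t (1 : R) (fun t => f (line s t)) (partial i f (line s t)) by exact: dline2.
have H3 (s t : R) : `|s| < e -> `|t| < e -> is_derive t (1 : R)
  (fun t => partial j f (line s t)) (partial i (partial j f) (line s t)) by exact: dline2.
have H4 (s t : R) : `|s| < e -> `|t| < e -> is_derive s (1 : R)
  (fun s => partial i f (line s t)) (partial j (partial i f) (line s t)) by exact: dline1.
apply: (schwarz e0 H1 H2 H3 H4).
move=> eps eps0.
have cc k l : {for p, continuous (partial k (partial l f))}.
  apply: differentiable_continuous.
  by have := smooth_onW (smooth_on_partial k (smooth_on_partial l sf)) Up.
have near_ij k l : \forall q \near p,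
    `|partial k (partial l f) p - partial k (partial l f) q| < eps.
  by move: (cc k l) => /cvgrPdist_lt; apply.
have [d1 d10 K1] := nearline _ (near_ij i j).
have [d2 d20 K2] := nearline _ (near_ij j i).
exists (Num.min d1 d2); first by rewrite lt_min d10 d20.
move=> s t; rewrite !lt_min => /andP[s1 s2] /andP[t1 t2].
by split; rewrite distrC; [exact: K1|exact: K2].
Qed.

End PartialsCommute.

(** * Integrals of continuous functions of bounded support *)

Section Windowed.
Context {R : realType}.
Notation mu := (@lebesgue_measure R).
Implicit Types (f g a b A B K : R -> R) (M x c k : R).

(** A bound [M] common to a whole family gives integrability and estimates that are uniform in the
    parameter. *)
Definition windowed M f := continuous f /\ forall x, M < `|x| -> f x = 0.

Definition itotal f : R := \int[mu]_x f x.

Lemma windowedW M N f : M <= N -> windowed M f -> windowed N f.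
Proof. by move=> MN [cf f0]; split => // x /(le_lt_trans MN); exact: f0. Qed.

Lemma windowedD M f g : windowed M f -> windowed M g -> windowed M (fun x => f x + g x).
Proof.
move=> [cf f0] [cg g0]; split => [x|x Mx]; last by rewrite f0 // g0 // addr0.
by apply: cvgD; [exact: cf|exact: cg].
Qed.

Lemma windowedMl M f g : continuous g -> windowed M f -> windowed M (fun x => g x * f x).
Proof.
move=> cg [cf f0]; split => [x|x Mx]; last by rewrite f0 // mulr0.
by apply: cvgM; [exact: cg|exact: cf].
Qed.

Lemma windowedMr M f g : continuous g -> windowed M f -> windowed M (fun x => f x * g x).
Proof.
move=> cg [cf f0]; split => [x|x Mx]; last by rewrite f0 // mul0r.
by apply: cvgM; [exact: cf|exact: cg].
Qed.

Lemma windowedN M f : windowed M f -> windowed M (fun x => - f x).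
Proof.
move=> [cf f0]; split => [x|x Mx]; last by rewrite f0 // oppr0.
by apply: cvgN; exact: cf.
Qed.

Lemma windowed_restrict M f : windowed M f -> (f \_ `[- M, M]) = f.
Proof.
move=> [cf f0]; apply/funext => x; rewrite patchE; case: ifPn => // xM.
apply/esym/f0; rewrite ltNge; apply: contra xM => xM.
by rewrite inE /= in_itv /= -ler_norml.
Qed.

Lemma windowed_integrable M f : windowed M f -> mu.-integrable setT (EFin \o f).
Proof.
move=> wf; rewrite -(windowed_restrict wf) -restrict_EFin.
apply/integrable_restrict => //; rewrite ?setTI //.
apply: continuous_compact_integrable; first exact: segment_compact.
by apply: continuous_subspaceT; case: wf.
Qed.

Lemma itotal_window M f : windowed M f -> itotal f = \int[mu]_(x in `[- M, M]) f x.
Proof. by move=> wf; rewrite [RHS]Rintegral_mkcond windowed_restrict. Qed.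

Lemma itotalD M f g : windowed M f -> windowed M g ->
  itotal (fun x => f x + g x) = itotal f + itotal g.
Proof. by move=> wf wg; apply: RintegralD => //; apply: windowed_integrable; eassumption. Qed.

Lemma itotalB M f g : windowed M f -> windowed M g ->
  itotal (fun x => f x - g x) = itotal f - itotal g.
Proof. by move=> wf wg; apply: RintegralB => //; apply: windowed_integrable; eassumption. Qed.

Lemma itotalZ M f c : windowed M f -> itotal (fun x => c * f x) = c * itotal f.
Proof. by move=> wf; apply: RintegralZl => //; apply: windowed_integrable; eassumption. Qed.

Lemma itotalN M f : windowed M f -> itotal (fun x => - f x) = - itotal f.
Proof.
move=> wf; rewrite -mulN1r -(itotalZ _ wf); congr itotal.
by apply/funext => x; rewrite mulN1r.
Qed.

Lemma itotal0 : itotal (fun=> 0) = 0.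
Proof.
have w0 : windowed 0 (fun=> 0 : R) by split => // x; exact: cvg_cst.
rewrite (_ : (fun=> 0) = (fun x : R => 0 * 0 : R)); first by rewrite (itotalZ 0 w0) mul0r.
by apply/funext => x; rewrite mul0r.
Qed.

Lemma le_itotal M f c : 0 <= M -> windowed M f -> (forall x, `|f x| <= c) ->
  `|itotal f| <= c * (2 * M).
Proof.
move=> M0 wf fc; rewrite (itotal_window wf).
have intf : mu.-integrable `[- M, M] (EFin \o f).
  by apply: integrableS (windowed_integrable wf).
apply: le_trans (le_normr_Rintegral _ intf) _ => //.
have -> : c * (2 * M) = \int[mu]_(x in `[- M, M]) c.
  rewrite Rintegral_cst //= lebesgue_measure_itv /= lte_fin.
  case: ltP => [_|MM] /=; first by rewrite opprK; ring.
  have -> : M = 0; last by rewrite !mulr0.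
  apply/eqP; rewrite eq_le M0 andbT; lra.
apply: le_Rintegral => //.
  exact: integrable_norm intf.
apply: continuous_compact_integrable; first exact: segment_compact.
by apply: continuous_subspaceT => x; exact: cvg_cst.
Qed.

(** An ordinary primitive shifted by half of the total integral: the derivative and the values at
    both ends are read off from this form. *)
Lemma dx_invE M f x : windowed M f ->
  dx_inv f x = \int[mu]_(y in `]-oo, x]) f y - 2^-1 * itotal f.
Proof.
move=> wf; rewrite /dx_inv.
have intf := windowed_integrable wf.
have H := @Rintegral_itvB R f -oo%O +oo%O x.
rewrite set_itvNyy in H.
have {}H := H intf isT isT.
have -> : \int[mu]_(y in `[x, +oo[) f y = itotal f - \int[mu]_(y in `]-oo, x]) f y.
  rewrite /itotal H Rintegral_itv_obnd_cbnd //.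
  by apply: integrableS intf.
by field.
Qed.

Lemma is_derive_dx_inv M f x : windowed M f -> is_derive x (1 : R) (dx_inv f) (f x).
Proof.
move=> wf; have intf := windowed_integrable wf.
have -> : dx_inv f = (fun x => \int[mu]_(y in `]-oo, x]) f y - 2^-1 * itotal f).
  by apply/funext => y; exact: dx_invE wf.
have [dF Fx] : derivable (fun x => \int[mu]_(y in `]-oo, x]) f y) x 1 /\
    ((fun x => \int[mu]_(y in `]-oo, x]) f y)^`())%classic x = f x.
  apply: (@continuous_FTC1 R f -oo%O x (x + 1)) => //.
  - by rewrite ltrDl.
  - by apply: integrableS intf.
  - exact: ltNyr.
  - by case: wf => cf _; exact: cf.
rewrite -[f x]subr0; apply: is_deriveB.
by rewrite -Fx derive1E; exact: derivableP.
Qed.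

Lemma dx_inv_continuous M f : windowed M f -> continuous (dx_inv f).
Proof.
move=> wf x; apply: differentiable_continuous; apply/derivable1_diffP.
by have [] := is_derive_dx_inv x wf.
Qed.

Lemma dx_inv_right M f x : windowed M f -> M < x -> dx_inv f x = 2^-1 * itotal f.
Proof.
move=> wf Mx; rewrite (dx_invE _ wf).
suff -> : \int[mu]_(y in `]-oo, x]) f y = itotal f by field.
rewrite Rintegral_mkcond /itotal; congr Rintegral; apply/funext => y.
rewrite patchE; case: ifPn => // yx; apply/esym; case: wf => _; apply.
move: yx; rewrite notin_setE /= in_itv /= => /negP; rewrite -ltNge => xy.
by apply: lt_le_trans (ler_norm _); exact: lt_trans xy.
Qed.

Lemma dx_inv_left M f x : windowed M f -> x < - M -> dx_inv f x = - (2^-1 * itotal f).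
Proof.
move=> wf Mx; rewrite (dx_invE _ wf).
suff -> : \int[mu]_(y in `]-oo, x]) f y = 0 by rewrite sub0r.
rewrite Rintegral_mkcond -[RHS]itotal0; congr Rintegral; apply/funext => y.
rewrite patchE; case: ifPn => // yx; case: wf => _; apply.
move: yx; rewrite inE /= in_itv /= => yx.
rewrite -normrN; apply: lt_le_trans (ler_norm _).
by rewrite ltrNr; exact: le_lt_trans Mx.
Qed.

Lemma itotal_derivative M f k K : windowed M f ->
  (forall x, is_derive x (1 : R) K (f x)) ->
  (forall x, M < `|x| -> K x = k) -> itotal f = 0.
Proof.
move=> wf dK Kk.
(* [M] may be negative; [N] is positive and both [N] and [- N] lie strictly outside the window. *)
pose N := `|M| + 1.
have MN : M < N by apply: le_lt_trans (ler_norm M) _; rewrite ltrDl.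
have N0 : 0 < N by apply: lt_le_trans ltr01 _; rewrite lerDr.
rewrite (itotal_window (windowedW (ltW MN) wf)).
have NN : - N < N by rewrite gtrN.
have cK : continuous K.
  by move=> x; apply: differentiable_continuous; apply/derivable1_diffP; have [] := dK x.
rewrite /Rintegral (@continuous_FTC2 _ f K) //.
- have -> : K N = K (- N) by rewrite !Kk // ltr_normr ?opprK MN ?orbT.
  by rewrite -EFinB /= subrr.
- by apply: continuous_subspaceT; case: wf.
- split.
  + by move=> x _; have [] := dK x.
  + exact/cvg_at_right_filter/cK.
  + exact/cvg_at_left_filter/cK.
- by move=> x _; rewrite derive1E derive_val.
Qed.

Lemma itotal_parts M a b A B : windowed M a -> windowed M b ->
  (forall x, is_derive x (1 : R) A (a x)) ->
  (forall x, is_derive x (1 : R) B (b x)) ->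
  (exists k, forall x, M < `|x| -> A x * B x = k) ->
  itotal (fun x => a x * B x) = - itotal (fun x => A x * b x).
Proof.
move=> wa wb dA dB [k AB].
have cA : continuous A.
  by move=> x; apply: differentiable_continuous; apply/derivable1_diffP; have [] := dA x.
have cB : continuous B.
  by move=> x; apply: differentiable_continuous; apply/derivable1_diffP; have [] := dB x.
have w1 := windowedMr cB wa; have w2 := windowedMl cA wb.
apply/eqP; rewrite -addr_eq0 -(itotalD w1 w2); apply/eqP.
apply: itotal_derivative (windowedD w1 w2) _ AB => x.
by have := is_deriveM (dA x) (dB x); rewrite /GRing.scale /= addrC [B x * _]mulrC.
Qed.

(** At the right end both primitives equal half of their totals, at the left end minus half. The
    product is the same at both ends, which is the boundary condition of [itotal_parts]. *)
Lemma dx_inv_skew M a b : windowed M a -> windowed M b ->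
  itotal (fun x => a x * dx_inv b x) = - itotal (fun x => dx_inv a x * b x).
Proof.
move=> wa wb; apply: (itotal_parts wa wb).
- by move=> x; exact: is_derive_dx_inv wa.
- by move=> x; exact: is_derive_dx_inv wb.
exists (2^-1 * itotal a * (2^-1 * itotal b)); move=> x; rewrite ltr_normr => /orP[Mx|].
  by rewrite (dx_inv_right wa Mx) (dx_inv_right wb Mx).
rewrite ltrNr => xM; rewrite (dx_inv_left wa xM) (dx_inv_left wb xM); ring.
Qed.

Lemma dx_invD M f g x : windowed M f -> windowed M g ->
  dx_inv (fun y => f y + g y) x = dx_inv f x + dx_inv g x.
Proof.
move=> wf wg; rewrite (dx_invE _ wf) (dx_invE _ wg) (dx_invE _ (windowedD wf wg)).
rewrite (itotalD wf wg) RintegralD //; first by ring.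
  by apply: integrableS (windowed_integrable wf).
by apply: integrableS (windowed_integrable wg).
Qed.

Lemma dx_invZ M f c x : windowed M f ->
  dx_inv (fun y => c * f y) x = c * dx_inv f x.
Proof.
move=> wf; have wcf : windowed M (fun y => c * f y).
  by apply: (@windowedMl M f (fun=> c)) => // y; exact: cvg_cst.
rewrite (dx_invE _ wf) (dx_invE _ wcf) (itotalZ _ wf) RintegralZl //; first by ring.
by apply: integrableS (windowed_integrable wf).
Qed.

(** The integral up to [x] contributes [2 * M], the subtracted half of the total another [M]. *)
Lemma le_dx_inv M f c x : 0 <= M -> windowed M f -> (forall x, `|f x| <= c) ->
  `|dx_inv f x| <= c * (3 * M).
Proof.
move=> M0 wf fc; rewrite (dx_invE _ wf).
have c0 : 0 <= c := le_trans (normr_ge0 _) (fc 0).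
have H1 := le_itotal M0 wf fc.
suff H2 : `|\int[mu]_(y in `]-oo, x]) f y| <= c * (2 * M).
  apply: le_trans (ler_normB _ _) _.
  rewrite normrM ger0_norm ?invr_ge0 //.
  move: H1 H2; move: `|_| `|_| => a b H1 H2; clear wf fc; lra.
have intf := windowed_integrable wf.
have intx : mu.-integrable `]-oo, x] (EFin \o f) by apply: integrableS intf.
apply: le_trans (le_normr_Rintegral _ intx) _ => //.
have wnf : windowed M (fun x => `|f x|).
  case: wf => cf f0; split => [y|y My]; last by rewrite f0 // normr0.
  by apply: cvg_norm; exact: cf.
have := le_itotal M0 wnf; rewrite (_ : `|itotal (fun x => `|f x|)| = itotal (fun x => `|f x|)); last first.
  by rewrite ger0_norm //; apply: Rintegral_ge0.
move=> /(_ c) H; apply: le_trans (H _); last by move=> y; rewrite normr_id.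
rewrite Rintegral_mkcond; apply: le_Rintegral => //.
- by rewrite -restrict_EFin; apply/integrable_restrict => //; rewrite setTI;
    apply: integrable_norm intx.
- exact: windowed_integrable wnf.
- by move=> y _; rewrite patchE; case: ifP => _ /=; [exact: lexx|exact: normr_ge0].
Qed.

End Windowed.

(** * Differentiation under the integral *)

Section UniformDerivative.
Context {R : realType}.
Implicit Types (f g fs : R -> R -> R) (df dg : R -> R) (M e c s x : R).

(** Differentiability at [s = 0] with a remainder estimate independent of [x], the form that
    survives [dx_inv] and integration over a window. *)
Definition uniform_derivative f df := forall e, 0 < e ->
  \forall s \near (0 : R), forall x, `|f s x - f 0 x - s * df x| <= e * `|s|.

Lemma MVT_from0 (phi dphi : R -> R) s :
  (forall r : R, `|r| <= `|s| -> is_derive r (1 : R) phi (dphi r)) ->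
  exists2 r : R, `|r| <= `|s| & phi s - phi 0 = dphi r * s.
Proof.
move=> dphiE.
have cphi (I : interval R) : (forall r, r \in I -> `|r| <= `|s|) ->
    {within [set` I], continuous phi}.
  by move=> Is; apply: derivable_within_continuous => r /Is /dphiE [].
case: (ltgtP 0 s) => [s0|s0|<-]; last first.
- by exists 0; rewrite ?normr0 // subrr mulr0.
- have small r : s <= r -> r <= 0 -> `|r| <= `|s|.
    by move=> sr r0; rewrite !ler0_norm ?(ltW s0) // lerN2.
  have [r /itvP rI E] : exists2 r : R, r \in `]s, 0[ & phi 0 - phi s = dphi r * (0 - s).
    apply: MVT => //; first by move=> r /itvP rI; apply: dphiE; apply: small; rewrite rI.
    by apply: cphi => r /itvP rI; apply: small; rewrite rI.
  by exists r; [apply: small; rewrite rI|rewrite -opprB E sub0r mulrN opprK].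
- have small r : 0 <= r -> r <= s -> `|r| <= `|s|.
    by move=> r0 rs; rewrite !ger0_norm // ltW.
  have [r /itvP rI E] : exists2 r : R, r \in `]0, s[ & phi s - phi 0 = dphi r * (s - 0).
    apply: MVT => //; first by move=> r /itvP rI; apply: dphiE; apply: small; rewrite rI.
    by apply: cphi => r /itvP rI; apply: small; rewrite rI.
  by exists r; [apply: small; rewrite rI|rewrite E subr0].
Qed.

Lemma near0_small (P : R -> Prop) : (\forall s \near (0 : R), P s) ->
  exists2 d : R, 0 < d & forall s, `|s| < d -> P s.
Proof.
move=> /nbhs_ballP[d d0 H]; exists d => // s sd; apply: H.
by rewrite -ball_normE /ball_ /= sub0r normrN.
Qed.

Lemma small_near0 (P : R -> Prop) (d : R) : 0 < d -> (forall s, `|s| < d -> P s) ->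
  \forall s \near (0 : R), P s.
Proof.
move=> d0 H; apply/nbhs_ballP; exists d => // s.
by rewrite -ball_normE /ball_ /= sub0r normrN; exact: H.
Qed.

Section FromC1.
Variables (M e : R) (f fs : R -> R -> R).
Hypothesis e0 : 0 < e.
Hypothesis f0 : forall s x, `|s| < e -> M < `|x| -> f s x = 0.
Hypothesis dfs : forall s x, `|s| < e -> is_derive s (1 : R) (f ^~ x) (fs s x).
Hypothesis cfs : forall x, {for (0, x), continuous (fun z : R * R => fs z.1 z.2)}.

Lemma C1_outside x : M < `|x| -> fs 0 x = 0.
Proof.
move=> Mx; have e00 : `|(0 : R)| < e by rewrite normr0.
have [_ <-] := dfs x e00.
rewrite (@near_eq_derive _ _ _ _ (cst 0)) ?derive_cst //.
by apply: (small_near0 e0) => s se; exact: f0.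
Qed.

Lemma C1_windowed : windowed M (fs 0).
Proof.
split=> [x|x]; last exact: C1_outside.
apply/cvgrPdist_lt => eps eps0.
have := @cfs x => /cvgrPdist_lt/(_ _ eps0) [[A B] /= [nA nB] AB].
by apply: filterS nB => y By; exact: (AB (0, y) (conj (nbhs_singleton nA) By)).
Qed.

(** By compactness of the window, the local estimates at the points [(0, x)] share one neighbourhood
    of [s = 0]. *)
Lemma C1_uniform_continuity (eps : R) : 0 < eps ->
  \forall s \near (0 : R), forall x, `[- M, M]%classic x -> `|fs s x - fs 0 x| <= eps.
Proof.
move=> eps0.
have K : near_covering `[- M, M]%classic by apply/compact_near_coveringP/segment_compact.
apply: (K R (nbhs (0 : R)) (fun s x => `|fs s x - fs 0 x| <= eps)) => // x _.
have e20 : 0 < eps / 2 by rewrite divr_gt0.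
have := @cfs x => /cvgrPdist_lt/(_ _ e20) [[A B] /= [nA nB] AB].
exists (B, A) => //= -[y s] [/= By As].
have H1 := AB (s, y) (conj As By); have H2 := AB (0, y) (conj (nbhs_singleton nA) By).
rewrite /= in H1 H2.
have -> : fs s y - fs 0 y = (fs 0 x - fs 0 y) - (fs 0 x - fs s y) by ring.
apply: le_trans (ler_normB _ _) _; apply: ltW.
by rewrite [ltRHS]splitr ltrD.
Qed.

(** By the mean value theorem the remainder is [s * (fs r x - fs 0 x)] with [|r| <= |s|], and [fs]
    is uniformly close to its value at [0] on the window. *)
Lemma C1_uniform_derivative : uniform_derivative f (fs 0).
Proof.
move=> eps eps0.
have [d d0 H] := near0_small (C1_uniform_continuity eps0).
have m0 : 0 < Num.min d e by rewrite lt_min d0 e0.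
apply: (small_near0 m0) => s; rewrite lt_min => /andP[sd se] x.
have [Mx|xM] := ltP M `|x|.
  rewrite (f0 se Mx) f0 ?normr0 // C1_outside //.
  by rewrite mulr0 !subr0 normr0 mulr_ge0 // ltW.
have [r rs ->] : exists2 r : R, `|r| <= `|s| & f s x - f 0 x = fs r x * s.
  apply: (@MVT_from0 (f ^~ x) (fs ^~ x)) => r rs.
  by apply: dfs; exact: le_lt_trans se.
rewrite [s * _]mulrC -mulrBl normrM ler_wpM2r //.
apply: H; first exact: le_lt_trans sd.
by rewrite /= in_itv /= -ler_norml.
Qed.

End FromC1.

Lemma uniform_derivativeD f (f' : R -> R) g (g' : R -> R) : uniform_derivative f f' ->
  uniform_derivative g g' ->
  uniform_derivative (fun s x => f s x + g s x) (fun x => f' x + g' x).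
Proof.
move=> uf ug e e0; have e20 : 0 < e / 2 by rewrite divr_gt0.
have H1 := uf _ e20; have H2 := ug _ e20.
apply: filterS2 H1 H2 => s H1 H2 x.
have -> : f s x + g s x - (f 0 x + g 0 x) - s * (f' x + g' x) =
  (f s x - f 0 x - s * f' x) + (g s x - g 0 x - s * g' x) by ring.
apply: le_trans (ler_normD _ _) _.
by rewrite (splitr e) mulrDl lerD.
Qed.

Lemma uniform_derivativeM c f (f' : R -> R) g (g' : R -> R) :
  (forall x, `|f 0 x| <= c) -> (forall x, `|f' x| <= c) ->
  (forall x, `|g 0 x| <= c) -> (forall x, `|g' x| <= c) ->
  uniform_derivative f f' -> uniform_derivative g g' ->
  uniform_derivative (fun s x => f s x * g s x) (fun x => f' x * g 0 x + f 0 x * g' x).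
Proof.
move=> fc f'c gc g'c uf ug e e0.
have c0 : 0 <= c := le_trans (normr_ge0 _) (fc 0).
(* The coefficients of the three error terms estimated below are [c ^ 2], [2 * c + 1] and [2 * c];
   [k] is their sum. *)
pose k := c ^+ 2 + 4 * c + 1.
have k0 : 0 < k by rewrite /k; have := sqr_ge0 c; lra.
pose d := Num.min 1 (e / k).
have d0 : 0 < d by rewrite lt_min ltr01 divr_gt0.
have d1 : d <= 1 by rewrite ge_min lexx.
have dk : d * k <= e by rewrite -ler_pdivlMr // ge_min lexx orbT.
have H1 := uf _ d0; have H2 := ug _ d0.
have H3 : \forall s \near (0 : R), `|s| < d by apply: (small_near0 d0).
apply: filterS3 H1 H2 H3 => s H1 H2 sd x.
have {}H1 := H1 x; have {}H2 := H2 x.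
set r := f s x - f 0 x - s * f' x in H1; set q := g s x - g 0 x - s * g' x in H2.
have -> : f s x * g s x - f 0 x * g 0 x - s * (f' x * g 0 x + f 0 x * g' x) =
    s * (s * (f' x * g' x)) + r * (g 0 x + s * g' x + q) + q * (f 0 x + s * f' x).
  by rewrite /r /q; ring.
have s1 : `|s| <= 1 by apply: le_trans (ltW sd) d1.
have sc (a : R) : `|a| <= c -> `|s * a| <= c.
  by move=> ac; rewrite normrM -[c]mul1r ler_pM.
have q1 : `|q| <= 1 by apply: le_trans H2 _; rewrite -[1]mulr1 ler_pM // ltW.
have B1 : `|s * (s * (f' x * g' x))| <= `|s| * (d * c ^+ 2).
  rewrite normrM ler_wpM2l // !normrM expr2 ler_pM ?mulr_ge0 //; first exact: ltW.
  by rewrite ler_pM.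
have B2 : `|r * (g 0 x + s * g' x + q)| <= (d * `|s|) * (2 * c + 1).
  rewrite normrM ler_pM //; apply: le_trans (ler_normD _ _) _; rewrite lerD //.
  apply: le_trans (ler_normD _ _) _.
  by rewrite (_ : 2 * c = c + c) ?lerD ?sc //; ring.
have B3 : `|q * (f 0 x + s * f' x)| <= (d * `|s|) * (2 * c).
  rewrite normrM ler_pM //; apply: le_trans (ler_normD _ _) _.
  by rewrite (_ : 2 * c = c + c) ?lerD ?sc //; ring.
apply: le_trans (ler_normD _ _) _.
apply: le_trans (lerD (ler_normD _ _) (lexx _)) _.
apply: le_trans (lerD (lerD B1 B2) B3) _.
have -> : `|s| * (d * c ^+ 2) + d * `|s| * (2 * c + 1) + d * `|s| * (2 * c) =
  (d * k) * `|s| by rewrite /k; ring.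
by rewrite ler_wpM2r.
Qed.

Lemma windowed_difference M f (f' : R -> R) s : windowed M (f s) -> windowed M (f 0) ->
  windowed M f' -> windowed M (fun x => f s x - f 0 x - s * f' x).
Proof.
move=> ws w0 w'; apply: windowedD.
  by apply: windowedD => //; exact: windowedN.
by apply/windowedN/windowedMl => // x; exact: cvg_cst.
Qed.

(** On functions with a common window [dx_inv] is linear and bounded, so it sends a uniform
    remainder to a uniform remainder. *)
Lemma uniform_derivative_dx_inv M f (f' : R -> R) : 0 <= M ->
  (\forall s \near (0 : R), windowed M (f s)) -> windowed M f' ->
  uniform_derivative f f' ->
  uniform_derivative (fun s => dx_inv (f s)) (dx_inv f').
Proof.
move=> M0 wf w' uf e e0.
have w0 := nbhs_singleton wf.
(* [3 * M] is the constant of [le_dx_inv]; adding [1] keeps the divisor positive when [M = 0]. *)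
have k0 : 0 < 3 * M + 1 by lra.
have d0 : 0 < e / (3 * M + 1) by rewrite divr_gt0.
have H := uf _ d0.
apply: filterS2 wf H => s ws H x.
have wsf' : windowed M (fun x => s * f' x) by apply: windowedMl => // y; exact: cvg_cst.
have -> : dx_inv (f s) x - dx_inv (f 0) x - s * dx_inv f' x =
    dx_inv (fun x => f s x - f 0 x - s * f' x) x.
  rewrite (dx_invD x (windowedD ws (windowedN w0)) (windowedN wsf')).
  rewrite (dx_invD x ws (windowedN w0)).
  have oppE (g : R -> R) : windowed M g -> dx_inv (fun y => - g y) x = - dx_inv g x.
    move=> wg; rewrite -mulN1r -(dx_invZ (-1) x wg); congr dx_inv.
    by apply/funext => y; rewrite mulN1r.
  by rewrite !oppE // (dx_invZ s x w').
apply: le_trans (le_dx_inv x M0 (windowed_difference ws w0 w') H) _.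
rewrite mulrAC ler_wpM2r // mulrAC -mulrA ger_pMr //.
rewrite ler_pdivrMr // mul1r lerDl ler01 //.
Qed.

Lemma is_derive0_approx (F : R -> R) (L : R) :
  (forall e : R, 0 < e -> \forall s \near (0 : R), `|F s - F 0 - s * L| <= e * `|s|) ->
  is_derive (0 : R) (1 : R) F L.
Proof.
move=> H.
have cv : (fun h : R => h^-1 *: ((F \o shift 0) (h *: (1 : R)) - F 0)) @ 0^' --> L.
  apply/cvgrPdist_le => e e0; have He := H _ e0.
  near=> h.
  have h0 : h != 0 by near: h; exact: nbhs_dnbhs_neq.
  rewrite /= addr0 [h *: (1 : R)]mulr1.
  have -> : L - h^-1 *: (F h - F 0) = - (h^-1 * (F h - F 0 - h * L)).
    by rewrite /GRing.scale /=; field.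
  rewrite normrN normrM normfV ler_pdivrMl ?normr_gt0 // [leRHS]mulrC.
  by near: h; apply: nbhs_dnbhs; exact: He.
by split; [apply/cvg_ex; exists L|exact: cvg_lim cv].
Unshelve. all: by end_near. Qed.

Lemma is_derive_itotal M f (f' : R -> R) : 0 <= M ->
  (\forall s \near (0 : R), windowed M (f s)) -> windowed M f' ->
  uniform_derivative f f' ->
  is_derive (0 : R) (1 : R) (fun s => itotal (f s)) (itotal f').
Proof.
move=> M0 wf w' uf; apply: is_derive0_approx => e e0.
have w0 := nbhs_singleton wf.
have k0 : 0 < 2 * M + 1 by lra.
have d0 : 0 < e / (2 * M + 1) by rewrite divr_gt0.
have H := uf _ d0.
apply: filterS2 wf H => s ws H.
have wsf' : windowed M (fun x => s * f' x) by apply: windowedMl => // y; exact: cvg_cst.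
have -> : itotal (f s) - itotal (f 0) - s * itotal f' =
    itotal (fun x => f s x - f 0 x - s * f' x).
  rewrite (itotalB (windowedD ws (windowedN w0)) wsf').
  by rewrite (itotalB ws w0) (itotalZ s w').
apply: le_trans (le_itotal M0 (windowed_difference ws w0 w') H) _.
rewrite mulrAC ler_wpM2r // mulrAC -mulrA ger_pMr //.
rewrite ler_pdivrMr // mul1r lerDl ler01 //.
Qed.

Lemma windowed_bounded M (f' : R -> R) : windowed M f' -> exists2 c : R, 0 <= c & forall x, `|f' x| <= c.
Proof.
move=> [cf f0].
have [MM|MM] := leP (- M) M; last first.
  exists 0 => // x; rewrite f0 ?normr0 //; apply: lt_le_trans (normr_ge0 x).
  by move: MM; clear; lra.
have [c _ H] : exists2 c : R, c \in `[- M, M] & forall t, t \in `[- M, M] -> `|f' t| <= `|f' c|.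
  apply: (@EVT_max R (fun x => `|f' x|)) => //; apply: continuous_subspaceT => x.
  by apply: cvg_norm; exact: cf.
exists `|f' c| => // x; have [Mx|xM] := ltP M `|x|; first by rewrite f0 ?normr0.
by apply: H; rewrite in_itv /= -ler_norml.
Qed.

Lemma dx_inv_bounded M (f' : R -> R) : 0 <= M -> windowed M f' ->
  exists2 c : R, 0 <= c & forall x, `|dx_inv f' x| <= c.
Proof.
move=> M0 wf; have [c c0 fc] := windowed_bounded wf.
by exists (c * (3 * M)); [rewrite !mulr_ge0|move=> x; exact: le_dx_inv].
Qed.

End UniformDerivative.

(** * Directional derivatives of matrices *)

Section MatrixDerivative.
Context {R : realType} {W : normedModType R}.
Implicit Types (p v : W).

(* Entrywise; differentiability is part of it because of the chain rule. *)
Definition mderiv p v (a b : nat) (M : W -> 'M[R]_(a, b)) (M' : 'M[R]_(a, b)) :=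
  forall i j, differentiable (fun q => M q i j) p /\ 'D_v (fun q => M q i j) p = M' i j.

Definition sderiv p v (f : W -> R) (f' : R) := differentiable f p /\ 'D_v f p = f'.

Lemma sderiv_is_derive p v (f : W -> R) (f' : R) :
  sderiv p v f f' -> is_derive p v f f'.
Proof. by move=> [df <-]; apply/derivableP/diff_derivable. Qed.

Lemma sderiv_eq p v f f' f'' : f' = f'' -> sderiv p v f f' -> sderiv p v f f''.
Proof. by move->. Qed.

Lemma sderiv_cst p v (c : R) : sderiv p v (fun=> c) 0.
Proof. by split; [exact: differentiable_cst|exact: derive_cst]. Qed.

Lemma sderivD p v f f' g g' : sderiv p v f f' -> sderiv p v g g' ->
  sderiv p v (fun q => f q + g q) (f' + g').
Proof.
move=> [df <-] [dg <-]; split; first exact: differentiableD.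
by rewrite deriveD //; exact: diff_derivable.
Qed.

Lemma sderivN p v f f' : sderiv p v f f' -> sderiv p v (fun q => - f q) (- f').
Proof.
move=> [df <-]; split; first exact: differentiableN.
by rewrite deriveN //; exact: diff_derivable.
Qed.

Lemma sderivB p v f f' g g' : sderiv p v f f' -> sderiv p v g g' ->
  sderiv p v (fun q => f q - g q) (f' - g').
Proof. by move=> df dg; apply: sderivD => //; exact: sderivN. Qed.

Lemma sderivM p v f f' g g' : sderiv p v f f' -> sderiv p v g g' ->
  sderiv p v (fun q => f q * g q) (f' * g p + f p * g').
Proof.
move=> [df <-] [dg <-]; split; first exact: differentiableM.
rewrite deriveM; try exact: diff_derivable.
by rewrite /GRing.scale /= addrC [g p * _]mulrC.
Qed.

Lemma sderivV p v f f' : f p != 0 -> sderiv p v f f' ->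
  sderiv p v (fun q => (f q)^-1) (- (f p) ^- 2 * f').
Proof.
move=> f0 [df <-]; split; first exact: differentiableV.
by rewrite deriveV //; exact: diff_derivable.
Qed.

Lemma sderiv_sum (I : finType) p v (f : I -> W -> R) (f' : I -> R) :
  (forall i, sderiv p v (f i) (f' i)) ->
  sderiv p v (fun q => \sum_i f i q) (\sum_i f' i).
Proof.
move=> df; elim: (index_enum I) => [|i r IH].
  rewrite big_nil (_ : (fun q => _) = fun=> 0); first exact: sderiv_cst.
  by apply/funext => q; rewrite big_nil.
rewrite big_cons (_ : (fun q => _) = fun q => f i q + \sum_(i <- r) f i q).
  exact: sderivD.
by apply/funext => q; rewrite big_cons.
Qed.

Lemma sderiv_near p v f g f' : (\forall q \near p, f q = g q) ->
  sderiv p v f f' -> sderiv p v g f'.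
Proof.
move=> fg [df <-]; split; first exact: near_eq_differentiable df.
by apply: near_eq_derive; apply: filterS fg => q.
Qed.

Section Fixed.
Variables (a b : nat).
Implicit Types (M N : W -> 'M[R]_(a, b)) (D E : 'M[R]_(a, b)).

Lemma mderiv_eq p v M D D' : D = D' -> mderiv p v M D -> mderiv p v M D'.
Proof. by move->. Qed.

(** Several identities below are obtained by computing the derivative of one function in two
    ways. *)
Lemma mderiv_unique p v M D D' : mderiv p v M D -> mderiv p v M D' -> D = D'.
Proof. by move=> H1 H2; apply/matrixP => i j; have [_ <-] := H1 i j; have [_ <-] := H2 i j. Qed.

Lemma mderiv_cst p v (A : 'M[R]_(a, b)) : mderiv p v (fun=> A) 0.
Proof. by move=> i j; rewrite mxE; exact: sderiv_cst. Qed.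

Lemma mderiv_near p v M N D : (\forall q \near p, M q = N q) ->
  mderiv p v M D -> mderiv p v N D.
Proof.
by move=> MN dM i j; apply: sderiv_near (dM i j); apply: filterS MN => q ->.
Qed.

Lemma mderivD p v M D N E : mderiv p v M D -> mderiv p v N E ->
  mderiv p v (fun q => M q + N q) (D + E).
Proof.
move=> dM dN i j; rewrite mxE; under eq_fun do rewrite mxE.
exact: sderivD (dM i j) (dN i j).
Qed.

Lemma mderivN p v M D : mderiv p v M D -> mderiv p v (fun q => - M q) (- D).
Proof.
move=> dM i j; rewrite mxE; under eq_fun do rewrite mxE.
exact: sderivN (dM i j).
Qed.

Lemma mderivB p v M D N E : mderiv p v M D -> mderiv p v N E ->
  mderiv p v (fun q => M q - N q) (D - E).
Proof. by move=> dM dN; apply: mderivD => //; exact: mderivN. Qed.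

Lemma mderivZ p v f f' M D : sderiv p v f f' -> mderiv p v M D ->
  mderiv p v (fun q => f q *: M q) (f' *: M p + f p *: D).
Proof.
move=> df dM i j; rewrite !mxE; under eq_fun do rewrite mxE.
exact: sderivM df (dM i j).
Qed.

Lemma mderivT p v M D : mderiv p v M D -> mderiv p v (fun q => (M q)^T) D^T.
Proof. by move=> dM i j; rewrite mxE; under eq_fun do rewrite mxE; exact: dM. Qed.

End Fixed.

Lemma mderivM p v a b c (M : W -> 'M[R]_(a, b)) M' (N : W -> 'M[R]_(b, c)) N' :
  mderiv p v M M' -> mderiv p v N N' ->
  mderiv p v (fun q => M q *m N q) (M' *m N p + M p *m N').
Proof.
move=> dM dN i j; rewrite !mxE -big_split /=; under eq_fun do rewrite mxE.
by apply: sderiv_sum => k; exact: sderivM (dM i k) (dN k j).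
Qed.

Lemma sderiv_mderiv p v (M : W -> 'M[R]_1) M' :
  mderiv p v M M' -> sderiv p v (fun q => M q 0 0) (M' 0 0).
Proof. exact. Qed.

Lemma mderiv_scalar p v f f' n : sderiv p v f f' ->
  mderiv p v (fun q => (f q)%:M : 'M[R]_n) f'%:M.
Proof.
move=> df i j; rewrite mxE; under eq_fun do rewrite mxE.
by case: (i == j); [exact: df|exact: sderiv_cst].
Qed.

Lemma mderiv_comp p v n (phi : W -> 'rV[R]_n) (v' : 'rV[R]_n)
    a b (M : 'rV[R]_n -> 'M[R]_(a, b)) (M' : 'M[R]_(a, b)) : mderiv p v phi v' ->
  (forall i j, differentiable (fun q => M q i j) (phi p)) ->
  (forall i j, \sum_k v' 0 k * partial k (fun q => M q i j) (phi p) = M' i j) ->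
  mderiv p v (M \o phi) M'.
Proof.
move=> dphi dM ME i j; split.
  by apply: (@differentiable_comp_rV _ _ _ phi (fun q => M q i j)) => // k; have [] := dphi 0 k.
rewrite -ME -[LHS]/('D_v ((fun q => M q i j) \o phi) p) derive_comp_rV //; last first.
  by move=> k; have [] := dphi 0 k.
by apply: eq_bigr => k _; have [_ ->] := dphi 0 k; rewrite mulrC.
Qed.

End MatrixDerivative.

Section Directional.
Context {R : realType} {n : nat}.
Implicit Types (p v : 'rV[R]_n).

Lemma mderiv_id p v : mderiv p v (fun q => q) v.
Proof.
move=> i j; rewrite ord1; split; first exact: differentiable_coord.
have := @derive_mx _ _ 1 n (fun q : 'rV[R]_n => q) p v (@derivable_id _ _ p v).
by rewrite derive_id => /matrixP/(_ 0 j); rewrite mxE.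
Qed.

Lemma derive_partial f p v : differentiable f p ->
  'D_v f p = \sum_k v 0 k * partial k f p.
Proof.
move=> df; rewrite -[f in LHS]/(f \o id) derive_comp_rV //; last first.
  by move=> j; exact: differentiable_coord.
apply: eq_bigr => k _; rewrite mulrC; congr (_ * _).
by have [_] := mderiv_id p v 0 k.
Qed.

Lemma sderiv_partial f p v : differentiable f p ->
  sderiv p v f (\sum_k v 0 k * partial k f p).
Proof. by move=> df; split => //; exact: derive_partial. Qed.

Lemma sderiv_gradient f p v : differentiable f p ->
  sderiv p v f ((v *m (gradient f p)^T) 0 0).
Proof.
move=> df; apply: sderiv_eq (sderiv_partial _ df).
by rewrite mxE; apply: eq_bigr => k _; rewrite !mxE.
Qed.

Lemma mderiv_chain (W : normedModType R) (q w : W) (phi : W -> 'rV[R]_n) v'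
    a b (M : 'rV[R]_n -> 'M[R]_(a, b)) M' : mderiv q w phi v' ->
  mderiv (phi q) v' M M' -> mderiv q w (M \o phi) M'.
Proof.
move=> dphi dM; apply: (mderiv_comp dphi) => i j; have [d E] := dM i j => //.
by rewrite -E derive_partial.
Qed.

Lemma sderiv_chain (W : normedModType R) (q w : W) (phi : W -> 'rV[R]_n) v'
    (f : 'rV[R]_n -> R) f' : mderiv q w phi v' ->
  sderiv (phi q) v' f f' -> sderiv q w (f \o phi) f'.
Proof.
move=> dphi [df <-].
have dF : mderiv (phi q) v' (fun r => (f r)%:M : 'M[R]_1) ('D_v' f (phi q))%:M.
  by apply: mderiv_scalar; split.
have := mderiv_chain dphi dF 0 0; rewrite mxE eqxx mulr1n.
by under eq_fun do rewrite /= mxE eqxx mulr1n.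
Qed.

End Directional.

(** * The Levi-Civita connection in matrix form *)

Section Metric.
Context {R : realType} {n : nat}.
Variables (U : set 'rV[R]_n) (g : 'rV[R]_n -> 'M[R]_n).
Hypotheses (oU : open U) (mg : metric_on U g).
Implicit Types (p v y : 'rV[R]_n).

Lemma near_on (P : 'rV[R]_n -> Prop) p : U p -> (forall q, U q -> P q) ->
  \forall q \near p, P q.
Proof. by move=> Up UP; near=> q; apply: UP; near: q; exact: open_nbhs_nbhs.
Unshelve. all: by end_near. Qed.

Lemma metric_trmx p : U p -> (g p)^T = g p.
Proof. by case: mg => _ /(_ p) H /H []. Qed.

Lemma metric_unit p : U p -> g p \in unitmx.
Proof. by case: mg => _ /(_ p) H /H []. Qed.

Lemma metric_lower p : U p -> g p *m lower g p = 1%:M.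
Proof. by move=> Up; rewrite /lower mulmxV // metric_unit. Qed.

Lemma lower_metric p : U p -> lower g p *m g p = 1%:M.
Proof. by move=> Up; rewrite /lower mulVmx // metric_unit. Qed.

Lemma lower_sym p : U p -> (lower g p)^T = lower g p.
Proof. by move=> Up; rewrite /lower trmx_inv metric_trmx. Qed.

Lemma lowerC p i j : U p -> lower g p i j = lower g p j i.
Proof. by move=> Up; rewrite -{1}(lower_sym Up) mxE. Qed.

Lemma smooth_metric i j : smooth_on U (fun q => g q i j).
Proof. by case: mg. Qed.

Lemma smooth_lower i j : smooth_on U (fun q => lower g q i j).
Proof. by apply: smooth_on_invmx => //; [exact: metric_unit|exact: smooth_metric]. Qed.

Lemma partial_lowerC i j k p : U p ->
  partial k (fun q => lower g q i j) p = partial k (fun q => lower g q j i) p.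
Proof. by move=> Up; apply: (partial_eq_on k oU _ Up) => q Uq; exact: lowerC. Qed.

Lemma smooth_christoffel j s k : smooth_on U (christoffel g j s k).
Proof.
apply: smooth_onM => //; first exact: smooth_on_cst.
apply: smooth_on_sum => // l _; apply: smooth_onM => //; first exact: smooth_metric.
by apply: smooth_onB => //; first apply: smooth_onD => //;
  apply/smooth_on_partial/smooth_lower.
Qed.

Lemma christoffelC j s k p : U p -> christoffel g j s k p = christoffel g j k s p.
Proof.
move=> Up; rewrite /christoffel; congr (_ * _); apply: eq_bigr => l _; congr (_ * _).
by rewrite (partial_lowerC s k l Up); ring.
Qed.

(** The Christoffel symbols of the first kind: the contravariant metric in the definition is
    cancelled by the covariant one. *)
Lemma lower_christoffel a k m p : U p ->
  \sum_i lower g p a i * christoffel g i k m p =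
  2^-1 * (partial k (fun q => lower g q a m) p + partial m (fun q => lower g q a k) p
          - partial a (fun q => lower g q k m) p).
Proof.
move=> Up; rewrite /christoffel.
set D := fun l => partial k (fun q => lower g q l m) p +
  partial m (fun q => lower g q l k) p - partial l (fun q => lower g q k m) p.
transitivity (2^-1 * \sum_l (lower g p *m g p) a l * D l).
  rewrite [RHS]mulr_sumr.
  under eq_bigr => i _ do rewrite mulrCA.
  rewrite -!mulr_sumr; congr (_ * _).
  under eq_bigr => i _ do rewrite mulr_sumr.
  rewrite exchange_big /=; apply: eq_bigr => l _.
  by rewrite mxE mulr_suml; apply: eq_bigr => i _; rewrite mulrA.
congr (_ * _); rewrite lower_metric // (bigD1 a) //= mxE eqxx mul1r big1 ?addr0 //.
by move=> l la; rewrite mxE eq_sym (negPf la) mul0r.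
Qed.

(** The connection contracted with a direction. Vectors are rows, so differentiating covariantly
    along [v] adds [y *m (Gam v p)^T] for a vector field [y] and subtracts [xi *m Gam v p] for a
    covector field [xi]. *)
Definition Gam v p : 'M[R]_n := \matrix_(i, m) \sum_k v 0 k * christoffel g i k m p.

Lemma GamE v p i m : Gam v p i m = \sum_k v 0 k * christoffel g i k m p.
Proof. by rewrite mxE. Qed.

(** The connection is torsion-free. *)
Lemma GamC v y p : U p -> Gam v p *m y^T = Gam y p *m v^T.
Proof.
move=> Up; apply/matrixP => i j; rewrite !mxE.
under eq_bigr => m _ do rewrite !mxE mulr_suml.
under [RHS]eq_bigr => m _ do rewrite !mxE mulr_suml.
rewrite exchange_big /=; apply: eq_bigr => k _; apply: eq_bigr => m _.
by rewrite (christoffelC _ k) // ord1; ring.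
Qed.

Lemma GamCT v y p : U p -> y *m (Gam v p)^T = v *m (Gam y p)^T.
Proof. by move=> Up; apply: trmx_inj; rewrite !trmx_mul !trmxK GamC. Qed.

(** Compatibility with the metric: of the six first-kind terms on the right, four cancel by the
    symmetry of the metric and the other two coincide. *)
Lemma mderiv_lower p v : U p ->
  mderiv p v (lower g) (lower g p *m Gam v p + (Gam v p)^T *m lower g p).
Proof.
move=> Up a m.
have d := smooth_onW (smooth_lower a m) Up.
apply: sderiv_eq (sderiv_partial v d).
have E b c : (lower g p *m Gam v p) b c = \sum_k v 0 k *
  (2^-1 * (partial k (fun q => lower g q b c) p + partial c (fun q => lower g q b k) p
          - partial b (fun q => lower g q k c) p)).
  rewrite mxE; under eq_bigr => i _ do rewrite mxE mulr_sumr.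
  rewrite exchange_big /=; apply: eq_bigr => k _.
  by rewrite -lower_christoffel // mulr_sumr; apply: eq_bigr => i _; rewrite mulrCA.
rewrite [RHS]mxE E -[in X in _ = _ + X](lower_sym Up) -trmx_mul mxE E -big_split /=.
apply: eq_bigr => k _; rewrite -mulrDr; congr (_ * _).
rewrite (partial_lowerC m a k Up) (partial_lowerC m k a Up) (partial_lowerC k a m Up).
by field.
Qed.

(** The derivative of the constant product [g q *m lower g q] is zero, which carries the formula
    over from the covariant metric. *)
Lemma mderiv_metric p v : U p ->
  mderiv p v g (- (Gam v p *m g p + g p *m (Gam v p)^T)).
Proof.
move=> Up.
pose G' : 'M[R]_n := \matrix_(i, j) \sum_k v 0 k * partial k (fun q => g q i j) p.
have dg : mderiv p v g G'.
  by move=> i j; rewrite mxE; apply: sderiv_partial; exact: smooth_onW (smooth_metric i j) Up.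
have d1 := mderivM dg (mderiv_lower v Up).
have d2 : mderiv p v (fun q => g q *m lower g q) 0.
  move=> i j; apply: sderiv_near (mderiv_cst p v (1%:M : 'M[R]_n) i j).
  by apply: near_on => // q Uq; rewrite metric_lower.
have /(congr1 (mulmx^~ (g p))) := mderiv_unique d1 d2.
rewrite mul0mx mulmxDl -mulmxA lower_metric // mulmx1 mulmxDr mulmxDl.
rewrite mulmxA metric_lower // mul1mx -!mulmxA lower_metric // mulmx1.
by move=> /eqP; rewrite addr_eq0 => /eqP <-.
Qed.

Definition dGam v y p : 'M[R]_n :=
  \matrix_(i, m) \sum_l \sum_k v 0 l * y 0 k * partial l (christoffel g i k m) p.

Lemma mderiv_Gam p v y : U p ->
  mderiv p v (Gam y) (dGam v y p).
Proof.
move=> Up i m; rewrite mxE exchange_big /=; under eq_fun do rewrite mxE.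
apply: sderiv_sum => k.
have d := smooth_onW (smooth_christoffel i k m) Up.
apply: sderiv_eq (sderivM (sderiv_cst p v (y 0 k)) (sderiv_partial v d)).
by rewrite mul0r add0r mulr_sumr; apply: eq_bigr => l _; rewrite mulrCA mulrA.
Qed.

(** The curvature operator [R(v, y)] with [v] and [y] frozen as constant vector fields, whose Lie
    bracket vanishes. *)
Definition Riem v y p : 'M[R]_n :=
  dGam v y p - dGam y v p + (Gam v p *m Gam y p - Gam y p *m Gam v p).

Lemma dGamE i m v y p : dGam v y p i m = \sum_l \sum_k v 0 l * y 0 k *
  partial l (christoffel g i k m) p.
Proof. by rewrite mxE. Qed.

Lemma sum_delta (F : 'I_n -> R) k : \sum_l (delta_mx 0 k : 'rV[R]_n) 0 l * F l = F k.
Proof.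
rewrite (bigD1 k) //= mxE !eqxx mul1r big1 ?addr0 // => l lk.
by rewrite mxE (negPf lk) andbF mul0r.
Qed.

Lemma Gam_delta k i m p : Gam (delta_mx 0 k) p i m = christoffel g i k m p.
Proof. by rewrite mxE sum_delta. Qed.

Lemma dGam_delta k l i m p : dGam (delta_mx 0 k) (delta_mx 0 l) p i m =
  partial k (christoffel g i l m) p.
Proof.
rewrite mxE; under eq_bigr => a _ do under eq_bigr => b _ do rewrite -mulrA.
under eq_bigr => a _ do rewrite -mulr_sumr sum_delta.
by rewrite sum_delta.
Qed.

Lemma curvatureE i j k l p : U p ->
  curvature g i j k l p = (Riem (delta_mx 0 k) (delta_mx 0 l) p *m g p) i j.
Proof.
move=> Up; rewrite mxE; apply: eq_bigr => s _.
rewrite mulrC -{1}(metric_trmx Up) mxE; congr (_ * _).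
rewrite mxE [X in _ = _ + X]mxE [in RHS]mxE !dGam_delta.
congr (_ + _ + _); last first.
  rewrite [X in _ = _ + X]mxE !mxE -sumrB; apply: eq_bigr => m _.
  by rewrite !Gam_delta.
by rewrite mxE dGam_delta.
Qed.

(** Curvature is given by components, that is on basis vectors; bilinearity carries flatness to all
    directions. *)
Lemma Riem_bilinear v y p : Riem v y p =
  \sum_k \sum_l (v 0 k * y 0 l) *: Riem (delta_mx 0 k) (delta_mx 0 l) p.
Proof.
have GE z : Gam z p = \sum_k z 0 k *: Gam (delta_mx 0 k) p.
  apply/matrixP => i m; rewrite mxE summxE; apply: eq_bigr => k _.
  by rewrite mxE Gam_delta.
have dE v' y' : dGam v' y' p = \sum_k \sum_l (v' 0 k * y' 0 l) *:
    dGam (delta_mx 0 k) (delta_mx 0 l) p.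
  apply/matrixP => i m; rewrite mxE summxE; apply: eq_bigr => k _.
  by rewrite summxE; apply: eq_bigr => l _; rewrite mxE dGam_delta.
have mE v' y' : Gam v' p *m Gam y' p = \sum_k \sum_l (v' 0 k * y' 0 l) *:
    (Gam (delta_mx 0 k) p *m Gam (delta_mx 0 l) p).
  rewrite GE mulmx_suml; apply: eq_bigr => k _.
  rewrite (GE y') mulmx_sumr; apply: eq_bigr => l _.
  by rewrite -scalemxAl -scalemxAr scalerA.
rewrite /Riem dE [dGam y v p]dE mE [Gam y p *m _]mE.
rewrite [X in _ - X + _]exchange_big [X in _ + (_ - X)]exchange_big /=.
rewrite -!sumrB -big_split /=; apply: eq_bigr => k _.
rewrite -!sumrB -big_split /=; apply: eq_bigr => l _.
by rewrite [y 0 l * _]mulrC -!scalerBr -scalerDr.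
Qed.

Lemma flat_Riem v y p : U p -> (forall i j k l, curvature g i j k l p = 0) ->
  Riem v y p = 0.
Proof.
move=> Up flat; rewrite Riem_bilinear big1 // => k _; rewrite big1 // => l _.
suff -> : Riem (delta_mx 0 k) (delta_mx 0 l) p = 0 by rewrite scaler0.
rewrite -[LHS]mulmx1 -(metric_lower Up) mulmxA.
rewrite (_ : Riem _ _ p *m g p = 0) ?mul0mx //.
by apply/matrixP => i j; rewrite -curvatureE // flat mxE.
Qed.

End Metric.

(** * Pairings and rank-one matrices of row vectors *)

Section RowAlgebra.
Context {R : realType} {n : nat}.
Implicit Types (a c d e : 'rV[R]_n) (A : 'M[R]_n) (k : R).

(** A plain pairing, typically of a vector with a covector; a metric enters only through explicit
    factors [g] or [lower g]. *)
Definition dot a c : R := (a *m c^T) 0 0.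

Definition outer a c : 'M[R]_n := a^T *m c.

Lemma dotE a c : dot a c = \sum_i a 0 i * c 0 i.
Proof. by rewrite /dot mxE; apply: eq_bigr => i _; rewrite mxE. Qed.

Lemma dotC a c : dot a c = dot c a.
Proof. by rewrite !dotE; apply: eq_bigr => i _; rewrite mulrC. Qed.

Lemma dotDl a c d : dot (a + c) d = dot a d + dot c d.
Proof. by rewrite /dot mulmxDl mxE. Qed.

Lemma dotDr a c d : dot d (a + c) = dot d a + dot d c.
Proof. by rewrite dotC dotDl ![dot _ d]dotC. Qed.

Lemma dotNl a c : dot (- a) c = - dot a c.
Proof. by rewrite /dot mulNmx mxE. Qed.

Lemma dotNr a c : dot a (- c) = - dot a c.
Proof. by rewrite dotC dotNl dotC. Qed.

Lemma dotZl k a c : dot (k *: a) c = k * dot a c.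
Proof. by rewrite /dot -scalemxAl mxE. Qed.

Lemma dotZr k a c : dot a (k *: c) = k * dot a c.
Proof. by rewrite dotC dotZl dotC. Qed.

Lemma dot0l a : dot 0 a = 0.
Proof. by rewrite /dot mul0mx mxE. Qed.

Lemma dot0r a : dot a 0 = 0.
Proof. by rewrite dotC dot0l. Qed.

Lemma dot_mulmx a A c : dot (a *m A) c = dot a (c *m A^T).
Proof. by rewrite /dot trmx_mul trmxK mulmxA. Qed.

Lemma mulmx_dot a c : a *m c^T = (dot a c)%:M.
Proof. by rewrite [LHS]mx11_scalar. Qed.

Lemma outerE a c i j : outer a c i j = a 0 i * c 0 j.
Proof. by rewrite /outer mxE big_ord1 mxE. Qed.

Lemma mul_outer A a c : A *m outer a c = outer (a *m A^T) c.
Proof. by rewrite /outer mulmxA trmx_mul trmxK. Qed.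

Lemma outer_mul A a c : outer a c *m A = outer a (c *m A).
Proof. by rewrite /outer mulmxA. Qed.

Lemma outer_outer a c d e : outer a c *m outer d e = dot c d *: outer a e.
Proof. by rewrite /outer -mulmxA (mulmxA c) mulmx_dot mul_scalar_mx scalemxAr. Qed.

Lemma row_outer a c d : a *m outer c d = dot a c *: d.
Proof. by rewrite /outer mulmxA mulmx_dot mul_scalar_mx. Qed.

Lemma outerT a c : (outer a c)^T = outer c a.
Proof. by rewrite /outer trmx_mul trmxK. Qed.

End RowAlgebra.

(** * The covariant Hessian of a function *)

Section Hessian.
Context {R : realType} {n : nat}.
Variables (U : set 'rV[R]_n) (g : 'rV[R]_n -> 'M[R]_n).
Hypotheses (oU : open U) (mg : metric_on U g).
Variable f : 'rV[R]_n -> R.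
Hypothesis sf : smooth_on U f.
Implicit Types (p v y : 'rV[R]_n).

Definition d2 v p : 'rV[R]_n := \row_j \sum_k v 0 k * partial k (partial j f) p.

(* The covariant derivative along [v] of the differential of [f]. *)
Definition covd v p : 'rV[R]_n := d2 v p - gradient f p *m Gam g v p.

Lemma mderiv_gradient v p : U p -> mderiv p v (gradient f) (d2 v p).
Proof.
move=> Up i j; rewrite ord1 mxE; under eq_fun do rewrite mxE.
by apply: sderiv_partial; exact: smooth_onW (smooth_on_partial j sf) Up.
Qed.

Lemma sderiv_dot_gradient v p : U p -> sderiv p v f (dot v (gradient f p)).
Proof. by move=> Up; apply: sderiv_gradient; exact: smooth_onW sf Up. Qed.

Lemma d2C v y p : U p -> dot y (d2 v p) = dot v (d2 y p).
Proof.
move=> Up; rewrite !dotE.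
under eq_bigr => j _ do rewrite mxE mulr_sumr.
under [RHS]eq_bigr => j _ do rewrite mxE mulr_sumr.
rewrite exchange_big /=; apply: eq_bigr => k _; apply: eq_bigr => j _.
by rewrite (partialC _ _ oU sf Up) mulrCA.
Qed.

Lemma covdC v y p : U p -> dot y (covd v p) = dot v (covd y p).
Proof.
move=> Up; rewrite /covd !dotDr !dotNr d2C // ![dot _ (gradient f p *m _)]dotC.
by rewrite !dot_mulmx (GamCT oU mg).
Qed.

(** An affinor acts on row vectors through its transpose. The identity rests on the symmetry of the
    covariant Hessian [S], that is on equality of mixed partial derivatives and absence of
    torsion. *)
Lemma hessian_upE v p : U p -> v *m (hessian_up g f p)^T = covd v p *m g p.
Proof.
move=> Up; pose S : 'M[R]_n := \matrix_(s, j)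
  (partial s (partial j f) p - \sum_k christoffel g k s j p * partial k f p).
have ST : S^T = S.
  apply/matrixP => i j; rewrite !mxE (partialC _ _ oU sf Up); congr (_ - _).
  by apply: eq_bigr => k _; rewrite (christoffelC oU mg).
have -> : hessian_up g f p = g p *m S.
  by apply/matrixP => i j; rewrite !mxE; apply: eq_bigr => s _; rewrite !mxE.
rewrite trmx_mul ST (metric_trmx mg) // mulmxA; congr (_ *m _).
apply/rowP => j; rewrite !mxE.
under eq_bigr => k _ do rewrite mxE mulrBr.
rewrite sumrB; congr (_ - _).
under [RHS]eq_bigr => k _ do rewrite !mxE mulr_sumr.
rewrite [RHS]exchange_big /=; apply: eq_bigr => s _.
rewrite mulr_sumr; apply: eq_bigr => k _.
by move: (christoffel _ _ _ _ _) (partial _ _ _) => x1 x2; ring.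
Qed.

Lemma grad_sqE p : grad_sq g f p = dot (gradient f p *m g p) (gradient f p).
Proof.
rewrite /grad_sq dotE exchange_big /=; apply: eq_bigr => j _.
by rewrite !mxE mulr_suml; apply: eq_bigr => i _; rewrite mxE [g p i j * _]mulrC.
Qed.

End Hessian.

Section DirectionalDerivative.
Context {R : realType} {n : nat}.
Variables (U : set 'rV[R]_n) (w : 'rV[R]_n -> 'M[R]_n).
Hypothesis sw : forall i j, smooth_on U (fun p => w p i j).

Definition ddir (v p : 'rV[R]_n) : 'M[R]_n :=
  \matrix_(i, j) \sum_k v 0 k * partial k (fun q => w q i j) p.

Lemma mderiv_ddir (v p : 'rV[R]_n) : U p -> mderiv p v w (ddir v p).
Proof.
by move=> Up i j; rewrite mxE; apply: sderiv_partial; exact: smooth_onW (sw i j) Up.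
Qed.

End DirectionalDerivative.

(** * Conformal change of a flat metric *)

Section ConformalAlgebra.
Context {R : realType} {n : nat}.

(* The change of the Christoffel symbols under [g |-> B ^ 2 g]; [l] is the
   covariant metric, [beta] the differential of [B] and [b] its gradient. *)
Definition shift_of (k : R) (beta b : 'rV[R]_n) (l : 'M[R]_n) (v : 'rV[R]_n) : 'M[R]_n :=
  - k *: ((dot v beta)%:M + outer v beta - outer b (v *m l)).

Lemma shift_ofE k beta b l v i j : shift_of k beta b l v i j =
  - k * (dot v beta * (i == j)%:R + v 0 i * beta 0 j - b 0 i * (v *m l) 0 j).
Proof.
rewrite /shift_of; move: (v *m l) => x; rewrite !(outerE, mxE).
by rewrite mulr_natr.
Qed.

Variables (k q : R) (v y beta b sv sy dv dy : 'rV[R]_n) (l g Gv Gy : 'M[R]_n).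
Hypotheses (k0 : k != 0) (lg : l *m g = 1%:M) (gT : g^T = g) (lT : l^T = l).
Hypotheses (bE : b = beta *m g) (GvyT : y *m Gv^T = v *m Gy^T).
Hypotheses (dvE : dv = sv + beta *m Gv) (dyE : dy = sy + beta *m Gy).
Hypothesis dC : dot y dv = dot v dy.

Let E := shift_of k^-1 beta b l.

(* The derivative along [w] of [shift_of] at [z]: [dw] and [sw] are the derivative
   and the covariant derivative of [beta] along [w], [Gw] is [Gam w]. *)
Definition dshift (w z dw sw : 'rV[R]_n) (Gw : 'M[R]_n) : 'M[R]_n :=
  (k ^- 2 * dot w beta) *: ((dot z beta)%:M + outer z beta - outer b (z *m l))
  - k^-1 *: ((dot z dw)%:M + outer z dw - outer (sw *m g - b *m Gw^T) (z *m l)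
             - outer b (z *m (l *m Gw + Gw^T *m l))).

(** With [E] the difference of the two connections, the left side is the new curvature operator
    minus the old one, times the new metric. Terms that are not tensorial cancel on
    antisymmetrization, because the connection is torsion-free and the second derivatives of [B]
    commute. *)
Lemma shift_curvature :
  (dshift v y dv sv Gv - dshift y v dy sy Gy
   + ((Gv + E v) *m (Gy + E y) - (Gy + E y) *m (Gv + E v)
      - (Gv *m Gy - Gy *m Gv))) *m (k ^+ 2 *: g) =
  let wv := k *: (sv *m g) - (2^-1 * dot b beta) *: v in
  let wy := k *: (sy *m g) - (2^-1 * dot b beta) *: y in
  outer wv y + outer v wy - outer y wv - outer wy v.
Proof.
set wv := k *: _ - _; set wy := k *: _ - _.
have gl : g *m l = 1%:M by exact: mulmx1C.
suff -> : dshift v y dv sv Gv - dshift y v dy sy Gy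
   + ((Gv + E v) *m (Gy + E y) - (Gy + E y) *m (Gv + E v)
      - (Gv *m Gy - Gy *m Gv)) =
   k ^- 2 *: ((outer wv y + outer v wy - outer y wv - outer wy v) *m l).
  rewrite -scalemxAr -scalemxAl scalerA divff ?expf_neq0 // scale1r.
  by rewrite -mulmxA lg mulmx1.
(* The derivative of [E z'] along [z], completed by its commutator with [Gz]. The noncovariant
   leftovers are expressed by [z' *m Gz^T] and [dot z' dz], both symmetric in [z] and [z'] in the
   two cases used. *)
have step z z' dz sz Gz : dz = sz + beta *m Gz ->
  dshift z z' dz sz Gz + Gz *m E z' - E z' *m Gz =
  (k ^- 2 * dot z beta) *: ((dot z' beta)%:M + outer z' beta - outer b (z' *m l))
  - k^-1 *: ((dot z' dz)%:M + outer z' sz + outer (z' *m Gz^T) beta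
             - outer (sz *m g) (z' *m l) - outer b (z' *m Gz^T *m l)).
  move=> dzE; rewrite /dshift /E /shift_of -!scalemxAr -!scalemxAl.
  rewrite !(mulmxDl, mulmxDr, mulNmx, mulmxN, mul_outer, outer_mul) mul_scalar_mx mul_mx_scalar.
  rewrite !mulmxA {2}dzE.
  move: (beta *m Gz) (b *m Gz^T) (z' *m l) (sz *m g) (z' *m Gz^T) => x1 x2 x3 x4 x5.
  move: (x3 *m Gz) (x5 *m l) (dot z' dz) => x6 x7 x8.
  by apply/matrixP => i j; rewrite !(outerE, mxE); ring.
have -> : dshift v y dv sv Gv - dshift y v dy sy Gy
   + ((Gv + E v) *m (Gy + E y) - (Gy + E y) *m (Gv + E v)
      - (Gv *m Gy - Gy *m Gv)) =
   (dshift v y dv sv Gv + Gv *m E y - E y *m Gv)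
   - (dshift y v dy sy Gy + Gy *m E v - E v *m Gy)
   + (E v *m E y - E y *m E v).
  rewrite !(mulmxDl, mulmxDr).
  by apply/matrixP => i j; rewrite !mxE; ring.
rewrite (step v y dv sv Gv dvE) (step y v dy sy Gy dyE) dC GvyT.
have zlg (z : 'rV[R]_n) : z *m l *m g = z by rewrite -mulmxA lg mulmx1.
have zlb z : dot (z *m l) b = dot z beta.
  by rewrite bE -[in RHS](zlg z) [RHS]dot_mulmx gT.
have EE z z' : E z *m E z' = k ^- 2 *: (
    (dot z beta) *: ((dot z' beta)%:M + outer z' beta - outer b (z' *m l))
    + (dot z' beta *: outer z beta + dot z' beta *: outer z beta - dot b beta *: outer z (z' *m l))
    - (dot z' beta *: outer b (z *m l) + dot (z *m l) z' *: outer b beta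
       - dot z beta *: outer b (z' *m l))).
  rewrite /E /shift_of -scalemxAl -scalemxAr scalerA mulrNN -invfM -expr2; congr (_ *: _).
  rewrite 2!mulmxDl mul_scalar_mx; congr (_ + _ + _).
    rewrite !(mulmxDr, mulmxN) mul_mx_scalar !outer_outer; congr (_ + _ - _).
      by rewrite dotC.
    by rewrite [dot beta b]dotC.
  rewrite mulNmx; congr (- _).
  by rewrite !(mulmxDr, mulmxN) mul_mx_scalar !outer_outer zlb.
rewrite !EE.
have -> : dot (y *m l) v = dot (v *m l) y by rewrite dot_mulmx lT dotC.
have wl z sz : (k *: (sz *m g) - (2^-1 * dot b beta) *: z) *m l =
    k *: sz - (2^-1 * dot b beta) *: (z *m l).
  by rewrite mulmxBl -!scalemxAl -mulmxA gl mulmx1.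
rewrite !(mulmxDl, mulNmx) !outer_mul !wl /wv /wy.
move: (sv *m g) (sy *m g) (v *m l) (y *m l) (v *m Gy^T) => x1 x2 x3 x4 x5.
move: (x5 *m l) => x6.
apply/matrixP => i j; rewrite !(outerE, mxE).
move: (dot v beta) (dot y beta) (dot b beta) (dot v dy) (dot x3 y) => r1 r2 r3 r4 r5.
by field.
Qed.

(** The expanded form of the Codazzi equation for the affinor. [t] is the second covariant
    derivative of the differential of [B] with raised index, already known to be symmetric and hence
    the same on both sides; the three assumptions are the symmetry of the metric, of the Hessian and
    of the connection. *)
Lemma codazzi_algebra (hv hy t yl vl : 'rV[R]_n) :
  dot y vl = dot v yl -> dot hy vl = dot hv yl -> y *m Gv^T = v *m Gy^T ->
  dot v beta *: hy + (k *: t + k *: - (hy *m Gv^T)) - dot hv beta *: y +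
  ((k *: hy - (2^-1 * q) *: y) *m Gv^T + - k^-1 *:
   (dot v beta *: (k *: hy - (2^-1 * q) *: y) +
    dot (k *: hy - (2^-1 * q) *: y) beta *: v -
    dot (k *: hy - (2^-1 * q) *: y) vl *: b)) =
  dot y beta *: hv + (k *: t + k *: - (hv *m Gy^T)) - dot hy beta *: v +
  ((k *: hv - (2^-1 * q) *: v) *m Gy^T + - k^-1 *:
   (dot y beta *: (k *: hv - (2^-1 * q) *: v) +
    dot (k *: hv - (2^-1 * q) *: v) beta *: y -
    dot (k *: hv - (2^-1 * q) *: v) yl *: b)).
Proof.
move=> E1 E2 E3.
rewrite !mulmxBl -!scalemxAl E3 !(dotDl, dotNl, dotZl) E1 E2.
move: (hy *m _) (hv *m _) (v *m _) => x1 x2 x3.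
move: (dot _ _) (dot _ _) (dot _ _) (dot _ _) (dot _ _) (dot _ _) => r1 r2 r3 r4 r5 r6.
by apply/rowP => j; rewrite !mxE; field.
Qed.

End ConformalAlgebra.

Section Conformal.
Context {R : realType} {n : nat}.
Variables (U : set 'rV[R]_n) (g : 'rV[R]_n -> 'M[R]_n) (B : 'rV[R]_n -> R).
Hypotheses (oU : open U) (fg : flat_metric_on U g) (sB : smooth_on U B).
Hypothesis B0 : forall p, U p -> B p != 0.
Implicit Types (p v y z : 'rV[R]_n).

Let mg : metric_on U g := fg.1.
Let beta p := gradient B p.
Let b p := beta p *m g p.
Let sB2 : smooth_on U (fun q => B q ^+ 2).
Proof. exact: smooth_onM. Qed.

Definition conformal p : 'M[R]_n := B p ^+ 2 *: g p.

Lemma metric_conformal : metric_on U conformal.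
Proof.
split=> [i j|p Up].
  by under eq_fun do rewrite mxE; apply: smooth_onM => //; exact: smooth_metric.
split; first by rewrite /conformal linearZ /= (metric_trmx mg).
by rewrite unitmxZ ?(metric_unit mg) // unitfE expf_neq0 // B0.
Qed.

Lemma lower_conformal p : U p -> lower conformal p = (B p ^+ 2)^-1 *: lower g p.
Proof.
move=> Up; have uB : B p ^+ 2 != 0 by rewrite expf_neq0 // B0.
have E : conformal p *m ((B p ^+ 2)^-1 *: lower g p) = 1%:M.
  by rewrite /conformal -scalemxAl -scalemxAr scalerA divff // scale1r (metric_lower mg).
by rewrite -[RHS]mul1mx -(lower_metric metric_conformal Up) -mulmxA E mulmx1.
Qed.

Lemma partial_lower_conformal i j s p : U p ->
  partial s (fun q => lower conformal q i j) p =
  - 2 * (B p) ^- 3 * partial s B p * lower g p i j +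
  (B p ^+ 2)^-1 * partial s (fun q => lower g q i j) p.
Proof.
move=> Up; have Bp := B0 Up.
rewrite (@partial_eq_on _ _ _ _ (fun q => (B q ^+ 2)^-1 * lower g q i j) s _ oU) //; last first.
  by move=> q Uq; rewrite lower_conformal // mxE.
have dB : sderiv p (delta_mx 0 s) B (partial s B p).
  by split => //; exact: smooth_onW sB Up.
have dl : sderiv p (delta_mx 0 s) (fun q => lower g q i j) (partial s (fun q => lower g q i j) p).
  by split => //; exact: smooth_onW (smooth_lower oU mg i j) Up.
have Bp2 : B p ^+ 2 != 0 by rewrite expf_neq0.
have dB2 : sderiv p (delta_mx 0 s) (fun q => B q ^+ 2) _ := sderivM dB dB.
have dV := @sderivV _ _ p _ (fun q => B q ^+ 2) _ Bp2 dB2.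
have [_] := sderivM dV dl.
rewrite /partial => ->.
move: ('D_ _ _ _) ('D_ _ _ _) (lower _ _ _ _) => x1 x2 x3.
by field.
Qed.

(** The covariant metric is multiplied by [B ^- 2]. This is the classical formula for the factor
    [exp (2 phi)] with [d phi = - dB / B]. *)
Lemma christoffel_conformal j s k p : U p ->
  christoffel conformal j s k p = christoffel g j s k p -
  (B p)^-1 * (partial s B p * (j == k)%:R + partial k B p * (j == s)%:R
              - b p 0 j * lower g p s k).
Proof.
move=> Up; have Bp := B0 Up; rewrite /christoffel.
have dE l : conformal p j l *
    (partial s (fun q => lower conformal q l k) p + partial k (fun q => lower conformal q l s) p
     - partial l (fun q => lower conformal q s k) p) =
  g p j l * (partial s (fun q => lower g q l k) p + partial k (fun q => lower g q l s) p
     - partial l (fun q => lower g q s k) p)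
  - 2 * (B p)^-1 * (partial s B p * (g p j l * lower g p l k) +
     partial k B p * (g p j l * lower g p l s) -
     (g p j l * partial l B p) * lower g p s k).
  rewrite !partial_lower_conformal // mxE.
  move: (partial _ (fun q => _) _) (partial _ (fun q => _) _) (partial _ (fun q => _) _) => x1 x2 x3.
  move: (partial _ _ _) (partial _ _ _) (partial _ _ _) => x4 x5 x6.
  move: (g p j l) (lower g p l k) (lower g p l s) (lower g p s k) => x7 x8 x9 x10.
  by field.
under eq_bigr => l _ do rewrite dE.
rewrite sumrB mulrBr; congr (_ - _).
rewrite -mulr_sumr sumrB big_split /= -!mulr_sumr -mulr_suml.
have glE m : \sum_l g p j l * lower g p l m = (j == m)%:R.
  transitivity ((1%:M : 'M[R]_n) j m); last by rewrite mxE.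
  by rewrite -(metric_lower mg Up) mxE.
rewrite !glE.
have -> : \sum_l g p j l * partial l B p = b p 0 j.
  rewrite mxE; apply: eq_bigr => l _; rewrite mxE mulrC.
  by rewrite -{1}(metric_trmx mg Up) mxE.
by field.
Qed.

Lemma Gam_conformal v p : U p ->
  Gam conformal v p = Gam g v p + shift_of (B p)^-1 (beta p) (b p) (lower g p) v.
Proof.
move=> Up; apply/matrixP => i m; rewrite [RHS]mxE shift_ofE !GamE.
have E k : v 0 k * christoffel conformal i k m p = v 0 k * christoffel g i k m p
    - (B p)^-1 * (v 0 k * beta p 0 k * (i == m)%:R + beta p 0 m * (v 0 k * (i == k)%:R)
                  - b p 0 i * (v 0 k * lower g p k m)).
  rewrite christoffel_conformal // !mxE.
  move: (christoffel _ _ _ _ _) (partial _ _ _) (partial _ _ _) (\sum_j _ * _) => x1 x2 x3 x4.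
  by ring.
under eq_bigr => k _ do rewrite E.
rewrite sumrB -mulr_sumr mulNr; congr (_ - _ * _).
rewrite sumrB big_split /= -mulr_suml -!mulr_sumr; congr (_ * _ + _ - _ * _).
- by rewrite dotE.
- rewrite mulrC; congr (_ * _).
  rewrite (bigD1 i) //= eqxx mulr1 big1 ?addr0 // => k ki.
  by rewrite eq_sym (negPf ki) mulr0.
- by rewrite [in RHS]mxE.
Qed.

Lemma mderiv_b v p : U p -> mderiv p v b (covd g B v p *m g p - b p *m (Gam g v p)^T).
Proof.
move=> Up; apply: mderiv_eq (mderivM (mderiv_gradient sB v Up) (mderiv_metric oU mg v Up)).
rewrite /covd /b mulmxN mulmxDr mulmxBl !mulmxA opprD addrA; congr (_ - _).
Qed.

Lemma mderiv_shift v z p : U p ->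
  mderiv p v (fun q => shift_of (B q)^-1 (beta q) (b q) (lower g q) z)
    (dshift (B p) (beta p) (b p) (lower g p) (g p) v z (d2 B v p) (covd g B v p) (Gam g v p)).
Proof.
move=> Up; have Bp := B0 Up.
have dB := sderiv_dot_gradient sB v Up.
have dbeta := mderiv_gradient sB v Up.
have dl := mderiv_lower oU mg v Up.
have dz := mderiv_cst p v z.
have d1 : mderiv p v (fun q => (dot z (beta q))%:M : 'M[R]_n) (dot z (d2 B v p))%:M.
  apply: mderiv_scalar.
  have := sderiv_mderiv (mderivM dz (mderivT dbeta)).
  by rewrite mul0mx add0r.
have d2' := mderivM (mderivT dz) dbeta.
have d3 := mderivM (mderivT (mderiv_b v Up)) (mderivM dz dl).
have := mderivZ (sderivN (sderivV Bp dB)) (mderivB (mderivD d1 d2') d3).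
apply: mderiv_eq.
rewrite trmx0 !mul0mx !add0r /dshift /outer -/(beta p) -/(b p).
by rewrite mulNr opprK scaleNr opprD addrA.
Qed.

(** Flatness of [g] enters here: the old curvature operator, which [shift_curvature] subtracts, is
    zero. *)
Lemma Riem_conformal v y p : U p ->
  Riem conformal v y p *m conformal p =
  let wv := B p *: (covd g B v p *m g p) - (2^-1 * dot (b p) (beta p)) *: v in
  let wy := B p *: (covd g B y p *m g p) - (2^-1 * dot (b p) (beta p)) *: y in
  outer wv y + outer v wy - outer y wv - outer wy v.
Proof.
move=> Up; have Bp := B0 Up.
have dE w z : dGam conformal w z p = dGam g w z p +
    dshift (B p) (beta p) (b p) (lower g p) (g p) w z (d2 B w p) (covd g B w p) (Gam g w p).
  apply: mderiv_unique (mderiv_Gam oU metric_conformal w z Up) _ => i j.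
  apply: sderiv_near (mderivD (mderiv_Gam oU mg w z Up) (mderiv_shift w z Up) i j).
  by apply: (near_on oU Up) => q Uq; rewrite Gam_conformal.
have d2E w : d2 B w p = covd g B w p + beta p *m Gam g w p by rewrite /covd subrK.
have := @shift_curvature R n (B p) v y (beta p) (b p) (covd g B v p) (covd g B y p)
  (d2 B v p) (d2 B y p) (lower g p) (g p) (Gam g v p) (Gam g y p) Bp
  (lower_metric mg Up) (metric_trmx mg Up) (lower_sym mg Up) erefl
  (GamCT oU mg v y Up) (d2E v) (d2E y) (d2C oU sB v y Up).
move=> <-; rewrite /conformal; congr (_ *m _).
have R0 : Riem g v y p = 0 by apply: (flat_Riem mg v y Up); exact: fg.2.
rewrite -[RHS]add0r -R0 /Riem !dE !Gam_conformal //.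
move: (dshift _ _ _ _ _ _ _ _ _ _) (dshift _ _ _ _ _ _ _ _ _ _) (dGam _ _ _ _) (dGam _ _ _ _).
move: (_ *m _) (_ *m _) (_ *m _) (_ *m _) => x1 x2 x3 x4 x5 x6 x7 x8.
by apply/matrixP => i j; rewrite !mxE; ring.
Qed.

Definition affinor p : 'M[R]_n := B p *: hessian_up g B p - (2^-1 * grad_sq g B p)%:M.

Lemma row_affinor v p : U p -> v *m (affinor p)^T =
  B p *: (covd g B v p *m g p) - (2^-1 * dot (b p) (beta p)) *: v.
Proof.
move=> Up; rewrite /affinor linearB linearZ /= tr_scalar_mx mulmxBr -scalemxAr.
by rewrite (hessian_upE oU mg sB) // mul_mx_scalar grad_sqE.
Qed.

Lemma gauss_conformal v y p : U p -> Riem conformal v y p *m conformal p =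
  outer (v *m (affinor p)^T) y + outer v (y *m (affinor p)^T)
  - outer y (v *m (affinor p)^T) - outer (y *m (affinor p)^T) v.
Proof. by move=> Up; rewrite Riem_conformal // !row_affinor. Qed.

Lemma curvature_conformal p i j k l : U p ->
  curvature conformal i j k l p =
    affinor p i k * (j == l)%:R + affinor p j l * (i == k)%:R
    - affinor p j k * (i == l)%:R - affinor p i l * (j == k)%:R.
Proof.
move=> Up; rewrite (curvatureE metric_conformal) // gauss_conformal //.
have wE m m' : ((delta_mx 0 m : 'rV[R]_n) *m (affinor p)^T) 0 m' = affinor p m' m.
  rewrite mxE -[RHS](sum_delta (fun l' => affinor p m' l') m).
  by apply: eq_bigr => l' _; rewrite [_^T _ _]mxE.
have E (X Y Z T : 'M[R]_n) : (X + Y - Z - T) i j = X i j + Y i j - Z i j - T i j.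
  by rewrite !mxE.
have dE a c : (delta_mx 0 a : 'rV[R]_n) 0 c = (c == a)%:R by rewrite mxE eqxx.
by rewrite E !outerE !wE !dE [(i == k)%:R * _]mulrC [(i == l)%:R * _]mulrC.
Qed.

Definition d3 v y p : 'rV[R]_n :=
  \row_j \sum_k \sum_l v 0 k * y 0 l * partial k (partial l (partial j B)) p.

Lemma d3C v y p : U p -> d3 v y p = d3 y v p.
Proof.
move=> Up; apply/rowP => j; rewrite !mxE exchange_big /=.
apply: eq_bigr => k _; apply: eq_bigr => l _.
by rewrite (partialC _ _ oU (smooth_on_partial j sB) Up) [v 0 l * _]mulrC.
Qed.

Lemma mderiv_d2 v y p : U p -> mderiv p v (d2 B y) (d3 v y p).
Proof.
move=> Up i j; rewrite ord1 mxE exchange_big /=; under eq_fun do rewrite mxE.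
apply: sderiv_sum => l.
have d := smooth_onW (smooth_on_partial l (smooth_on_partial j sB)) Up.
apply: sderiv_eq (sderivM (sderiv_cst p v (y 0 l)) (sderiv_partial v d)).
by rewrite mul0r add0r mulr_sumr; apply: eq_bigr => k _; rewrite mulrCA mulrA.
Qed.

Lemma mderiv_covd v y p : U p -> mderiv p v (covd g B y)
  (d3 v y p - (d2 B v p *m Gam g y p + beta p *m dGam g v y p)).
Proof.
move=> Up; apply: mderivB (mderiv_d2 v y Up) _.
exact: mderivM (mderiv_gradient sB v Up) (mderiv_Gam oU mg v y Up).
Qed.

(* The second covariant derivative of the differential of [B]; its symmetry is
   the flatness of [g]. *)
Definition covd2 v y p : 'rV[R]_n :=
  d3 v y p - (d2 B v p *m Gam g y p + beta p *m dGam g v y p) - covd g B y p *m Gam g v p.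

(** The Ricci identity: up to sign, the difference of the two sides is the differential of [B]
    applied to the curvature operator of [g], which vanishes. *)
Lemma covd2C v y p : U p -> covd2 v y p = covd2 y v p.
Proof.
move=> Up; have R0 : Riem g v y p = 0 by apply: (flat_Riem mg v y Up); exact: fg.2.
have : beta p *m Riem g v y p = 0 by rewrite R0 mulmx0.
rewrite /covd2 /covd /Riem -/(beta p) (d3C v y Up) !(mulmxDr, mulmxBr, mulmxBl, mulmxN) !mulmxA.
move: (d3 _ _ _) (beta p *m dGam _ _ _ _) (beta p *m dGam _ _ _ _) => x1 x2 x3.
move: (d2 _ _ _ *m _) (d2 _ _ _ *m _) => x4 x5.
move: (beta p *m _ *m _) (beta p *m _ *m _) => x6 x7 /rowP E.
by apply/rowP => j; have := E j; rewrite !mxE => Ej; apply/eqP; rewrite -subr_eq0 -oppr_eq0 -[X in _ == X]Ej; apply/eqP; ring.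
Qed.

Lemma smooth_affinor i j : smooth_on U (fun q => affinor q i j).
Proof.
under eq_fun do rewrite !mxE.
have sg k l := smooth_metric mg k l.
have sp k : smooth_on U (partial k B) by exact: smooth_on_partial.
apply: smooth_onB => //; first apply: smooth_onM => //.
  apply: smooth_on_sum => // s _; apply: smooth_onM => //; apply: smooth_onB => //.
    exact: smooth_on_partial.
  by apply: smooth_on_sum => // k _; apply: smooth_onM => //; exact: smooth_christoffel.
case: (i == j); last exact: smooth_on_cst.
apply: smooth_onM => //; first exact: smooth_on_cst.
apply: smooth_on_sum => // k _; apply: smooth_on_sum => // l _.
by apply: smooth_onM => //; apply: smooth_onM.
Qed.

(** The product rule applied to [row_affinor]. The last term is the derivative of half of the
    squared gradient: its two factors contribute equally, and the Christoffel terms of the metric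
    and of the Hessian cancel. *)
Lemma row_ddir_affinor v y p : U p -> y *m (ddir affinor v p)^T =
  dot v (beta p) *: (covd g B y p *m g p)
  + B p *: (covd2 v y p *m g p - covd g B y p *m g p *m (Gam g v p)^T)
  - dot (covd g B v p *m g p) (beta p) *: y.
Proof.
move=> Up; have Bp := B0 Up.
have dB := sderiv_dot_gradient sB v Up.
have dh := mderivM (mderiv_covd v y Up) (mderiv_metric oU mg v Up).
have dq := sderiv_mderiv (mderivM (mderiv_b v Up) (mderivT (mderiv_gradient sB v Up))).
have d := mderivB (mderivZ dB dh)
  (mderivZ (sderivM (sderiv_cst p v 2^-1) dq) (mderiv_cst p v y)).
have dy : mderiv p v (fun q => y *m (affinor q)^T) (0 *m (affinor p)^T + y *m (ddir affinor v p)^T).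
  exact: mderivM (mderiv_cst p v y) (mderivT (mderiv_ddir smooth_affinor v Up)).
rewrite mul0mx add0r in dy.
have {}d := mderiv_near (near_on oU Up (fun q Uq => esym (row_affinor y Uq))) d.
rewrite (mderiv_unique dy d) mul0r add0r scaler0 addr0; congr (_ + _ *: _ - _ *: _).
  rewrite /covd2; move: (_ - _) (covd g B y p) => X c.
  by rewrite mulmxN mulmxDr mulmxBl !mulmxA opprD addrA.
transitivity (2^-1 * (dot (covd g B v p *m g p) (beta p) + dot (covd g B v p *m g p) (beta p))); last by field.
congr (_ * _); rewrite mxE -/(dot _ _) -/(dot _ _) -/(beta p).
have -> : d2 B v p = covd g B v p + beta p *m Gam g v p by rewrite /covd subrK.
have -> : dot (b p) (covd g B v p + beta p *m Gam g v p) =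
    dot (b p) (covd g B v p) + dot (b p *m (Gam g v p)^T) (beta p).
  by rewrite dotDr [dot (b p) (_ *m _)]dotC [dot (_ *m Gam _ _ _) _]dot_mulmx [X in _ + X = _]dotC.
rewrite dotDl dotNl.
have -> : dot (b p) (covd g B v p) = dot (covd g B v p *m g p) (beta p).
  by rewrite dot_mulmx (metric_trmx mg Up) dotC.
by ring.
Qed.

(** The covariant derivative of the affinor has a further term, the affinor applied to
    [y *m (Gam conformal v p)^T]. It is symmetric in [v] and [y] and has been dropped from both
    sides. *)
Lemma codazzi v y p : U p ->
  y *m (ddir affinor v p)^T + y *m (affinor p)^T *m (Gam conformal v p)^T =
  v *m (ddir affinor y p)^T + v *m (affinor p)^T *m (Gam conformal y p)^T.
Proof.
move=> Up; have Bp := B0 Up.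
have shiftT x w : x *m (shift_of (B p)^-1 (beta p) (b p) (lower g p) w)^T =
    - (B p)^-1 *: (dot w (beta p) *: x + dot x (beta p) *: w - dot x (w *m lower g p) *: b p).
  rewrite /shift_of linearZ linearB linearD /= tr_scalar_mx !outerT -scalemxAr.
  by rewrite mulmxBr mulmxDr mul_mx_scalar !row_outer.
rewrite !row_ddir_affinor // !row_affinor // !Gam_conformal // !linearD /= !shiftT.
rewrite (covd2C v y Up).
apply: codazzi_algebra => //.
- by rewrite dotC dot_mulmx (lower_sym mg Up).
- have hl x w : dot (covd g B x p *m g p) (w *m lower g p) = dot (covd g B x p) w.
    by rewrite dotC dot_mulmx (lower_sym mg Up) -mulmxA (metric_lower mg Up) mulmx1 dotC.
  by rewrite !hl dotC (covdC oU mg sB) // dotC.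
- exact: (GamCT oU mg).
Qed.

(** Self-adjointness with respect to the rescaled metric, tested on covectors. The Hessian part is
    symmetric by [covdC], the multiple of the identity by the symmetry of the metric. *)
Lemma dot_affinor x y p : U p ->
  dot (x *m conformal p *m (affinor p)^T) y = dot (y *m conformal p *m (affinor p)^T) x.
Proof.
move=> Up; rewrite !row_affinor // /conformal -!scalemxAr !(dotDl, dotNl, dotZl).
have gC z w : dot (z *m g p) w = dot (w *m g p) z.
  by rewrite dot_mulmx (metric_trmx mg Up) dotC.
have cZ c z : covd g B (c *: z) p *m g p = c *: (covd g B z p *m g p).
  by rewrite -!(hessian_upE oU mg sB _ Up) -scalemxAl.
rewrite !cZ !dotZl (gC (covd _ _ _ _) y) (gC (covd _ _ _ _) x) (gC x y).
by rewrite (covdC oU mg sB (x *m g p) (y *m g p) Up).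
Qed.

End Conformal.

(** * Paths, fields and families of fields *)

Section SmoothPaths.
Context {R : realType}.

Definition smooth1 (f : R -> R) := forall m x, derivable (derive1n m f) x 1.

Lemma smooth1_derive1 f : smooth1 f -> smooth1 (derive1 f).
Proof. by move=> sf m x; rewrite -derive1Sn; exact: sf. Qed.

Lemma smooth1_is_derive f x : smooth1 f -> is_derive x (1 : R) f (derive1 f x).
Proof. by move=> sf; rewrite derive1E; apply: derivableP; exact: (sf 0%N). Qed.

Lemma smooth1_continuous f : smooth1 f -> continuous f.
Proof.
by move=> sf x; apply: differentiable_continuous; apply/derivable1_diffP; exact: (sf 0%N).
Qed.

Lemma smooth1I (f : R -> R) : (forall x, derivable f x 1) -> smooth1 (derive1 f) -> smooth1 f.
Proof. by move=> df sf [|m] x; [exact: df|rewrite derive1Sn; exact: sf]. Qed.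

Lemma continuous_rV (T : topologicalType) n (phi : T -> 'rV[R]_n) (p : T) :
  (forall j, {for p, continuous (fun q => phi q 0 j)}) -> {for p, continuous phi}.
Proof.
move=> cphi.
have -> : phi = fun q => \sum_j phi q 0 j *: delta_mx 0 j.
  by apply/funext => q; rewrite {1}(row_sum_delta (phi q)).
elim: (index_enum _) => [|j r IH].
  rewrite (_ : (fun q => _) = cst 0); first exact: cvg_cst.
  by apply/funext => q; rewrite big_nil.
rewrite (_ : (fun q => _) = fun q => phi q 0 j *: delta_mx 0 j +
    \sum_(j <- r) phi q 0 j *: delta_mx 0 j); last first.
  by apply/funext => q; rewrite big_cons.
apply: cvgD; last exact: IH.
by apply: cvgZr_tmp; exact: (cphi j).
Qed.

Section Coordinates.
Context {m : nat}.
Implicit Types (y : 'rV[R]_(m + 1)).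

(** The packing of parameters and space variable that [has_variational_derivative] uses. *)
Definition point_at (s : 'rV[R]_m) (x : R) : 'rV[R]_(m + 1) := row_mx s x%:M.

Lemma point_atK_time s x : lsubmx (point_at s x) = s.
Proof. exact: row_mxKl. Qed.

Lemma point_atK_space s x : rsubmx (point_at s x) 0 0 = x.
Proof. by rewrite row_mxKr mxE eqxx. Qed.

Lemma point_at_eta y : point_at (lsubmx y) (rsubmx y 0 0) = y.
Proof. by rewrite /point_at -mx11_scalar hsubmxK. Qed.

Lemma continuous_point_at s x :
  {for (s, x), continuous (fun z : 'rV[R]_m * R => point_at z.1 z.2)}.
Proof.
apply: continuous_rV => j; case: (split_ordP j) => k ->.
  rewrite (_ : (fun z => _) = (fun z : 'rV[R]_m * R => z.1 0 k)); last first.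
    by apply/funext => z; rewrite /point_at row_mxEl.
  apply: (@continuous_comp _ _ _ fst (fun N : 'rV[R]_m => N 0 k)); first exact: cvg_fst.
  exact: coord_continuous.
rewrite (_ : (fun z => _) = snd); first exact: cvg_snd.
by apply/funext => z; rewrite /point_at row_mxEr mxE ord1 eqxx.
Qed.

Lemma is_derive_space (f : 'rV[R]_(m + 1) -> R) s x (df : R) : is_derive (point_at s x) (delta_mx 0 (rshift m 0)) f df ->
  is_derive x (1 : R) (fun r => f (point_at s r)) df.
Proof.
have E r : point_at s r = point_at s 0 + r *: delta_mx 0 (rshift m 0).
  apply/rowP => j; rewrite !mxE; case: (split_ordP j) => k ->.
    by rewrite ?mxE ?eq_lrshift ?andbF ?mulr0 ?addr0.
  by rewrite ?mxE ord1 !eqxx ?mulr1 ?add0r.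
rewrite (_ : (fun r => _) = fun r => f (point_at s 0 + r *: delta_mx 0 (rshift m 0))).
  by rewrite E; exact: is_derive_line.
by apply/funext => r; rewrite E.
Qed.

Lemma is_derive_time (f : 'rV[R]_(m + 1) -> R) s x k r (df : R) :
  is_derive (point_at (s + r *: delta_mx 0 k) x) (delta_mx 0 (lshift 1 k)) f df ->
  is_derive r (1 : R) (fun r => f (point_at (s + r *: delta_mx 0 k) x)) df.
Proof.
have E r' : point_at (s + r' *: delta_mx 0 k) x = point_at s x + r' *: delta_mx 0 (lshift 1 k).
  apply/rowP => j; rewrite !mxE; case: (split_ordP j) => k' ->.
    by rewrite !mxE eq_lshift.
  by rewrite !mxE eq_rlshift andbF mulr0 addr0.
rewrite (_ : (fun r => _) = fun r => f (point_at s x + r *: delta_mx 0 (lshift 1 k))).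
  by rewrite E; exact: is_derive_line.
by apply/funext => r'; rewrite E.
Qed.

Lemma smooth_on_space (U : set 'rV[R]_(m + 1)) f : smooth1 f ->
  smooth_on U (fun y => f (rsubmx y 0 0)).
Proof.
move=> sf k; elim: k f sf => [|k IH] f sf.
  split => // y _.
  apply: (@differentiable_comp _ _ _ _ (fun y : 'rV[R]_(m + 1) => rsubmx y 0 0)).
    by under eq_fun do rewrite mxE; exact: differentiable_coord.
  by apply/derivable1_diffP; exact: (sf 0%N).
have dsp y : differentiable (fun y : 'rV[R]_(m + 1) => rsubmx y 0 0 : R) y.
  by under eq_fun do rewrite mxE; exact: differentiable_coord.
have df (y : R) : differentiable f y by apply/derivable1_diffP; exact: (sf 0%N).
split => [y _|i]; first exact: differentiable_comp.
have -> : partial i (fun y => f (rsubmx y 0 0)) =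
    fun y => (rshift m 0 == i)%:R * derive1 f (rsubmx y 0 0).
  apply/funext => y; rewrite /partial deriveE; last exact: differentiable_comp.
  have dspE : 'd (fun y : 'rV[R]_(m + 1) => rsubmx y 0 0 : R) y (delta_mx 0 i) = (rshift m 0 == i)%:R.
    rewrite -deriveE //; under eq_fun do rewrite mxE.
    exact: (partial_coord i (rshift m 0) y).
  rewrite diff_comp //= dspE.
  rewrite -[X in 'd f _ X]mulr1 -[X in 'd f _ X]/(_ *: (1 : R)) linearZ /=.
  by rewrite derive1E deriveE.
have := IH _ (smooth1_derive1 sf).
case: (rshift m 0 == i) => /=.
  by under [in X in _ -> X]eq_fun do rewrite mul1r.
move=> _; under eq_fun do rewrite mul0r.
exact: smooth_on_cst.
Qed.

Lemma smooth1_slice (U : set 'rV[R]_(m + 1)) f s : smooth_on U f ->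
  (forall x, U (point_at s x)) -> smooth1 (fun x => f (point_at s x)).
Proof.
move=> sf Us k; elim: k f sf => [|k IH] f sf x.
  have H : is_derive x (1 : R) (fun r => f (point_at s r)) (partial (rshift m 0) f (point_at s x)).
    apply: is_derive_space; apply/derivableP/diff_derivable.
    exact: smooth_onW sf (Us x).
  by case: H.
rewrite derive1Sn.
have -> : derive1 (fun x => f (point_at s x)) = (fun x => partial (rshift m 0) f (point_at s x)).
  apply/funext => r; rewrite derive1E.
  have H : is_derive r (1 : R) (fun r => f (point_at s r)) (partial (rshift m 0) f (point_at s r)).
    apply: is_derive_space; apply/derivableP/diff_derivable.
    exact: smooth_onW sf (Us r).
  by rewrite derive_val.
exact/IH/smooth_on_partial.
Qed.

End Coordinates.

End SmoothPaths.

Section Fields.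
Context {R : realType} {n : nat}.
Implicit Types (U : set 'rV[R]_n) (u v : R -> 'rV[R]_n).

Lemma smooth_path_coord u i : smooth_path u -> smooth1 (fun x => u x 0 i).
Proof. by move=> su m x; exact: su. Qed.

Lemma smooth_path_dx u : smooth_path u -> smooth_path (dx u).
Proof.
move=> su i m x; under eq_fun do rewrite mxE.
by apply: smooth1_derive1; exact: smooth_path_coord.
Qed.

Lemma mderiv_path u x : smooth_path u -> mderiv x (1 : R) u (dx u x).
Proof.
move=> su i j; rewrite ord1 mxE; split; last by rewrite derive1E.
by apply/derivable1_diffP; exact: (su j 0%N).
Qed.

Lemma test_field_window v : test_field v -> exists M : R, 0 <= M /\ forall x, M < `|x| -> v x = 0.
Proof.
move=> [_ [M H]]; exists `|M|; split => // x Mx; apply: H.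
exact: le_lt_trans (ler_norm M) Mx.
Qed.

Lemma field_dx_window U u : field U u ->
  exists M : R, 0 <= M /\ forall x, M < `|x| -> dx u x = 0.
Proof.
move=> [_ [M H]]; exists `|M|; split => // x Mx; apply: H.
exact: le_lt_trans (ler_norm M) Mx.
Qed.

Lemma dx_outside v M x : (forall x, M < `|x| -> v x = 0) -> M < `|x| -> dx v x = 0.
Proof.
move=> v0 Mx; apply/rowP => i; rewrite !mxE derive1E.
rewrite (@near_eq_derive _ _ _ _ (cst 0)) ?derive_cst //.
have : \forall y \near x, M < `|y|.
  have /cvgrPdist_lt : {for x, continuous (fun y : R => `|y|)} by apply: cvg_norm; exact: cvg_id.
  move=> /(_ (`|x| - M)); rewrite subr_gt0 => /(_ Mx); apply: filterS => y.
  by have := ler_norm (`|x| - `|y|); lra.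
by apply: filterS => y My; rewrite v0 // mxE.
Qed.

Lemma constant_outside u (M x y : R) : smooth_path u -> (forall x, M < `|x| -> dx u x = 0) ->
  x <= y -> (forall z, x <= z <= y -> M < `|z|) -> u x = u y.
Proof.
move=> su du xy My; apply/rowP => j; apply/eqP; rewrite eq_sym -subr_eq0; apply/eqP.
have [z _ ->] : exists2 z, z \in `[x, y] & u y 0 j - u x 0 j = 0 * (y - x).
  apply: (@MVT_segment _ (fun z => u z 0 j) (fun=> 0)) => // [z /itvP zI|].
    have -> : 0 = dx u z 0 j by rewrite du ?mxE // My // !zI.
    by rewrite mxE; apply: smooth1_is_derive; exact: smooth_path_coord.
  by apply: continuous_subspaceT; apply: smooth1_continuous; exact: smooth_path_coord.
by rewrite mul0r.
Qed.

Section Affine.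
Variables (U : set 'rV[R]_n) (m : nat) (u : R -> 'rV[R]_n) (v : 'I_m -> R -> 'rV[R]_n).
Hypotheses (oU : open U) (fu : field U u) (tv : forall a, test_field (v a)).

Lemma smooth_on_affine (V : set 'rV[R]_(m + 1)) j : open V ->
  smooth_on V (fun y => affine_family u v (lsubmx y) (rsubmx y 0 0) 0 j).
Proof.
move=> oV; have [[su _] _] := fu.
rewrite (_ : (fun y => _) = fun y : 'rV[R]_(m + 1) => u (rsubmx y 0 0) 0 j +
    \sum_a y 0 (lshift 1 a) * v a (rsubmx y 0 0) 0 j); last first.
  apply/funext => y; rewrite /affine_family mxE summxE; congr (_ + _).
  by apply: eq_bigr => a _; rewrite !mxE.
apply: smooth_onD => //; first exact: (@smooth_on_space _ _ V _ (@smooth_path_coord u j su)).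
apply: smooth_on_sum => // a _; apply: smooth_onM => //; first exact: smooth_on_coord.
by have [sva _] := tv a; exact: (@smooth_on_space _ _ V _ (@smooth_path_coord (v a) j sva)).
Qed.

Lemma dx_affine s x : dx (affine_family u v s) x = dx u x + \sum_a s 0 a *: dx (v a) x.
Proof.
have [[su _] _] := fu.
apply/rowP => j; rewrite [LHS]mxE derive1E [RHS]mxE summxE.
have H : sderiv x (1 : R) (fun y => affine_family u v s y 0 j)
    (dx u x 0 j + \sum_a s 0 a * dx (v a) x 0 j).
  rewrite (_ : (fun y => _) = fun y => u y 0 j + \sum_a s 0 a * v a y 0 j).
    apply: sderivD; first exact: (mderiv_path x su).
    apply: sderiv_sum => a; have [sva _] := tv a.
    apply: sderiv_eq (sderivM (sderiv_cst x 1 (s 0 a)) (mderiv_path x sva 0 j)).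
    by rewrite mul0r add0r.
  apply/funext => y; rewrite /affine_family mxE summxE; congr (_ + _).
  by apply: eq_bigr => a _; rewrite !mxE.
by have [_ ->] := H; congr (_ + _); apply: eq_bigr => a _; rewrite !mxE.
Qed.

Lemma smooth_path_affine s : smooth_path (affine_family u v s).
Proof.
move=> i; have sA := smooth_on_affine i (@openT 'rV[R]_(m + 1)).
have := smooth1_slice sA (fun x => I : setT (point_at s x)).
by under eq_fun do rewrite point_atK_time point_atK_space.
Qed.

Lemma affine_window : exists M : R, [/\ 0 <= M, forall x, M < `|x| -> dx u x = 0 &
  forall a x, M < `|x| -> v a x = 0].
Proof.
have [M0 [M00 HM0]] := field_dx_window fu.
have /choice [M HM] : forall a, exists M : R, 0 <= M /\ forall x, M < `|x| -> v a x = 0.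
  by move=> a; exact: test_field_window.
exists (M0 + \sum_a M a); have S0 : 0 <= \sum_a M a by apply: sumr_ge0 => a _; have [] := HM a.
split; first exact: addr_ge0.
- by move=> x Mx; apply: HM0; apply: le_lt_trans Mx; rewrite lerDl.
- move=> a x Mx; have [_] := HM a; apply; apply: le_lt_trans Mx.
  rewrite (bigD1 a) //= addrCA lerDl addr_ge0 // sumr_ge0 // => c _.
  by have [] := HM c.
Qed.

(** On a compact interval the openness of [U] gives one bound for all [x]; outside it the
    perturbation vanishes and [u] repeats the values taken at the two ends. *)
Lemma field_affine : exists2 e : R, 0 < e & forall s : 'rV[R]_m,
  (forall a, `|s 0 a| < e) -> field U (affine_family u v s).
Proof.
have [[su Uu] _] := fu; have [M [M0 du v0]] := affine_window.
(* The ends of [[- N, N]] must lie strictly outside the window, so that [u] is constant from there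
   on. *)
pose N := M + 1; have N0 : 0 <= N by rewrite addr_ge0.
have MN : M < N by rewrite ltrDl.
have v_out s x : M < `|x| -> affine_family u v s x = u x.
  move=> Mx; rewrite /affine_family big1 ?addr0 // => a _.
  by rewrite v0 // scaler0.
have u_out x : N < `|x| -> exists2 z, `|z| = N & u x = u z.
  rewrite ltr_normr => /orP[Nx|xN].
    exists N; first exact: ger0_norm.
    apply/esym/(constant_outside su du); first exact: ltW.
    move=> z /andP[Nz _]; apply: lt_le_trans MN _; exact: le_trans (ler_norm z).
  exists (- N); first by rewrite normrN ger0_norm.
  apply: (constant_outside su du); first by rewrite lerNr ltW.
  move=> z /andP[_ zN]; apply: lt_le_trans MN _; rewrite -normrN.
  by apply: le_trans (ler_norm (- z)); rewrite lerNr.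
have K : near_covering `[- N, N]%classic by apply/compact_near_coveringP/segment_compact.
have H : \forall s \near (0 : 'rV[R]_m), `[- N, N]%classic `<=` (fun x => U (affine_family u v s x)).
  apply: (K _ (nbhs (0 : 'rV[R]_m)) (fun s x => U (affine_family u v s x))) => // x _.
  have cA : {for (0, x), continuous (fun z : 'rV[R]_m * R => affine_family u v z.1 z.2)}.
    apply: continuous_rV => j.
    have d := smooth_onW (smooth_on_affine j (@openT 'rV[R]_(m + 1)))
       (I : setT (point_at 0 x)).
    rewrite (_ : (fun q => _) = (fun y => affine_family u v (lsubmx y) (rsubmx y 0 0) 0 j) \o
        (fun z : 'rV[R]_m * R => point_at z.1 z.2)); last first.
      by apply/funext => z; rewrite /= point_atK_time point_atK_space.
    apply: continuous_comp; first exact: (@continuous_point_at _ _ (0 : 'rV[R]_m) x).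
    exact: differentiable_continuous d.
  have U0 : U (affine_family u v (0 : 'rV[R]_m) x).
    rewrite /affine_family big1 ?addr0; first exact: Uu.
    by move=> a _; rewrite mxE scale0r.
  have [[A B] /= [nA nB] AB] := cA _ (open_nbhs_nbhs (conj oU U0)).
  by exists (B, A) => //= -[y s] [/= By As]; exact: (AB (s, y)).
move: H => /nbhs_ballP[e e0 He]; exists e => // s se.
have Hs := He s; split.
  split; first exact: smooth_path_affine.
  move=> x; have {}Hs : `[- N, N]%classic `<=` (fun x => U (affine_family u v s x)).
    apply: He; rewrite -ball_normE /ball_ /= sub0r normrN.
    rewrite [ltLHS]/Num.Def.normr /= mx_normrE.
    by apply/bigmax_ltP; split => // -[i j] _; rewrite ord1.
  have [Nx|xN] := ltP N `|x|; last by apply: Hs; rewrite /= in_itv /= -ler_norml.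
  have [z zN uz] := u_out x Nx.
  rewrite v_out; last exact: lt_trans Nx.
  rewrite uz -(v_out s) ?zN //; apply: Hs.
  by rewrite /= in_itv /= -ler_norml zN.
exists M => x Mx; rewrite dx_affine du // big1 ?addr0 // => a _.
by rewrite (dx_outside (v0 a)) // scaler0.
Qed.

End Affine.

End Fields.

(** * Smooth one-parameter families of functions of [x] *)

Section SmoothFamilies.
Context {R : realType}.
Implicit Types (e s x M : R) (f h : R -> R -> R).

(** The real parameter is stored as a row of length one, so that a family is a function on row
    vectors and the smoothness lemmas apply to it. *)
Definition strip e : set 'rV[R]_(1 + 1) := [set y | `|lsubmx y 0 0| < e].

Definition smooth_family e f := smooth_on (strip e) (fun y => f (lsubmx y 0 0) (rsubmx y 0 0)).

Definition at2 s x : 'rV[R]_(1 + 1) := point_at s%:M x.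

Lemma at2K_time s x : lsubmx (at2 s x) 0 0 = s.
Proof. by rewrite point_atK_time mxE eqxx. Qed.

Lemma at2K_space s x : rsubmx (at2 s x) 0 0 = x.
Proof. exact: point_atK_space. Qed.

Lemma at2_eta y : at2 (lsubmx y 0 0) (rsubmx y 0 0) = y.
Proof. by rewrite /at2 -mx11_scalar point_at_eta. Qed.

Lemma strip_at2 e s x : `|s| < e -> strip e (at2 s x).
Proof. by move=> se; rewrite /strip /= at2K_time. Qed.

Lemma open_strip e : open (strip e).
Proof.
rewrite (_ : strip e = (fun y : 'rV[R]_(1 + 1) => `|y 0 (lshift 1 0)|) @^-1` [set r | r < e]).
  apply: open_comp; last exact: open_lt.
  move=> y _.
  apply: (@continuous_comp _ _ _ (fun z : 'rV[R]_(1 + 1) => z 0 (lshift 1 0)) (fun r : R => `|r|)).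
    exact: (differentiable_continuous (differentiable_coord y 0 (lshift 1 0))).
  exact: norm_continuous.
by apply/seteqP; split => y /=; rewrite /strip /= mxE.
Qed.

Definition dtime f s x : R :=
  partial (lshift 1 0) (fun y => f (lsubmx y 0 0) (rsubmx y 0 0)) (at2 s x).

Definition dspace f s x : R :=
  partial (rshift 1 0) (fun y => f (lsubmx y 0 0) (rsubmx y 0 0)) (at2 s x).

Lemma smooth_family_dtime e f : smooth_family e f -> smooth_family e (dtime f).
Proof.
move=> /(smooth_on_partial (lshift 1 0)); rewrite /smooth_family /dtime.
by under [in X in _ -> X]eq_fun do rewrite at2_eta.
Qed.

Lemma smooth_family_dspace e f : smooth_family e f -> smooth_family e (dspace f).
Proof.
move=> /(smooth_on_partial (rshift 1 0)); rewrite /smooth_family /dspace.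
by under [in X in _ -> X]eq_fun do rewrite at2_eta.
Qed.

Lemma is_derive_dtime e f s x : smooth_family e f -> `|s| < e ->
  is_derive s (1 : R) (f ^~ x) (dtime f s x).
Proof.
move=> sf se.
have E r : at2 r x = point_at (0 + r *: (delta_mx 0 0 : 'rV[R]_1)) x.
  by rewrite /at2 add0r; congr point_at; apply/matrixP => i j; rewrite !mxE !ord1 eqxx mulr1.
have := @is_derive_time R 1 (fun y => f (lsubmx y 0 0) (rsubmx y 0 0)) 0 x 0 s (dtime f s x).
rewrite -E => H.
have : is_derive s (1 : R) (fun r => (fun y => f (lsubmx y 0 0) (rsubmx y 0 0))
     (point_at (0 + r *: (delta_mx 0 0 : 'rV[R]_1)) x)) (dtime f s x).
  apply: H; apply/derivableP/diff_derivable; apply: smooth_onW sf _.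
  exact: strip_at2.
rewrite (_ : (fun r => _) = f ^~ x) //.
by apply/funext => r; rewrite /= -E at2K_time at2K_space.
Qed.

Lemma is_derive_dspace e f s x : smooth_family e f -> `|s| < e ->
  is_derive x (1 : R) (f s) (dspace f s x).
Proof.
move=> sf se.
have := @is_derive_space R 1 (fun y => f (lsubmx y 0 0) (rsubmx y 0 0)) s%:M x (dspace f s x).
move=> H.
have : is_derive x (1 : R) (fun r => (fun y => f (lsubmx y 0 0) (rsubmx y 0 0))
     (point_at s%:M r)) (dspace f s x).
  apply: H; apply/derivableP/diff_derivable; apply: smooth_onW sf _.
  exact: strip_at2.
rewrite (_ : (fun r => _) = f s) //.
by apply/funext => r; rewrite -/(at2 s r) at2K_time at2K_space.
Qed.

(** This is what makes a variation commute with [d/dx]. *)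
Lemma dtime_dspace e f s x : smooth_family e f -> `|s| < e ->
  dtime (dspace f) s x = dspace (dtime f) s x.
Proof.
move=> sf se; rewrite /dtime /dspace.
under eq_fun do rewrite at2_eta.
under [in RHS]eq_fun do rewrite at2_eta.
apply: partialC (@open_strip e) sf _; exact: strip_at2.
Qed.

Lemma smooth_family_slice e f s : smooth_family e f -> `|s| < e -> smooth1 (f s).
Proof.
move=> sf se.
have := @smooth1_slice R 1 (strip e) _ s%:M sf (fun x => strip_at2 x se).
by under eq_fun do rewrite -/(at2 s _) at2K_time at2K_space.
Qed.

Lemma smooth_family_continuous e f s x : smooth_family e f -> `|s| < e ->
  {for (s, x), continuous (fun z : R * R => f z.1 z.2)}.
Proof.
move=> sf se.
have d := smooth_onW sf (strip_at2 x se).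
rewrite (_ : (fun z => _) = (fun y => f (lsubmx y 0 0) (rsubmx y 0 0)) \o
   ((fun z : 'rV[R]_1 * R => point_at z.1 z.2) \o (fun z : R * R => (z.1%:M, z.2)))); last first.
  by apply/funext => z /=; rewrite -/(at2 _ _) at2K_time at2K_space.
apply: continuous_comp; last exact: differentiable_continuous d.
apply: continuous_comp; last exact: continuous_point_at.
have cs : {for s, continuous (fun r : R => r%:M : 'rV[R]_1)}.
  apply: continuous_rV => j.
  rewrite (_ : (fun z => _) = id); first exact: cvg_id.
  by apply/funext => z; rewrite mxE ord1 eqxx.
move=> P [[A B] /= [nA nB] AB].
by exists ((fun r : R => r%:M) @^-1` A, B) => /= [|[r z] /= [Ar Bz]];
  [split => //; exact: cs|exact: (AB (r%:M, z))].
Qed.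

Lemma smooth_familyD e f h : smooth_family e f -> smooth_family e h ->
  smooth_family e (fun s x => f s x + h s x).
Proof. by move=> sf sh; apply: smooth_onD => //; exact: open_strip. Qed.

Lemma smooth_familyB e f h : smooth_family e f -> smooth_family e h ->
  smooth_family e (fun s x => f s x - h s x).
Proof. by move=> sf sh; apply: smooth_onB => //; exact: open_strip. Qed.

Lemma smooth_familyM e f h : smooth_family e f -> smooth_family e h ->
  smooth_family e (fun s x => f s x * h s x).
Proof. by move=> sf sh; apply: smooth_onM => //; exact: open_strip. Qed.

Lemma smooth_family_sum e (I : finType) (f : I -> R -> R -> R) :
  (forall i, smooth_family e (f i)) -> smooth_family e (fun s x => \sum_i f i s x).
Proof.
move=> sf; apply: (@smooth_on_sum _ _ _ I _ xpredT
  (fun i y => f i (lsubmx y 0 0) (rsubmx y 0 0))) => [|i _]; first exact: open_strip.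
exact: sf.
Qed.

Lemma smooth_family_cst e (f : R -> R) : smooth1 f -> smooth_family e (fun _ x => f x).
Proof. by move=> sf; exact: smooth_on_space. Qed.

Lemma smooth_family_comp e n (U : set 'rV[R]_n) (F : 'rV[R]_n -> R) (phi : R -> R -> 'rV[R]_n) :
  smooth_on U F -> (forall j, smooth_family e (fun s x => phi s x 0 j)) ->
  (forall s x, `|s| < e -> U (phi s x)) -> smooth_family e (fun s x => F (phi s x)).
Proof.
move=> sF sphi Uphi.
apply: (@smooth_on_comp _ _ _ _ U (fun y => phi (lsubmx y 0 0) (rsubmx y 0 0)) F) => //.
  exact: open_strip.
by move=> y sy; apply: Uphi.
Qed.

(** The passage from joint smoothness, which is what functionals provide, to the uniform notions
    used under integrals. *)
Lemma smooth_family_uniform_derivative M e f : 0 < e -> smooth_family e f ->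
  (forall s x, `|s| < e -> M < `|x| -> f s x = 0) ->
  [/\ uniform_derivative f (dtime f 0), windowed M (dtime f 0) &
      forall s, `|s| < e -> windowed M (f s)].
Proof.
move=> e0 sf f0.
have df s x : `|s| < e -> is_derive s (1 : R) (f ^~ x) (dtime f s x).
  exact: is_derive_dtime.
have cdf x : {for (0, x), continuous (fun z : R * R => dtime f z.1 z.2)}.
  apply: (@smooth_family_continuous e) => //; first exact: smooth_family_dtime.
  by rewrite normr0.
split; [exact: C1_uniform_derivative e0 f0 df cdf|exact: C1_windowed e0 f0 df cdf|].
move=> s se; split; last by move=> x; exact: f0.
exact: smooth1_continuous (smooth_family_slice sf se).
Qed.

Definition windowed_family M e f :=
  smooth_family e f /\ forall s x, `|s| < e -> M < `|x| -> f s x = 0.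

Lemma tail_uniform_derivative M e (a b : R -> R -> R) : 0 <= M -> 0 < e ->
  windowed_family M e a -> windowed_family M e b ->
  uniform_derivative (fun s x => a s x * dx_inv (b s) x)
    (fun x => dtime a 0 x * dx_inv (b 0) x + a 0 x * dx_inv (dtime b 0) x).
Proof.
move=> M0 e0 [sa a0] [sb b0]; have e00 : `|(0 : R)| < e by rewrite normr0.
have [ua wa Wa] := smooth_family_uniform_derivative e0 sa a0.
have [ub wb Wb] := smooth_family_uniform_derivative e0 sb b0.
have [c1 c10 H1] := windowed_bounded (Wa _ e00).
have [c2 c20 H2] := windowed_bounded wa.
have [c3 c30 H3] := dx_inv_bounded M0 (Wb _ e00).
have [c4 c40 H4] := dx_inv_bounded M0 wb.
(* The sum is a bound valid for all four functions at once. *)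
apply: (@uniform_derivativeM _ (c1 + c2 + c3 + c4) a (dtime a 0)
  (fun s => dx_inv (b s)) (dx_inv (dtime b 0))) => //.
- by move=> x; apply: le_trans (H1 x) _; lra.
- by move=> x; apply: le_trans (H2 x) _; lra.
- by move=> x; apply: le_trans (H3 x) _; lra.
- by move=> x; apply: le_trans (H4 x) _; lra.
- apply: (uniform_derivative_dx_inv M0) => //.
  exact: small_near0 e0 Wb.
Qed.

(** The shape of the bracket along a line of fields: one local density and two products, each with
    one [dx_inv]. *)
Lemma is_derive_nonlocal M e (l a1 b1 a2 b2 : R -> R -> R) : 0 <= M -> 0 < e ->
  windowed_family M e l -> windowed_family M e a1 -> windowed_family M e b1 ->
  windowed_family M e a2 -> windowed_family M e b2 ->
  is_derive (0 : R) (1 : R)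
    (fun s => itotal (fun x => l s x + a1 s x * dx_inv (b1 s) x + a2 s x * dx_inv (b2 s) x))
    (itotal (fun x => dtime l 0 x
       + (dtime a1 0 x * dx_inv (b1 0) x + a1 0 x * dx_inv (dtime b1 0) x)
       + (dtime a2 0 x * dx_inv (b2 0) x + a2 0 x * dx_inv (dtime b2 0) x))).
Proof.
move=> M0 e0 wl wa1 wb1 wa2 wb2; have e00 : `|(0 : R)| < e by rewrite normr0.
have [ul dl Wl] := smooth_family_uniform_derivative e0 wl.1 wl.2.
have [_ da1 Wa1] := smooth_family_uniform_derivative e0 wa1.1 wa1.2.
have [_ db1 Wb1] := smooth_family_uniform_derivative e0 wb1.1 wb1.2.
have [_ da2 Wa2] := smooth_family_uniform_derivative e0 wa2.1 wa2.2.
have [_ db2 Wb2] := smooth_family_uniform_derivative e0 wb2.1 wb2.2.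
have wM (a b : R -> R) : windowed M a -> windowed M b -> windowed M (fun x => a x * dx_inv b x).
  by move=> wa wb; apply: windowedMr wa; exact: dx_inv_continuous wb.
apply: (is_derive_itotal M0 (f := fun s x =>
    l s x + a1 s x * dx_inv (b1 s) x + a2 s x * dx_inv (b2 s) x)).
- apply: (small_near0 e0) => s se; apply: windowedD; first apply: windowedD.
  + exact: Wl.
  + by apply: wM; [exact: Wa1|exact: Wb1].
  + by apply: wM; [exact: Wa2|exact: Wb2].
- apply: windowedD; first apply: windowedD => //; apply: windowedD; apply: wM => //;
    by [exact: Wa1|exact: Wb1|exact: Wa2|exact: Wb2].
- apply: uniform_derivativeD; first apply: uniform_derivativeD => //.
  + exact: tail_uniform_derivative wa1 wb1.
  + exact: tail_uniform_derivative wa2 wb2.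
Qed.

End SmoothFamilies.

(** * Second variations of functionals *)

Section Functionals.
Context {R : realType} {n : nat}.
Variables (U : set 'rV[R]_n) (oU : open U).
Implicit Types (u v xi : R -> 'rV[R]_n) (e s x M : R).

Definition line u v s : R -> 'rV[R]_n := fun x => u x + s *: v x.

Lemma line0 u v : line u v 0 = u.
Proof. by apply/funext => x; rewrite /line scale0r addr0. Qed.

Lemma affine_line u v (s : 'rV[R]_1) : affine_family u (fun _ => v) s = line u v (s 0 0).
Proof. by apply/funext => x; rewrite /affine_family big_ord1. Qed.

Lemma test_fieldI v M : (forall i, smooth1 (fun x => v x 0 i)) ->
  (forall x, M < `|x| -> v x = 0) -> test_field v.
Proof. by move=> sv v0; split; [move=> i m x; exact: sv|exists M]. Qed.

Lemma field_line u v : field U u -> test_field v ->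
  exists2 e : R, 0 < e & forall s, `|s| < e -> field U (line u v s).
Proof.
move=> fu tv; have [e e0 He] := field_affine oU fu (fun _ : 'I_1 => tv).
exists e => // s se; have := He s%:M; rewrite affine_line mxE eqxx; apply => a.
by rewrite ord1 mxE eqxx.
Qed.

Lemma dtimeE e (f : R -> R -> R) s x d : smooth_family e f -> `|s| < e ->
  is_derive s (1 : R) (f ^~ x) d -> dtime f s x = d.
Proof.
move=> sf se H1; have H2 := is_derive_dtime x sf se.
by rewrite -(@derive_val _ _ _ _ _ _ _ H2) (@derive_val _ _ _ _ _ _ _ H1).
Qed.

(** First variations are given at parameter zero only. Moving the base point along the line yields
    derivatives at every small parameter, as [schwarz] demands. *)
Lemma is_derive_translate (f : R -> R) s (d : R) :
  is_derive (0 : R) (1 : R) (fun r => f (s + r)) d -> is_derive s (1 : R) f d.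
Proof.
have E : (fun h : R => h^-1 *: ((f \o shift s) (h *: (1 : R)) - f s)) =
    (fun h => h^-1 *: (((fun r => f (s + r)) \o shift 0) (h *: (1 : R)) - f (s + 0))).
  by apply/funext => h /=; rewrite !addr0 [h *: _ + s]addrC.
move=> [df <-]; split; first by rewrite /derivable E.
by rewrite /derive E.
Qed.

Section Derivative.
Variables (F : (R -> 'rV[R]_n) -> R) (dF : (R -> 'rV[R]_n) -> R -> 'rV[R]_n).
Hypothesis hF : has_variational_derivative U F dF.

(* The derivative of the variational derivative, i.e. the second variation. *)
Definition vderiv u v : R -> 'rV[R]_n :=
  fun x => \row_i dtime (fun s x => dF (line u v s) x 0 i) 0 x.

Lemma smooth_family_line u v e i : field U u -> test_field v ->
  (forall s, `|s| < e -> field U (line u v s)) ->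
  smooth_family e (fun s x => dF (line u v s) x 0 i).
Proof.
move=> fu tv He; have [_ _ H] := hF.
have := H 1%N u (fun _ => v) fu (fun _ => tv) i.
have -> : (fun y : 'rV[R]_(1 + 1) => dF (affine_family u (fun _ => v) (lsubmx y)) (rsubmx y 0 0) 0 i)
   = (fun y => dF (line u v (lsubmx y 0 0)) (rsubmx y 0 0) 0 i).
  by apply/funext => y; rewrite affine_line.
apply: smooth_on_sub => y; rewrite /strip /= => ye.
by rewrite affine_line; exact: He.
Qed.

Lemma variational_window : exists2 M : R, 0 <= M &
  forall u, field U u -> forall x, M < `|x| -> dF u x = 0.
Proof.
have [_ [M H] _] := hF; exists `|M| => // u fu x Mx; apply: H => //.
exact: le_lt_trans (ler_norm M) Mx.
Qed.

Lemma test_field0 : test_field (fun=> 0 : 'rV[R]_n).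
Proof.
split; last by exists 0.
move=> i m x; have -> : (fun y : R => (0 : 'rV[R]_n) 0 i) = cst 0 by apply/funext => y; rewrite mxE.
elim: m x => [|m IH] x; first exact: derivable_cst.
rewrite derive1Sn; have -> : derive1 (cst (0 : R)) = cst (0 : R).
  by apply/funext => y; rewrite derive1E derive_cst.
exact: IH.
Qed.

(** Smoothness in [x] is extracted from the line along the zero direction, a family that does not
    move. *)
Lemma test_field_variational u : field U u -> test_field (dF u).
Proof.
move=> fu; have [M M0 HM] := variational_window.
have lE s : line u (fun=> 0) s = u by apply/funext => x; rewrite /line scaler0 addr0.
apply: (test_fieldI (M := M)); last exact: HM.
move=> i; have sf : smooth_family 1 (fun s x => dF (line u (fun=> 0) s) x 0 i).
  by apply: smooth_family_line => //; [exact: test_field0|move=> s _; rewrite lE].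
by have := smooth_family_slice (s := 0) sf; rewrite normr0 lE; apply.
Qed.

Lemma is_derive_vderiv u v x i : field U u -> test_field v ->
  is_derive (0 : R) (1 : R) (fun s => dF (line u v s) x 0 i) (vderiv u v x 0 i).
Proof.
move=> fu tv; have [e e0 He] := field_line fu tv.
rewrite mxE; apply: (is_derive_dtime (e := e)); last by rewrite normr0.
exact: smooth_family_line.
Qed.

Lemma test_field_vderiv u v : field U u -> test_field v -> test_field (vderiv u v).
Proof.
move=> fu tv; have [e e0 He] := field_line fu tv.
have [M M0 HM] := variational_window.
have sf i := smooth_family_line i fu tv He.
apply: (test_fieldI (M := M)) => [i|x Mx].
  have := smooth_family_slice (s := 0) (smooth_family_dtime (sf i)).
  by rewrite normr0 => /(_ e0); under [in X in _ -> X]eq_fun do rewrite mxE.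
apply/rowP => i; rewrite !mxE.
have [|_ [_ H] _] := smooth_family_uniform_derivative (M := M) e0 (sf i).
  by move=> s y se My; rewrite HM ?mxE //; exact: He.
exact: H.
Qed.

Lemma windowed_dot M (a b : R -> 'rV[R]_n) : (forall i, continuous (fun x => a x 0 i)) ->
  (forall i, continuous (fun x => b x 0 i)) -> (forall x, M < `|x| -> b x = 0) ->
  windowed M (fun x => dot (a x) (b x)).
Proof.
move=> ca cb b0; split => [x|x Mx]; last by rewrite b0 // dot0r.
have -> : (fun x => dot (a x) (b x)) = (fun x => \sum_i a x 0 i * b x 0 i).
  by apply/funext => y; rewrite dotE.
elim: (index_enum _) => [|i r IH].
  rewrite (_ : (fun q => _) = cst 0); first exact: cvg_cst.
  by apply/funext => q; rewrite big_nil.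
rewrite (_ : (fun q => _) = fun q => a q 0 i * b q 0 i + \sum_(i <- r) a q 0 i * b q 0 i).
  by apply: cvgD => //; apply: cvgM; [exact: ca|exact: cb].
by apply/funext => q; rewrite big_cons.
Qed.

Lemma pairingE (a b : R -> 'rV[R]_n) : pairing a b = itotal (fun x => dot (a x) (b x)).
Proof. by rewrite /pairing /itotal; congr Rintegral; apply/funext => x; rewrite dotE. Qed.

Lemma test_field_continuous v i : test_field v -> continuous (fun x => v x 0 i).
Proof. by move=> [sv _]; exact: smooth1_continuous (@smooth_path_coord _ _ v i sv). Qed.

Lemma is_derive_pairing u v b : field U u -> test_field v -> test_field b ->
  is_derive (0 : R) (1 : R) (fun s => pairing (dF (line u v s)) b)
    (pairing (vderiv u v) b).
Proof.
move=> fu tv tb; have [e e0 He] := field_line fu tv.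
have [M [M0 b0]] := test_field_window tb.
have sf i := smooth_family_line i fu tv He.
have sfd : smooth_family e (fun s x => dot (dF (line u v s) x) (b x)).
  have -> : (fun s x => dot (dF (line u v s) x) (b x)) =
      (fun s x => \sum_i dF (line u v s) x 0 i * b x 0 i).
    by apply/funext => s; apply/funext => x; rewrite dotE.
  apply: smooth_family_sum => i; apply: smooth_familyM => //.
  by apply: smooth_family_cst; apply: smooth_path_coord; case: tb.
have dE x : dtime (fun s x => dot (dF (line u v s) x) (b x)) 0 x = dot (vderiv u v x) (b x).
  apply: (dtimeE sfd); rewrite ?normr0 //.
  have H : sderiv (0 : R) (1 : R) (fun s => \sum_i dF (line u v s) x 0 i * b x 0 i)
      (\sum_i vderiv u v x 0 i * b x 0 i).
    apply: sderiv_sum => i.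
    have H : sderiv (0 : R) (1 : R) (fun s => dF (line u v s) x 0 i) (vderiv u v x 0 i).
      by have [d <-] := is_derive_vderiv x i fu tv; split => //; apply/derivable1_diffP.
    by apply: sderiv_eq (sderivM H (sderiv_cst (0 : R) (1 : R) (b x 0 i))); rewrite mulr0 addr0.
  have := sderiv_is_derive H; rewrite -dotE.
  by rewrite (_ : (fun s => \sum_i _) = (fun s => dot (dF (line u v s) x) (b x))) //;
    apply/funext => s; rewrite dotE.
have [|ud wd Wd] := smooth_family_uniform_derivative (M := M) e0 sfd.
  by move=> s x se Mx; rewrite b0 // dot0r.
have := is_derive_itotal M0 (small_near0 e0 Wd) wd ud.
rewrite (_ : dtime _ 0 = (fun x => dot (vderiv u v x) (b x))); last by apply/funext.
rewrite -pairingE (_ : (fun s => itotal _) = (fun s => pairing (dF (line u v s)) b)) //.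
by apply/funext => s; rewrite pairingE.
Qed.

Lemma near0_rV m (P : 'rV[R]_m -> Prop) : (\forall s \near (0 : 'rV[R]_m), P s) ->
  exists2 e : R, 0 < e & forall s : 'rV[R]_m, (forall a, `|s 0 a| < e) -> P s.
Proof.
move=> /nbhs_ballP[e e0 He]; exists e => // s se; apply: He.
rewrite -ball_normE /ball_ /= sub0r normrN [ltLHS]/Num.Def.normr /= mx_normrE.
by apply/bigmax_ltP; split => // -[i j] _; rewrite ord1.
Qed.

Section TwoVariations.
Variables (m : nat) (u : R -> 'rV[R]_n) (v : 'I_m -> R -> 'rV[R]_n).
Hypotheses (fu : field U u) (tv : forall a, test_field (v a)).
Implicit Types (z : 'rV[R]_m) (a c : 'I_m).

Let A z := affine_family u v z.

Lemma affine_shift z a s : A (z + s *: delta_mx 0 a) = line (A z) (v a) s.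
Proof.
apply/funext => x; rewrite /A /affine_family /line -addrA; congr (_ + _).
rewrite [in LHS](bigD1 a) //= [in RHS](bigD1 a) //= !mxE !eqxx mulr1 scalerDl addrAC.
congr (_ + _ + _); apply: eq_bigr => c ca.
by rewrite !mxE (negPf ca) andbF mulr0 addr0.
Qed.

(** At the fields of a family the second variation is a partial derivative of one function that is
    jointly smooth in the parameters and [x]; its continuity in the parameters comes from this. *)
Lemma vderiv_affine z a x i : field U (A z) -> vderiv (A z) (v a) x 0 i =
  partial (lshift 1 a) (fun y => dF (A (lsubmx y)) (rsubmx y 0 0) 0 i) (point_at z x).
Proof.
move=> fz; have [_ _ /(_ m u v fu tv i) sH] := hF.
have dH := smooth_onW sH (p := point_at z x).
rewrite /= point_atK_time in dH.
have H1 : is_derive (0 : R) (1 : R) (fun r =>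
   (fun y => dF (A (lsubmx y)) (rsubmx y 0 0) 0 i) (point_at (z + r *: delta_mx 0 a) x))
   (partial (lshift 1 a) (fun y => dF (A (lsubmx y)) (rsubmx y 0 0) 0 i) (point_at z x)).
  have := @is_derive_time R m (fun y => dF (A (lsubmx y)) (rsubmx y 0 0) 0 i) z x a 0
    (partial (lshift 1 a) (fun y => dF (A (lsubmx y)) (rsubmx y 0 0) 0 i) (point_at z x)).
  rewrite {1}scale0r addr0; apply; apply/derivableP/diff_derivable; exact: dH.
have H2 := is_derive_vderiv x i fz (tv a).
have E : (fun r => (fun y => dF (A (lsubmx y)) (rsubmx y 0 0) 0 i)
     (point_at (z + r *: delta_mx 0 a) x)) = (fun s => dF (line (A z) (v a) s) x 0 i).
  by apply/funext => r; rewrite /= point_atK_time point_atK_space affine_shift.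
rewrite E in H1.
by rewrite -(@derive_val _ _ _ _ _ _ _ H2) (@derive_val _ _ _ _ _ _ _ H1).
Qed.

(** The continuity assumption of [schwarz]. The integrands are close uniformly on the compact window
    of [v c], hence so are the integrals. *)
Lemma near_second_variation a c eps : 0 < eps ->
  \forall z \near (0 : 'rV[R]_m),
    `|pairing (vderiv (A z) (v a)) (v c) - pairing (vderiv (A 0) (v a)) (v c)| < eps.
Proof.
move=> eps0; have [M [M0 v0]] := test_field_window (tv c).
have [e e0 He] := field_affine oU fu tv.
have nearf : \forall z \near (0 : 'rV[R]_m), field U (A z).
  apply/nbhs_ballP; exists e => // z; rewrite -ball_normE /ball_ /= sub0r normrN => ze.
  apply: He => k; apply: le_lt_trans ze.
  by rewrite [leRHS]/Num.Def.normr /= mx_normrE; exact: (le_bigmax _ _ (0, k)).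
have f0 := nbhs_singleton nearf.
pose f z x := dot (vderiv (A z) (v a) x) (v c x).
have d0 : 0 < eps / (2 * M + 1) by rewrite divr_gt0 //; lra.
have K : near_covering `[- M, M]%classic by apply/compact_near_coveringP/segment_compact.
(* The guard [field U (A z)] stays inside the covering argument because [vderiv] is identified with
   the partial derivative only at fields. *)
have U1 : \forall z \near (0 : 'rV[R]_m), `[- M, M]%classic `<=`
    (fun x => field U (A z) -> `|f z x - f 0 x| <= eps / (2 * M + 1)).
  apply: (K _ (nbhs (0 : 'rV[R]_m))
    (fun z x => field U (A z) -> `|f z x - f 0 x| <= eps / (2 * M + 1))) => // x _.
  pose h (y : 'rV[R]_(m + 1)) := \sum_i partial (lshift 1 a)
    (fun y => dF (A (lsubmx y)) (rsubmx y 0 0) 0 i) y * v c (rsubmx y 0 0) 0 i.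
  have hE z y : field U (A z) -> f z y = h (point_at z y).
    move=> fz; rewrite /f dotE /h; apply: eq_bigr => i _.
    by rewrite vderiv_affine // point_atK_space.
  have dh : differentiable h (point_at 0 x).
    rewrite /h (_ : (fun y => _) = \sum_i (fun y => partial (lshift 1 a)
      (fun y => dF (A (lsubmx y)) (rsubmx y 0 0) 0 i) y * v c (rsubmx y 0 0) 0 i)); last first.
      by apply/funext => y; rewrite fct_sumE.
    apply: differentiable_sum => i; apply: differentiableM.
      have [_ _ /(_ m u v fu tv i) sH] := hF.
      apply: smooth_onW (smooth_on_partial _ sH) _.
      by rewrite /= point_atK_time.
    have [svc _] := tv c.
    exact: smooth_onW (@smooth_on_space _ _ setT _ (@smooth_path_coord _ _ (v c) i svc)) I.
  have ch : {for (0, x), continuous (fun z : 'rV[R]_m * R => h (point_at z.1 z.2))}.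
    apply: (@continuous_comp _ _ _ (fun z : 'rV[R]_m * R => point_at z.1 z.2) h).
      exact: (@continuous_point_at _ _ (0 : 'rV[R]_m) x).
    exact: differentiable_continuous dh.
  have e20 : 0 < eps / (2 * M + 1) / 2 by rewrite divr_gt0.
  have := ch => /cvgrPdist_lt/(_ _ e20) [[P Q] /= [nP nQ] PQ].
  exists (Q, P) => //= -[y z] [/= Qy Pz] fz.
  have H1 := PQ (z, y) (conj Pz Qy); have H2 := PQ (0, y) (conj (nbhs_singleton nP) Qy).
  rewrite /= in H1 H2.
  rewrite !hE //.
  have -> : h (point_at z y) - h (point_at 0 y) =
    (h (point_at 0 x) - h (point_at 0 y)) - (h (point_at 0 x) - h (point_at z y)) by ring.
  apply: le_trans (ler_normB _ _) _; apply: ltW.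
  by rewrite [ltRHS]splitr ltrD.
apply: filterS2 nearf U1 => z fz U1.
have wf z' : field U (A z') -> windowed M (f z').
  move=> fz'; apply: windowed_dot v0 => i; apply: test_field_continuous => //.
  exact: test_field_vderiv.
rewrite !pairingE -(itotalB (wf _ fz) (wf _ f0)).
have wd := windowedD (wf _ fz) (windowedN (wf _ f0)).
apply: le_lt_trans (le_itotal M0 wd (c := eps / (2 * M + 1)) _) _.
  move=> x; have [Mx|xM] := ltP M `|x|.
    by case: wd => _ ->; rewrite ?normr0 // ltW.
  by apply: U1 => //; rewrite /= in_itv /= -ler_norml.
rewrite mulrAC -mulrA gtr_pMr // ltr_pdivrMr; lra.
Qed.

Lemma is_derive_affine_pairing z a c r : field U (A (z + r *: delta_mx 0 a)) ->
  is_derive r (1 : R) (fun r => pairing (dF (A (z + r *: delta_mx 0 a))) (v c))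
    (pairing (vderiv (A (z + r *: delta_mx 0 a)) (v a)) (v c)).
Proof.
move=> fz; apply: is_derive_translate.
have := is_derive_pairing fz (tv a) (tv c).
rewrite (_ : (fun s => _) = (fun s => pairing (dF (A (z + (r + s) *: delta_mx 0 a))) (v c))) //.
by apply/funext => s; rewrite -affine_shift scalerDl addrA.
Qed.

Lemma is_derive_affine_functional z a r : field U (A (z + r *: delta_mx 0 a)) ->
  is_derive r (1 : R) (fun r => F (A (z + r *: delta_mx 0 a)))
    (pairing (dF (A (z + r *: delta_mx 0 a))) (v a)).
Proof.
move=> fz; apply: is_derive_translate.
have [/(_ _ _ fz (tv a)) H _ _] := hF; move: H; rewrite /first_variation.
rewrite (_ : (fun s => _) = (fun s => F (A (z + (r + s) *: delta_mx 0 a)))) //.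
by apply/funext => s; rewrite scalerDl addrA [in RHS]affine_shift.
Qed.

End TwoVariations.

(** Schwarz's theorem for the function [F (u + s v + t w)] of the two real variables [s] and [t]. *)
Lemma second_variation_sym u v w : field U u -> test_field v -> test_field w ->
  pairing (vderiv u v) w = pairing (vderiv u w) v.
Proof.
move=> fu tv tw.
pose f (a : 'I_2) := if a == 0 then v else w.
have tf a : test_field (f a) by rewrite /f; case: ifP.
pose z s t : 'rV[R]_2 := s *: delta_mx 0 0 + t *: delta_mx 0 1.
have z0 : z 0 0 = 0 by rewrite /z !scale0r addr0.
have zs s t a : `|z s t 0 a| <= Num.max `|s| `|t|.
  rewrite /z !mxE; case: a => -[|[|//]] /= ia.
    by rewrite !mulr0 mulr1 addr0 le_max lexx.
  by rewrite mulr0 mulr1 add0r le_max lexx orbT.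
have zC s t : z s t = t *: delta_mx 0 1 + s *: delta_mx 0 0 by rewrite addrC.
have [e e0 He] := field_affine oU fu tf.
have fz s t : `|s| < e -> `|t| < e -> field U (affine_family u f (z s t)).
  by move=> se te; apply: He => a; apply: le_lt_trans (zs _ _ _) _; rewrite gt_max se te.
have A0 : affine_family u f 0 = u.
  by apply/funext => x; rewrite /affine_family big1 ?addr0 // => a _; rewrite mxE scale0r.
have H1 (s t : R) : `|s| < e -> `|t| < e -> is_derive s (1 : R) (fun s => F (affine_family u f (z s t)))
    (pairing (dF (affine_family u f (z s t))) (f 0)).
  move=> se te; under eq_fun do rewrite zC; rewrite zC.
  by apply: is_derive_affine_functional => //; rewrite -zC; exact: fz.
have H2 (s t : R) : `|s| < e -> `|t| < e -> is_derive t (1 : R) (fun t => F (affine_family u f (z s t)))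
    (pairing (dF (affine_family u f (z s t))) (f 1)).
  by move=> se te; apply: is_derive_affine_functional => //; exact: fz.
have H3 (s t : R) : `|s| < e -> `|t| < e -> is_derive t (1 : R)
    (fun t => pairing (dF (affine_family u f (z s t))) (f 0))
    (pairing (vderiv (affine_family u f (z s t)) (f 1)) (f 0)).
  by move=> se te; apply: is_derive_affine_pairing => //; exact: fz.
have H4 (s t : R) : `|s| < e -> `|t| < e -> is_derive s (1 : R)
    (fun s => pairing (dF (affine_family u f (z s t))) (f 1))
    (pairing (vderiv (affine_family u f (z s t)) (f 0)) (f 1)).
  move=> se te; under eq_fun do rewrite zC; rewrite zC.
  by apply: is_derive_affine_pairing => //; rewrite -zC; exact: fz.
apply/esym.
apply: (schwarz e0 H1 H2 H3 H4) => eps eps0.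
have [d1 d10 K1] := near0_rV (near_second_variation fu tf 1 0 eps0).
have [d2 d20 K2] := near0_rV (near_second_variation fu tf 0 1 eps0).
exists (Num.min d1 d2); first by rewrite lt_min d10 d20.
move=> s t; rewrite !lt_min => /andP[s1 s2] /andP[t1 t2].
rewrite A0 in K1 K2; split.
  by apply: K1 => a; apply: le_lt_trans (zs _ _ _) _; rewrite gt_max s1 t1.
by apply: K2 => a; apply: le_lt_trans (zs _ _ _) _; rewrite gt_max s2 t2.
Qed.

End Derivative.

End Functionals.

(** * Nonlocal operators of hydrodynamic type *)

Section TrivectorAlgebra.
Context {R : realType} {n : nat}.
Implicit Types (a b : 'rV[R]_n) (k : R).

Lemma dot_mulmxT a b (M : 'M[R]_n) : dot a (b *m M^T) = dot (a *m M) b.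
Proof. by rewrite [RHS]dot_mulmx. Qed.

Section Density.
Variables (X v v' xi xi' eta eta' : 'rV[R]_n) (fx px fy py : R).
Variables (G Wt CX Cv Cv' dXv dvX dWX dWv : 'M[R]_n).
Hypotheses (GT : G^T = G) (XCv : X *m Cv^T = v *m CX^T).
Hypothesis codazzi : X *m dWv + X *m Wt *m Cv^T = v *m dWX + v *m Wt *m CX^T.
Hypothesis gauss : (dXv - dvX + (CX *m Cv - Cv *m CX)) *m G =
  outer (X *m Wt) v + outer X (v *m Wt) - outer v (X *m Wt) - outer (v *m Wt) X.

Let Dxi := xi' - xi *m CX.
Let Deta := eta' - eta *m CX.
Let dGX := - (CX *m G + G *m CX^T).
Let dGv := - (Cv *m G + G *m Cv^T).
Let dW := v' *m Wt + X *m dWv.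

(** Here [X] is [u_x], a prime is [d/dx], and [fx], [px], [fy], [py] are the nonlocal potentials.
    Subtracting the derivative of the primitive removes [v'] and [Cv']. The Codazzi equation trades
    [dWv] for [dWX], and the Gauss equation turns the curvature into products that cancel those
    created by differentiating the potentials. *)
Lemma trivector_density :
  (dot xi (Deta *m dGv - eta *m (dvX + Cv') *m G) + dot xi dW * fy + dot xi v' * py
   - px * dot v' eta - fx * dot dW eta)
  - (- (dot xi' (eta *m Cv *m G) + dot xi ((eta' *m Cv + eta *m (dXv + Cv')) *m G + eta *m Cv *m dGX))
     + ((dot xi' (v *m Wt) + dot xi (v' *m Wt + v *m dWX)) * fy + dot xi (v *m Wt) * dot X eta)
     + ((dot xi' v + dot xi v') * py + dot xi v * dot (X *m Wt) eta)
     - ((dot eta' (v *m Wt) + dot eta (v' *m Wt + v *m dWX)) * fx + dot eta (v *m Wt) * dot X xi)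
     - ((dot eta' v + dot eta v') * px + dot eta v * dot (X *m Wt) xi)) =
  - dot xi ((Deta *m G + fy *: (X *m Wt) + py *: X) *m Cv^T)
  + dot eta ((Dxi *m G + fx *: (X *m Wt) + px *: X) *m Cv^T)
  - dot Dxi (fy *: (v *m Wt) + py *: v) + dot Deta (fx *: (v *m Wt) + px *: v).
Proof.
(* The Gauss equation tested on the covectors [xi] and [eta]. *)
have E4 : dot xi (eta *m dXv *m G) - dot xi (eta *m dvX *m G) +
    (dot xi (eta *m CX *m Cv *m G) - dot xi (eta *m Cv *m CX *m G)) =
  dot eta (X *m Wt) * dot xi v + dot eta X * dot xi (v *m Wt)
  - dot eta v * dot xi (X *m Wt) - dot eta (v *m Wt) * dot xi X.
  have := congr1 (fun M => dot xi (eta *m M)) gauss.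
  rewrite !mulmxA !(mulmxDr, mulmxBr, mulmxN, mulmxDl, mulmxBl, mulNmx) !row_outer !mulmxA.
  by rewrite !(dotDr, dotNr, dotZr).
have dWE : dW = v' *m Wt + (v *m dWX + v *m Wt *m CX^T - X *m Wt *m Cv^T).
  by rewrite /dW -codazzi addrK.
have flip a b : dot a (b *m G) = dot b (a *m G).
  by rewrite [RHS]dotC dot_mulmx GT.
rewrite [dot dW eta]dotC dWE [dot v' eta]dotC [dot X eta]dotC [dot X xi]dotC.
rewrite [dot (X *m Wt) eta]dotC [dot (X *m Wt) xi]dotC.
rewrite /dGX /dGv /Dxi /Deta.
rewrite !(mulmxDl, mulmxBl, mulNmx, mulmxDr, mulmxN, =^~ scalemxAl) !mulmxA XCv.
rewrite !(dotDl, dotNl, dotDr, dotNr, dotZr, dot_mulmxT).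
rewrite [dot (eta *m Cv) (xi' *m G)]flip [dot (eta *m Cv) (xi *m CX *m G)]flip.
have {}E4 : dot xi (eta *m dXv *m G) =
  dot eta (X *m Wt) * dot xi v + dot eta X * dot xi (v *m Wt)
  - dot eta v * dot xi (X *m Wt) - dot eta (v *m Wt) * dot xi X
  - (dot xi (eta *m CX *m Cv *m G) - dot xi (eta *m Cv *m CX *m G))
  + dot xi (eta *m dvX *m G).
  by rewrite -E4; do ?[move: (dot _ _) => ?]; ring.
rewrite E4; do ?[move: (dot _ _) => ?]; ring.
Qed.

End Density.

Section Cyclic.
Variables (X : 'rV[R]_n) (G Wt : 'M[R]_n) (C : 'rV[R]_n -> 'M[R]_n).
Hypothesis CT : forall a b, a *m (C b)^T = b *m (C a)^T.
Hypothesis GT : G^T = G.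
Hypothesis sym : forall a b, dot (a *m G *m Wt) b = dot (b *m G *m Wt) a.
Variables (x y z Dx Dy Dz : 'rV[R]_n) (fx px fy py fz pz : R).

Let J D f p := D *m G + f *: (X *m Wt) + p *: X.

(** [a], [b] are covectors, [Da], [Db] their covariant derivatives along the path, [fa], [pa], [fb],
    [pb] their nonlocal potentials. The operator values [Ja], [Jb] are separate arguments, so that
    the cyclic sum can treat them alike with [v]. *)
Definition trivector_term (a b Da Db : 'rV[R]_n) (fa pa fb pb : R) (Ja Jb v : 'rV[R]_n) : R :=
  - dot a (Jb *m (C v)^T) + dot b (Ja *m (C v)^T)
  - dot Da (fb *: (v *m Wt) + pb *: v) + dot Db (fa *: (v *m Wt) + pa *: v).

(** The connection terms cancel in pairs because [C] is symmetric in its two arguments. The other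
    terms cancel because [G] and [G *m Wt] are symmetric and products of potentials commute. *)
Lemma trivector_cyclic :
  trivector_term x y Dx Dy fx px fy py (J Dx fx px) (J Dy fy py) (J Dz fz pz) +
  trivector_term y z Dy Dz fy py fz pz (J Dy fy py) (J Dz fz pz) (J Dx fx px) +
  trivector_term z x Dz Dx fz pz fx px (J Dz fz pz) (J Dx fx px) (J Dy fy py) = 0.
Proof.
rewrite /trivector_term.
rewrite (CT (J Dz fz pz) (J Dx fx px)) (CT (J Dy fy py) (J Dz fz pz)).
rewrite (CT (J Dy fy py) (J Dx fx px)).
have Gsym a b : dot a (b *m G) = dot b (a *m G) by rewrite [RHS]dotC dot_mulmx GT.
have sym' a b : dot a (b *m G *m Wt) = dot b (a *m G *m Wt).
  by rewrite dotC sym dotC.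
rewrite /J !(mulmxDl, =^~ scalemxAl) !(dotDl, dotNl, dotDr, dotNr, dotZr, mulmxDl, =^~ scalemxAl).
rewrite (Gsym Dy Dx) (Gsym Dz Dy) (Gsym Dz Dx) (sym' Dy Dx) (sym' Dz Dy) (sym' Dz Dx).
by do ?[move: (dot _ _) => ?]; ring.
Qed.

End Cyclic.

End TrivectorAlgebra.

Section Smooth1Closure.
Context {R : realType}.

(** A function of [x] is a family constant in the parameter, and the closure properties are
    inherited from families. *)
Lemma smooth1P (f : R -> R) : smooth1 f <-> smooth_family 1 (fun _ x => f x).
Proof.
split=> [|sf]; first exact: smooth_family_cst.
by have := smooth_family_slice (s := 0) sf; rewrite normr0 => /(_ ltr01).
Qed.

Lemma smooth1D (f h : R -> R) : smooth1 f -> smooth1 h -> smooth1 (fun x => f x + h x).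
Proof. by move=> /smooth1P sf /smooth1P sh; apply/smooth1P; exact: smooth_familyD. Qed.

Lemma smooth1M (f h : R -> R) : smooth1 f -> smooth1 h -> smooth1 (fun x => f x * h x).
Proof. by move=> /smooth1P sf /smooth1P sh; apply/smooth1P; exact: smooth_familyM. Qed.

Lemma smooth1B (f h : R -> R) : smooth1 f -> smooth1 h -> smooth1 (fun x => f x - h x).
Proof. by move=> /smooth1P sf /smooth1P sh; apply/smooth1P; exact: smooth_familyB. Qed.

Lemma smooth1_sum (I : finType) (f : I -> R -> R) : (forall i, smooth1 (f i)) ->
  smooth1 (fun x => \sum_i f i x).
Proof.
move=> sf; apply/smooth1P; apply: (smooth_family_sum (f := fun i _ x => f i x)) => i.
exact/smooth1P.
Qed.

Lemma smooth1_comp n (U : set 'rV[R]_n) (F : 'rV[R]_n -> R) (u : R -> 'rV[R]_n) :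
  smooth_on U F -> path_in U u -> smooth1 (fun x => F (u x)).
Proof.
move=> sF [su Uu]; apply/smooth1P.
apply: (@smooth_family_comp _ _ _ U F (fun _ x => u x)) => // j.
by apply/smooth1P; exact: smooth_path_coord.
Qed.

Lemma smooth1_dx_inv M (f : R -> R) : windowed M f -> smooth1 f -> smooth1 (dx_inv f).
Proof.
move=> wf sf; apply: smooth1I => [x|].
  by have [] := is_derive_dx_inv x wf.
rewrite (_ : derive1 (dx_inv f) = f) //; apply/funext => x.
by rewrite derive1E; have H := is_derive_dx_inv x wf; rewrite (@derive_val _ _ _ _ _ _ _ H).
Qed.

End Smooth1Closure.

(** * The operator along a field and its skew-symmetry *)

Section Operator.
Context {R : realType} {n : nat}.
Variables (U : set 'rV[R]_n) (g w : 'rV[R]_n -> 'M[R]_n).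
Hypotheses (oU : open U) (mg : metric_on U g).
Hypothesis sw : forall i j, smooth_on U (fun p => w p i j).
Implicit Types (u xi eta : R -> 'rV[R]_n) (x M : R).

Definition wx u x : 'rV[R]_n := dx u x *m (w (u x))^T.

Definition Dcov u xi x : 'rV[R]_n := dx xi x - xi x *m Gam g (dx u x) (u x).

Lemma densitywE u xi : densityw w u xi = fun x => dot (wx u x) (xi x).
Proof.
apply/funext => x; rewrite dotE; apply: eq_bigr => j _; congr (_ * _).
by rewrite [RHS]mxE; apply: eq_bigr => k _; rewrite [_^T _ _]mxE mulrC.
Qed.

Lemma density1E u xi : density1 u xi = fun x => dot (dx u x) (xi x).
Proof. by apply/funext => x; rewrite dotE. Qed.

(** Symmetry of the Christoffel symbols is used because [Gam] contracts the first lower index,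
    whereas the operator contracts [u_x] with the second. *)
Lemma local_opE u xi x : U (u x) -> local_op g u xi x = Dcov u xi x *m g (u x).
Proof.
move=> Ux.
have DE s : Dcov u xi x 0 s = dx xi x 0 s -
    \sum_j \sum_k christoffel g j s k (u x) * dx u x 0 k * xi x 0 j.
  rewrite /Dcov [LHS]mxE [X in _ + X]mxE [X in _ - X]mxE; congr (_ - _).
  apply: eq_bigr => j _; rewrite GamE mulr_sumr; apply: eq_bigr => k _.
  rewrite (christoffelC oU mg) //; move: (christoffel _ _ _ _ _) => c; ring.
apply/rowP => i; rewrite [LHS]mxE [RHS]mxE -sumrB; apply: eq_bigr => s _.
have -> : g (u x) s i = g (u x) i s by rewrite -{1}(metric_trmx mg Ux) mxE.
rewrite DE mulrBl [dx xi x 0 s * _]mulrC; congr (_ - _).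
rewrite mulrC mulr_sumr; apply: eq_bigr => j _; rewrite mulr_sumr.
by apply: eq_bigr => k _; rewrite !mulrA.
Qed.

Lemma nonlocal_opE u xi x : U (u x) -> nonlocal_op g w u xi x =
  Dcov u xi x *m g (u x) + dx_inv (fun y => dot (dx u y) (xi y)) x *: wx u x
  + dx_inv (fun y => dot (wx u y) (xi y)) x *: dx u x.
Proof.
move=> Ux; rewrite -local_opE // /nonlocal_op /nonlocal_op_with density1E densitywE.
apply/rowP => i; rewrite [LHS]mxE [RHS]mxE [X in _ = X + _]mxE.
congr (_ + _ + _); last by rewrite [RHS]mxE mulrC.
rewrite [RHS]mxE mulrC; congr (_ * _); rewrite [RHS]mxE.
by apply: eq_bigr => k _; rewrite [_^T _ _]mxE mulrC.
Qed.

Lemma smooth1_dot (a b : R -> 'rV[R]_n) : (forall i, smooth1 (fun x => a x 0 i)) ->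
  (forall i, smooth1 (fun x => b x 0 i)) -> smooth1 (fun x => dot (a x) (b x)).
Proof.
move=> sa sb; have -> : (fun x => dot (a x) (b x)) = (fun x => \sum_i a x 0 i * b x 0 i).
  by apply/funext => x; rewrite dotE.
by apply: smooth1_sum => i; exact: smooth1M.
Qed.

Lemma smooth1_wx u i : path_in U u -> smooth1 (fun x => wx u x 0 i).
Proof.
move=> pu; have [su _] := pu.
have -> : (fun x => wx u x 0 i) = (fun x => \sum_k dx u x 0 k * w (u x) i k).
  by apply/funext => x; rewrite mxE; apply: eq_bigr => k _; rewrite [_^T _ _]mxE.
apply: smooth1_sum => k; apply: smooth1M.
  exact: (@smooth_path_coord _ _ (dx u) k (smooth_path_dx su)).
exact: smooth1_comp (sw i k) pu.
Qed.

Lemma smooth1_local_op u xi i : path_in U u -> smooth_path xi ->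
  smooth1 (fun x => local_op g u xi x 0 i).
Proof.
move=> pu sxi; have [su _] := pu; under eq_fun do rewrite mxE.
have sdx k := @smooth_path_coord _ _ (dx u) k (smooth_path_dx su).
apply: smooth1B.
  apply: smooth1_sum => j; apply: smooth1M; first exact: smooth1_comp (smooth_metric mg i j) pu.
  exact: (@smooth_path_coord _ _ (dx xi) j (smooth_path_dx sxi)).
apply: smooth1_sum => s; apply: smooth1_sum => j; apply: smooth1_sum => k.
apply: smooth1M; last exact: (@smooth_path_coord _ _ xi j sxi).
apply: smooth1M; last exact: sdx.
apply: smooth1M; first exact: smooth1_comp (smooth_metric mg i s) pu.
exact: smooth1_comp (smooth_christoffel oU mg j s k) pu.
Qed.

Lemma local_op_outside u xi M x : (forall x, M < `|x| -> xi x = 0) -> M < `|x| ->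
  local_op g u xi x = 0.
Proof.
move=> xi0 Mx; apply/rowP => i; rewrite !mxE big1 ?sub0r ?oppr0.
  rewrite big1 ?oppr0 // => s _; rewrite big1 // => j _; rewrite big1 // => k _.
  have -> : xi x 0 j = 0 by rewrite xi0 // mxE.
  by rewrite mulr0.
move=> j _; have -> : dx xi x 0 j = 0 by rewrite (dx_outside xi0) // mxE.
by rewrite mulr0.
Qed.

Section Path.
Variable u : R -> 'rV[R]_n.
Hypothesis fu : field U u.

Let pu : path_in U u := fu.1.
Let su : smooth_path u := pu.1.
Let Uu : forall x, U (u x) := pu.2.

Lemma smooth1_dx i : smooth1 (fun x => dx u x 0 i).
Proof. exact: (@smooth_path_coord _ _ (dx u) i (smooth_path_dx su)). Qed.

Lemma windowed_smooth_dot M (a xi : R -> 'rV[R]_n) : (forall i, smooth1 (fun x => a x 0 i)) ->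
  test_field xi -> (forall x, M < `|x| -> xi x = 0) -> windowed M (fun x => dot (a x) (xi x)).
Proof.
move=> sa txi xi0; apply: windowed_dot xi0 => i; first exact: smooth1_continuous.
exact: test_field_continuous.
Qed.

(** The nonlocal potentials need not vanish at infinity, but their cofactors [wx w u] and [dx u] do.
    The Jacobi identity varies the bracket along exactly these directions. *)
Lemma test_field_nonlocal xi : test_field xi -> test_field (nonlocal_op g w u xi).
Proof.
move=> txi; have [sxi _] := txi.
have [M [M0 xi0]] := test_field_window txi; have [N [N0 du]] := field_dx_window fu.
have sxi' i : smooth1 (fun x => xi x 0 i) := @smooth_path_coord _ _ xi i sxi.
have s1 := smooth1_dx; have s2 i : smooth1 (fun x => wx u x 0 i) by exact: smooth1_wx.
apply: (@test_fieldI _ _ _ (M + N)) => [i|x].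
  have -> : (fun x => nonlocal_op g w u xi x 0 i) = (fun x => local_op g u xi x 0 i
      + dx_inv (fun y => dot (dx u y) (xi y)) x * wx u x 0 i
      + dx_inv (fun y => dot (wx u y) (xi y)) x * dx u x 0 i).
    apply/funext => x; rewrite nonlocal_opE // -local_opE // mxE [X in X + _]mxE.
    by congr (_ + _ + _); rewrite mxE.
  apply: smooth1D; first apply: smooth1D; first exact: smooth1_local_op.
    apply: smooth1M => //; apply: smooth1_dx_inv (windowed_smooth_dot s1 txi xi0) _.
    exact: smooth1_dot.
  apply: smooth1M => //; apply: smooth1_dx_inv (windowed_smooth_dot s2 txi xi0) _.
  exact: smooth1_dot.
move=> x_out.
rewrite nonlocal_opE // -local_opE // (local_op_outside u xi0); last first.
  by apply: le_lt_trans x_out; rewrite lerDl.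
by rewrite /wx du ?mul0mx ?scaler0 ?addr0 //; apply: le_lt_trans x_out; rewrite lerDr.
Qed.

Lemma mderiv_metric_path x : mderiv x (1 : R) (g \o u)
  (- (Gam g (dx u x) (u x) *m g (u x) + g (u x) *m (Gam g (dx u x) (u x))^T)).
Proof. exact: mderiv_chain (mderiv_path x su) (mderiv_metric oU mg _ (Uu x)). Qed.

Lemma windowed_local_op M xi eta : test_field xi -> (forall x, M < `|x| -> xi x = 0) ->
  smooth_path eta -> windowed M (fun x => dot (xi x) (local_op g u eta x)).
Proof.
move=> txi xi0 seta.
have s i := @smooth1_local_op u eta i pu seta.
by under eq_fun do rewrite dotC; exact: (windowed_smooth_dot s txi xi0).
Qed.

(** As the metric is covariantly constant, the sum of the two integrands is the derivative of
    [dot xi (eta *m g)], which has bounded support. *)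
Lemma local_op_skew M xi eta : test_field xi -> test_field eta ->
  (forall x, M < `|x| -> xi x = 0) -> (forall x, M < `|x| -> eta x = 0) ->
  itotal (fun x => dot (xi x) (local_op g u eta x)) =
  - itotal (fun x => dot (eta x) (local_op g u xi x)).
Proof.
move=> txi teta xi0 eta0.
have [sxi _] := txi; have [seta _] := teta.
have w1 := windowed_local_op txi xi0 seta.
have w2 := windowed_local_op teta eta0 sxi.
apply/eqP; rewrite -addr_eq0 -(itotalD w1 w2); apply/eqP.
apply: (@itotal_derivative _ M _ 0 (fun x => dot (xi x) (eta x *m g (u x)))).
- exact: windowedD.
- move=> x; apply: sderiv_is_derive.
  have d := mderivM (mderiv_path x sxi)
    (mderivT (mderivM (mderiv_path x seta) (mderiv_metric_path x))).
  apply: sderiv_eq (sderiv_mderiv d).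
  have GT := metric_trmx mg (Uu x).
  rewrite mxE -!/(dot _ _) !local_opE // /Dcov.
  have flip a b : dot a (b *m g (u x)) = dot b (a *m g (u x)).
    by rewrite [RHS]dotC dot_mulmx GT.
  rewrite !(mulmxBl, mulmxN, mulmxDr, mulmxA) !(dotDr, dotNr, dot_mulmxT).
  rewrite (flip (eta x)) [dot (eta x) (xi x *m _ *m _)]flip.
  by do ?[move: (dot _ _) => ?]; ring.
- by move=> x Mx; rewrite xi0 // dot0l.
Qed.

(** Moving [dx_inv] to the other factor interchanges the two tails, up to sign. *)
Lemma nonlocal_skew xi eta : test_field xi -> test_field eta ->
  pairing xi (nonlocal_op g w u eta) = - pairing eta (nonlocal_op g w u xi).
Proof.
move=> txi teta.
have [M1 [M10 xi0]] := test_field_window txi.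
have [M2 [M20 eta0]] := test_field_window teta.
pose M := M1 + M2.
have {}xi0 x : M < `|x| -> xi x = 0.
  by move=> Mx; apply: xi0; apply: le_lt_trans Mx; rewrite lerDl.
have {}eta0 x : M < `|x| -> eta x = 0.
  by move=> Mx; apply: eta0; apply: le_lt_trans Mx; rewrite lerDr.
have s1 := smooth1_dx; have s2 i : smooth1 (fun x => wx u x 0 i) by exact: smooth1_wx.
have E a b : test_field a -> test_field b ->
    (forall x, M < `|x| -> a x = 0) -> (forall x, M < `|x| -> b x = 0) ->
    pairing a (nonlocal_op g w u b) = itotal (fun x => dot (a x) (local_op g u b x))
    + itotal (fun x => dot (wx u x) (a x) * dx_inv (fun y => dot (dx u y) (b y)) x)
    + itotal (fun x => dot (dx u x) (a x) * dx_inv (fun y => dot (wx u y) (b y)) x).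
  move=> ta tb a0 b0.
  have wl := windowed_local_op ta a0 tb.1.
  have wt (c c' : R -> 'rV[R]_n) : (forall i, smooth1 (fun x => c x 0 i)) -> (forall i, smooth1 (fun x => c' x 0 i)) ->
      windowed M (fun x => dot (c x) (a x) * dx_inv (fun y => dot (c' y) (b y)) x).
    move=> sc sc'; apply: windowedMr (windowed_smooth_dot sc ta a0).
    exact: dx_inv_continuous (windowed_smooth_dot sc' tb b0).
  rewrite -(itotalD wl (wt _ _ s2 s1)) -(itotalD (windowedD wl (wt _ _ s2 s1)) (wt _ _ s1 s2)).
  rewrite pairingE; congr itotal; apply/funext => x.
  rewrite nonlocal_opE // -local_opE // !dotDr !dotZr.
  by rewrite [dot (a x) (wx u x)]dotC [dot (a x) (dx u x)]dotC; congr (_ + _ + _); exact: mulrC.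
rewrite !E // (local_op_skew txi teta xi0 eta0).
rewrite (dx_inv_skew (windowed_smooth_dot s2 txi xi0) (windowed_smooth_dot s1 teta eta0)).
rewrite (dx_inv_skew (windowed_smooth_dot s1 txi xi0) (windowed_smooth_dot s2 teta eta0)).
have cC (p q : R -> R) : itotal (fun x => p x * q x) = itotal (fun x => q x * p x).
  by congr itotal; apply/funext => x; rewrite mulrC.
rewrite ![itotal (fun x => dx_inv _ x * _)]cC.
by move: (itotal _) (itotal _) (itotal _) => a b c; ring.
Qed.

End Path.

End Operator.

Section FamilyClosure.
Context {R : realType}.

Lemma smooth_family_eq e (f h : R -> R -> R) : (forall s x, `|s| < e -> f s x = h s x) ->
  smooth_family e f -> smooth_family e h.
Proof. by move=> fh; apply: smooth_on_eq => [|y ye]; [exact: open_strip|exact: fh]. Qed.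

Lemma smooth_family_param e : smooth_family e (fun s _ : R => s).
Proof.
rewrite /smooth_family; under eq_fun do rewrite mxE.
exact: smooth_on_coord.
Qed.

Lemma smooth_family_dot e n (a b : R -> R -> 'rV[R]_n) :
  (forall i, smooth_family e (fun s x => a s x 0 i)) ->
  (forall i, smooth_family e (fun s x => b s x 0 i)) ->
  smooth_family e (fun s x => dot (a s x) (b s x)).
Proof.
move=> sa sb; apply: (@smooth_family_eq _ (fun s x => \sum_i a s x 0 i * b s x 0 i)).
  by move=> s x _; rewrite dotE.
by apply: smooth_family_sum => i; exact: smooth_familyM.
Qed.

(** Both the direction [phi] and the base point [u] vary; linearity in the direction gives the
    summand [Gam g a]. *)
Lemma mderiv_Gam_family (W : normedModType R) n (U : set 'rV[R]_n) (g : 'rV[R]_n -> 'M[R]_n)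
    (q t : W) (phi u : W -> 'rV[R]_n) a b : open U -> metric_on U g ->
  U (u q) -> mderiv q t phi a -> mderiv q t u b ->
  mderiv q t (fun q => Gam g (phi q) (u q)) (dGam g b (phi q) (u q) + Gam g a (u q)).
Proof.
move=> oU mg Uq dphi du i m; rewrite mxE dGamE GamE exchange_big -big_split /=.
under eq_fun do rewrite GamE.
apply: sderiv_sum => k.
have d := smooth_onW (smooth_christoffel oU mg i k m) Uq.
apply: sderiv_eq (sderivM (dphi 0 k) (sderiv_chain du (sderiv_partial b d))).
rewrite addrC; congr (_ + _); rewrite mulr_sumr; apply: eq_bigr => l _.
by rewrite mulrCA mulrA.
Qed.

Lemma sderiv_id (x d : R) : sderiv x d (fun s => s) d.
Proof. by split; [exact/derivable1_diffP/derivable_id|exact: derive_id]. Qed.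

Lemma sderiv_dot (W : normedModType R) n (q t : W) (a b : W -> 'rV[R]_n) a' b' :
  mderiv q t a a' -> mderiv q t b b' ->
  sderiv q t (fun q => dot (a q) (b q)) (dot a' (b q) + dot (a q) b').
Proof.
move=> da db; have := sderiv_mderiv (mderivM da (mderivT db)).
by rewrite mxE.
Qed.

End FamilyClosure.

(** * First variation of the bracket *)

Section Variation.
Context {R : realType} {n : nat}.
Variables (U : set 'rV[R]_n) (g w : 'rV[R]_n -> 'M[R]_n).
Hypotheses (oU : open U) (mg : metric_on U g).
Hypothesis sw : forall i j, smooth_on U (fun p => w p i j).
Implicit Types (u xi eta v : R -> 'rV[R]_n) (x M : R).

Let phi u eta := dx_inv (fun y => dot (dx u y) (eta y)).
Let psi u eta := dx_inv (fun y => dot (wx w u y) (eta y)).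

(** The derivative of the local part along [v] with [eta] fixed: the metric varies with the point,
    the connection with the point and with its direction [u_x]. *)
Definition dlocal u eta v x : 'rV[R]_n :=
  Dcov g u eta x *m - (Gam g (v x) (u x) *m g (u x) + g (u x) *m (Gam g (v x) (u x))^T)
  - eta x *m (dGam g (v x) (dx u x) (u x) + Gam g (dx v x) (u x)) *m g (u x).

Definition dwx u v x : 'rV[R]_n :=
  dx v x *m (w (u x))^T + dx u x *m (ddir w (v x) (u x))^T.

(* The density of [xi J'[v] eta], where [J'[v]] is the derivative of the
   operator along [v] and [xi], [eta] are fixed. *)
Definition trivector u xi eta v x : R :=
  dot (xi x) (dlocal u eta v x) + dot (xi x) (dwx u v x) * phi u eta x
  + dot (xi x) (dx v x) * psi u eta x
  - psi u xi x * dot (dx v x) (eta x) - phi u xi x * dot (dwx u v x) (eta x).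

Lemma dx_line u v s x : smooth_path u -> smooth_path v ->
  dx (line u v s) x = dx u x + s *: dx v x.
Proof.
move=> su sv; apply/rowP => j; rewrite [LHS]mxE derive1E.
have : sderiv x (1 : R) (fun y => line u v s y 0 j) ((dx u x + s *: dx v x) 0 j).
  have := mderivD (mderiv_path x su) (mderivZ (sderiv_cst x (1 : R) s) (mderiv_path x sv)) 0 j.
  by rewrite scale0r add0r.
by case.
Qed.

Lemma smooth1_dwx u v i : path_in U u -> smooth_path v -> smooth1 (fun x => dwx u v x 0 i).
Proof.
move=> pu sv; have [su _] := pu.
have sdu k : smooth1 (fun x => dx u x 0 k).
  exact: (@smooth_path_coord _ _ (dx u) k (smooth_path_dx su)).
have sdv k : smooth1 (fun x => dx v x 0 k).
  exact: (@smooth_path_coord _ _ (dx v) k (smooth_path_dx sv)).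
have -> : (fun x => dwx u v x 0 i) = (fun x => \sum_k dx v x 0 k * w (u x) i k
   + \sum_k dx u x 0 k * \sum_l v x 0 l * partial l (fun q => w q i k) (u x)).
  apply/funext => x; rewrite mxE; congr (_ + _); rewrite mxE; apply: eq_bigr => k _.
    by rewrite [_^T _ _]mxE.
  by rewrite [_^T _ _]mxE [ddir _ _ _ _ _]mxE.
apply: smooth1D; apply: smooth1_sum => k; apply: smooth1M => //.
  exact: smooth1_comp (sw i k) pu.
apply: smooth1_sum => l; apply: smooth1M.
  exact: (@smooth_path_coord _ _ v l sv).
exact: smooth1_comp (smooth_on_partial l (sw i k)) pu.
Qed.

Section Bracket.
Variables (F G : (R -> 'rV[R]_n) -> R) (dF dG : (R -> 'rV[R]_n) -> R -> 'rV[R]_n).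
Hypotheses (hF : has_variational_derivative U F dF) (hG : has_variational_derivative U G dG).
Variables (u v : R -> 'rV[R]_n).
Hypotheses (fu : field U u) (tv : test_field v).

Let su : smooth_path u := fu.1.1.
Let Uu : forall x, U (u x) := fu.1.2.
Let sv : smooth_path v := tv.1.

Section Family.
Variables (e M : R).
Hypotheses (e0 : 0 < e) (M0 : 0 <= M).
Hypothesis fl : forall s : R, `|s| < e -> field U (line u v s).
Hypothesis dF0 : forall u, field U u -> forall x, M < `|x| -> dF u x = 0.
Hypothesis dG0 : forall u, field U u -> forall x, M < `|x| -> dG u x = 0.

Let e00 : `|(0 : R)| < e.
Proof. by rewrite normr0. Qed.

Let xi s := dF (line u v s).
Let eta s := dG (line u v s).
Let l s x := dot (xi s x) (local_op g (line u v s) (eta s) x).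
Let a1 s x := dot (wx w (line u v s) x) (xi s x).
Let b1 s x := dot (dx (line u v s) x) (eta s x).
Let a2 s x := dot (dx (line u v s) x) (xi s x).
Let b2 s x := dot (wx w (line u v s) x) (eta s x).

Let sf_line j : smooth_family e (fun s x => line u v s x 0 j).
Proof.
apply: (@smooth_family_eq _ _ (fun s x => u x 0 j + s * v x 0 j)).
  by move=> s x _; rewrite !mxE.
apply: smooth_familyD; first exact/smooth_family_cst/smooth_path_coord.
by apply: smooth_familyM; [exact: smooth_family_param|exact/smooth_family_cst/smooth_path_coord].
Qed.

Let sf_dx j : smooth_family e (fun s x => dx (line u v s) x 0 j).
Proof.
apply: (@smooth_family_eq _ _ (fun s x => dx u x 0 j + s * dx v x 0 j)).
  by move=> s x _; rewrite dx_line // [RHS]mxE [X in _ = _ + X]mxE.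
apply: smooth_familyD; first exact/smooth_family_cst/(@smooth_path_coord _ _ (dx u))/smooth_path_dx.
apply: smooth_familyM; first exact: smooth_family_param.
exact/smooth_family_cst/(@smooth_path_coord _ _ (dx v))/smooth_path_dx.
Qed.

Let sf_on (f : 'rV[R]_n -> R) : smooth_on U f -> smooth_family e (fun s x => f (line u v s x)).
Proof.
move=> sf; apply: (smooth_family_comp sf) => // s x se.
by have [[_ H] _] := fl se.
Qed.

Let sf_wx j : smooth_family e (fun s x => wx w (line u v s) x 0 j).
Proof.
apply: (@smooth_family_eq _ _ (fun s x => \sum_k dx (line u v s) x 0 k * w (line u v s x) j k)).
  by move=> s x _; rewrite [RHS]mxE; apply: eq_bigr => k _; rewrite [_^T _ _]mxE.
by apply: smooth_family_sum => k; apply: smooth_familyM => //; exact: (sf_on (sw j k)).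
Qed.

Let sf_xi i : smooth_family e (fun s x => xi s x 0 i).
Proof. exact: (smooth_family_line hF). Qed.

Let sf_eta i : smooth_family e (fun s x => eta s x 0 i).
Proof. exact: (smooth_family_line hG). Qed.

Let dx_eta s x i : `|s| < e -> dspace (fun s x => eta s x 0 i) s x = dx (eta s) x 0 i.
Proof.
move=> se; rewrite [RHS]mxE derive1E.
by have H := is_derive_dspace x (sf_eta i) se; rewrite (@derive_val _ _ _ _ _ _ _ H).
Qed.

Let sf_dx_eta i : smooth_family e (fun s x => dx (eta s) x 0 i).
Proof.
apply: (smooth_family_eq (f := dspace (fun s x => eta s x 0 i))).
  by move=> s x se; exact: dx_eta.
exact: smooth_family_dspace.
Qed.

Let sf_local i : smooth_family e (fun s x => local_op g (line u v s) (eta s) x 0 i).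
Proof.
apply: (smooth_family_eq (f := fun s x => \sum_j g (line u v s x) i j * dx (eta s) x 0 j
   - \sum_t \sum_j \sum_k
       g (line u v s x) i t * christoffel g j t k (line u v s x) * dx (line u v s) x 0 k * eta s x 0 j)).
  by move=> s x _; rewrite [RHS]mxE.
apply: smooth_familyB.
  by apply: smooth_family_sum => j; apply: smooth_familyM => //; exact: (sf_on (smooth_metric mg i j)).
apply: smooth_family_sum => t; apply: smooth_family_sum => j; apply: smooth_family_sum => k.
apply: smooth_familyM => //; apply: smooth_familyM => //; apply: smooth_familyM.
  exact: (sf_on (smooth_metric mg i t)).
exact: (sf_on (smooth_christoffel oU mg j t k)).
Qed.

Let wl : windowed_family M e l.
Proof.
split=> [|s x se Mx]; first exact: smooth_family_dot.
by rewrite /l /xi (dF0 (fl se)) // dot0l.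
Qed.

Let wa1 : windowed_family M e a1.
Proof.
split=> [|s x se Mx]; first exact: smooth_family_dot.
by rewrite /a1 /xi (dF0 (fl se)) // dot0r.
Qed.

Let wa2 : windowed_family M e a2.
Proof.
split=> [|s x se Mx]; first exact: smooth_family_dot.
by rewrite /a2 /xi (dF0 (fl se)) // dot0r.
Qed.

Let wb1 : windowed_family M e b1.
Proof.
split=> [|s x se Mx]; first exact: smooth_family_dot.
by rewrite /b1 /eta (dG0 (fl se)) // dot0r.
Qed.

Let wb2 : windowed_family M e b2.
Proof.
split=> [|s x se Mx]; first exact: smooth_family_dot.
by rewrite /b2 /eta (dG0 (fl se)) // dot0r.
Qed.

Let bracketE s : `|s| < e -> bracket (nonlocal_op g w) dF dG (line u v s) =
  itotal (fun x => l s x + a1 s x * dx_inv (b1 s) x + a2 s x * dx_inv (b2 s) x).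
Proof.
move=> se; have [[_ Us] _] := fl se.
rewrite /bracket pairingE; congr itotal; apply/funext => x.
rewrite (nonlocal_opE w oU mg) // -(local_opE oU mg) // !dotDr !dotZr.
rewrite [dot _ (wx _ _ _)]dotC [dot _ (dx _ _)]dotC.
by congr (_ + _ + _); exact: mulrC.
Qed.

Let xi0 := dF u.
Let eta0 := dG u.
Let dxi := vderiv dF u v.
Let deta := vderiv dG u v.

Let d_line x : mderiv (0 : R) (1 : R) (fun s => line u v s x) (v x).
Proof.
move=> i j; have := sderivD (sderiv_cst (0 : R) (1 : R) (u x i j))
  (sderivM (sderiv_id (0 : R) 1) (sderiv_cst (0 : R) (1 : R) (v x i j))).
rewrite mul1r mulr0 addr0 add0r.
by apply: sderiv_near; near=> s; rewrite !mxE.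
Unshelve. all: by end_near. Qed.

Let d_dx x : mderiv (0 : R) (1 : R) (fun s => dx (line u v s) x) (dx v x).
Proof.
move=> i j; have := sderivD (sderiv_cst (0 : R) (1 : R) (dx u x i j))
  (sderivM (sderiv_id (0 : R) 1) (sderiv_cst (0 : R) (1 : R) (dx v x i j))).
rewrite mul1r mulr0 addr0 add0r.
by apply: sderiv_near; near=> s; rewrite dx_line // [RHS]mxE [X in _ = _ + X]mxE.
Unshelve. all: by end_near. Qed.

Let d_var (dH : (R -> 'rV[R]_n) -> R -> 'rV[R]_n) H x : has_variational_derivative U H dH ->
  mderiv (0 : R) (1 : R) (fun s => dH (line u v s) x) (vderiv dH u v x).
Proof.
move=> hH i j; rewrite ord1; have [d <-] := is_derive_vderiv oU hH x j fu tv.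
by split => //; apply/derivable1_diffP.
Qed.

(** The parameter derivative passes through [d/dx] by [dtime_dspace]. *)
Let d_dx_eta x : mderiv (0 : R) (1 : R) (fun s => dx (eta s) x) (dx deta x).
Proof.
move=> i j; rewrite ord1.
have H := is_derive_dtime x (smooth_family_dspace (sf_eta j)) e00.
have d : sderiv (0 : R) (1 : R) (dspace (fun s x => eta s x 0 j) ^~ x)
    (dtime (dspace (fun s x => eta s x 0 j)) 0 x).
  by split; [apply/derivable1_diffP; case: H|exact: derive_val].
apply: sderiv_near (sderiv_eq _ d); first by apply: (small_near0 e0) => s se; exact: dx_eta.
rewrite (dtime_dspace x (sf_eta j) e00) [RHS]mxE derive1E.
have H2 := is_derive_dspace x (smooth_family_dtime (sf_eta j)) e00.
rewrite -(@derive_val _ _ _ _ _ _ _ H2); congr ('D_1 _ x).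
by apply/funext => y; rewrite mxE.
Qed.

Let d_wx x : mderiv (0 : R) (1 : R) (fun s => wx w (line u v s) x) (dwx u v x).
Proof.
have Ul : U (line u v 0 x) by rewrite line0.
have := mderivM (d_dx x) (mderivT (mderiv_chain (d_line x) (mderiv_ddir sw (v x) Ul))).
by rewrite /= line0.
Qed.

Let d_local x : mderiv (0 : R) (1 : R) (fun s => local_op g (line u v s) (eta s) x)
  (Dcov g u deta x *m g (u x) + dlocal u eta0 v x).
Proof.
have Ul : U (line u v 0 x) by rewrite line0.
have dG' := mderiv_Gam_family (u := fun s => line u v s x) (q := 0) oU mg Ul (d_dx x) (d_line x).
have d := mderivM (mderivB (d_dx_eta x) (mderivM (d_var x hG) dG'))
  (mderiv_chain (d_line x) (mderiv_metric oU mg (v x) Ul)).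
apply: (@mderiv_near _ _ _ _ _ _ (fun s => Dcov g (line u v s) (eta s) x *m g (line u v s x))).
  apply: (small_near0 e0) => s se; have [[_ Us] _] := fl se.
  by rewrite (local_opE oU mg).
have E (P Q K X : 'rV[R]_n) (N : 'M[R]_n) :
    (P - (Q + K)) *m N + X = (P - Q) *m N + (X - K *m N).
  by rewrite opprD addrA mulmxBl -addrA [- _ + _]addrC.
by apply: mderiv_eq d; rewrite /= /eta line0; exact: E.
Qed.

Let dtime_sderiv (f : R -> R -> R) x d : windowed_family M e f ->
  sderiv (0 : R) (1 : R) (f ^~ x) d -> dtime f 0 x = d.
Proof. by move=> [sf _] H; apply: (dtimeE sf e00); exact: sderiv_is_derive. Qed.

Let dl x : dtime l 0 x = dot (dxi x) (Dcov g u eta0 x *m g (u x))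
  + dot (xi0 x) (Dcov g u deta x *m g (u x)) + dot (xi0 x) (dlocal u eta0 v x).
Proof.
rewrite (dtime_sderiv wl (sderiv_dot (d_var x hF) (d_local x))) /xi /eta !line0.
by rewrite (local_opE oU mg) // dotDr addrA.
Qed.

Let da1 x : dtime a1 0 x = dot (dwx u v x) (xi0 x) + dot (wx w u x) (dxi x).
Proof. by rewrite (dtime_sderiv wa1 (sderiv_dot (d_wx x) (d_var x hF))) /xi !line0. Qed.

Let da2 x : dtime a2 0 x = dot (dx v x) (xi0 x) + dot (dx u x) (dxi x).
Proof. by rewrite (dtime_sderiv wa2 (sderiv_dot (d_dx x) (d_var x hF))) /xi !line0. Qed.

Let db1 : dtime b1 0 = fun x => dot (dx v x) (eta0 x) + dot (dx u x) (deta x).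
Proof.
by apply/funext => x; rewrite (dtime_sderiv wb1 (sderiv_dot (d_dx x) (d_var x hG))) /eta !line0.
Qed.

Let db2 : dtime b2 0 = fun x => dot (dwx u v x) (eta0 x) + dot (wx w u x) (deta x).
Proof.
by apply/funext => x; rewrite (dtime_sderiv wb2 (sderiv_dot (d_wx x) (d_var x hG))) /eta !line0.
Qed.

Let dxi0 x : M < `|x| -> dxi x = 0.
Proof.
move=> Mx; apply/rowP => i; rewrite !mxE.
have [|_ [_ H] _] := smooth_family_uniform_derivative e0 (sf_xi i) (M := M); last exact: H.
by move=> s y se My; rewrite /xi dF0 ?mxE //; exact: fl.
Qed.

Let deta0 x : M < `|x| -> deta x = 0.
Proof.
move=> Mx; apply/rowP => i; rewrite !mxE.
have [|_ [_ H] _] := smooth_family_uniform_derivative e0 (sf_eta i) (M := M); last exact: H.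
by move=> s y se My; rewrite /eta dG0 ?mxE //; exact: fl.
Qed.

Let txi : test_field xi0.
Proof. exact: (test_field_variational hF fu). Qed.

Let teta : test_field eta0.
Proof. exact: (test_field_variational hG fu). Qed.

Let tdxi : test_field dxi.
Proof. exact: (test_field_vderiv oU hF fu tv). Qed.

Let tdeta : test_field deta.
Proof. exact: (test_field_vderiv oU hG fu tv). Qed.

Let s_dx i : smooth1 (fun x => dx u x 0 i).
Proof. exact: smooth1_dx fu i. Qed.

Let s_wx i : smooth1 (fun x => wx w u x 0 i).
Proof. exact: smooth1_wx fu.1. Qed.

Let s_dxv i : smooth1 (fun x => dx v x 0 i).
Proof. exact: (@smooth_path_coord _ _ (dx v) i (smooth_path_dx sv)). Qed.

Let s_dwx i : smooth1 (fun x => dwx u v x 0 i).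
Proof. exact: smooth1_dwx fu.1 sv. Qed.

Let wxi (a : R -> 'rV[R]_n) : (forall i, smooth1 (fun x => a x 0 i)) -> windowed M (fun x => dot (a x) (xi0 x)).
Proof. by move=> sa; apply: windowed_smooth_dot sa txi _; exact: dF0. Qed.

Let weta (a : R -> 'rV[R]_n) : (forall i, smooth1 (fun x => a x 0 i)) -> windowed M (fun x => dot (a x) (eta0 x)).
Proof. by move=> sa; apply: windowed_smooth_dot sa teta _; exact: dG0. Qed.

Let wdxi (a : R -> 'rV[R]_n) : (forall i, smooth1 (fun x => a x 0 i)) -> windowed M (fun x => dot (a x) (dxi x)).
Proof. by move=> sa; apply: windowed_smooth_dot sa tdxi _; exact: dxi0. Qed.

Let wdeta (a : R -> 'rV[R]_n) : (forall i, smooth1 (fun x => a x 0 i)) -> windowed M (fun x => dot (a x) (deta x)).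
Proof. by move=> sa; apply: windowed_smooth_dot sa tdeta _; exact: deta0. Qed.

Let wtail a b : windowed M a -> windowed M b -> windowed M (fun x => a x * dx_inv b x).
Proof. by move=> wa wb; apply: windowedMr wa; exact: dx_inv_continuous wb. Qed.

Let s_op (c : R -> 'rV[R]_n) i : test_field c -> smooth1 (fun x => nonlocal_op g w u c x 0 i).
Proof.
move=> txi'; have [H _] := test_field_nonlocal oU mg sw fu txi'.
exact: (@smooth_path_coord _ _ _ i H).
Qed.

Let s_local (c : R -> 'rV[R]_n) i : test_field c -> smooth1 (fun x => local_op g u c x 0 i).
Proof. by move=> [sxi' _]; exact: smooth1_local_op fu.1 sxi'. Qed.

Let L x := dot (xi0 x) (dlocal u eta0 v x).

Let wL : windowed M L.
Proof.
have [_ wdl _] := smooth_family_uniform_derivative e0 wl.1 wl.2.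
have w1 : windowed M (fun x => dot (local_op g u eta0 x) (dxi x)).
  refine (@wdxi (local_op g u eta0) _) => i; apply: s_local; exact: teta.
have w2 : windowed M (fun x => dot (local_op g u deta x) (xi0 x)).
  refine (@wxi (local_op g u deta) _) => i; apply: s_local; exact: tdeta.
(* Continuity and bounded support of [L] are read off from [dl], all of whose other terms are known
   to have them. *)
rewrite (_ : L = fun x => dtime l 0 x + - dot (local_op g u eta0 x) (dxi x)
   + - dot (local_op g u deta x) (xi0 x)).
  by apply: windowedD; [apply: windowedD wdl _|]; exact: windowedN.
apply/funext => x; rewrite dl !(local_opE oU mg) // ![dot (_ *m _) _]dotC -/(L x).
by move: (dot _ _) (dot _ _) (L x) => a b c; ring.
Qed.

(** Three sources contribute: the variation of [dF], that of [dG], and that of the operator. The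
    last is brought to the form [trivector] by skew-symmetry of [dx_inv], which lets it act on the
    unvaried factor. *)
Lemma bracket_variation_family : windowed M (trivector u xi0 eta0 v) /\
  first_variation (bracket (nonlocal_op g w) dF dG) u v
    (pairing dxi (nonlocal_op g w u eta0) + pairing xi0 (nonlocal_op g w u deta)
     + itotal (trivector u xi0 eta0 v)).
Proof.
have wD1 : windowed M (fun x => dot (xi0 x) (dwx u v x)).
  by under eq_fun do rewrite dotC; exact: wxi.
have wD2 : windowed M (fun x => dot (xi0 x) (dx v x)).
  by under eq_fun do rewrite dotC; exact: wxi.
pose r0 x := L x + dot (xi0 x) (dwx u v x) * phi u eta0 x + dot (xi0 x) (dx v x) * psi u eta0 x.
have wr0 : windowed M r0.
  by apply: windowedD; first apply: windowedD wL _; apply: wtail => //; exact: weta.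
pose t1 x := psi u xi0 x * dot (dx v x) (eta0 x).
pose t2 x := phi u xi0 x * dot (dwx u v x) (eta0 x).
have wt1 : windowed M t1.
  by apply: windowedMl (weta s_dxv); exact: dx_inv_continuous (wxi s_wx).
have wt2 : windowed M t2.
  by apply: windowedMl (weta s_dwx); exact: dx_inv_continuous (wxi s_dx).
have TE : trivector u xi0 eta0 v = fun x => r0 x + - t1 x + - t2 x by [].
split.
  by rewrite TE; apply: windowedD; [apply: windowedD wr0 _|]; exact: windowedN.
rewrite TE (itotalD (windowedD wr0 (windowedN wt1)) (windowedN wt2)) (itotalD wr0 (windowedN wt1)).
rewrite (itotalN wt1) (itotalN wt2).
(* The summands in which the variation of the operator falls under [dx_inv]; they become the two
   negative terms of [trivector]. *)
have sk1 := dx_inv_skew (wxi s_wx) (weta s_dxv).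
have sk2 := dx_inv_skew (wxi s_dx) (weta s_dwx).
rewrite -/t1 -/t2 in sk1 sk2.
rewrite -sk1 -sk2 !pairingE.
have wP1 : windowed M (fun x => dot (dxi x) (nonlocal_op g w u eta0 x)).
  under eq_fun do rewrite dotC.
  refine (@wdxi (nonlocal_op g w u eta0) _) => i; apply: s_op; exact: teta.
have wP2 : windowed M (fun x => dot (xi0 x) (nonlocal_op g w u deta x)).
  by under eq_fun do rewrite dotC; refine (@wxi (nonlocal_op g w u deta) _) => i; apply: s_op; exact: tdeta.
have wT1 := wtail (wxi s_wx) (weta s_dxv).
have wT2 := wtail (wxi s_dx) (weta s_dwx).
rewrite !addrA -(itotalD wP1 wP2) -(itotalD (windowedD wP1 wP2) wr0).
rewrite -(itotalD (windowedD (windowedD wP1 wP2) wr0) wT1).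
rewrite -(itotalD (windowedD (windowedD (windowedD wP1 wP2) wr0) wT1) wT2).
have := is_derive_nonlocal M0 e0 wl wa1 wb1 wa2 wb2.
rewrite (_ : (fun x => dtime l 0 x + _ + _) = (fun x =>
   dot (dxi x) (nonlocal_op g w u eta0 x) + dot (xi0 x) (nonlocal_op g w u deta x) + r0 x
   + dot (wx w u x) (xi0 x) * dx_inv (fun y => dot (dx v y) (eta0 y)) x
   + dot (dx u x) (xi0 x) * dx_inv (fun y => dot (dwx u v y) (eta0 y)) x)).
  apply: near_eq_is_derive; apply: (small_near0 e0) => s se; exact/esym/bracketE.
apply/funext => x; rewrite db1 db2 dl da1 da2.
rewrite (dx_invD _ (weta s_dxv) (wdeta s_dx)) (dx_invD _ (weta s_dwx) (wdeta s_wx)).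
rewrite /a1 /a2 /b1 /b2 /xi /eta !line0 -/xi0 -/eta0 !(nonlocal_opE w oU mg) //.
rewrite /r0 -/(L x) /phi /psi; move: (L x) => Lx.
rewrite [dot (xi0 x) (dwx _ _ _)]dotC [dot (xi0 x) (dx v _)]dotC.
rewrite !dotDr !dotZr.
rewrite [dot (xi0 x) (wx _ _ _)]dotC [dot (xi0 x) (dx u _)]dotC.
rewrite [dot (dxi x) (wx _ _ _)]dotC [dot (dxi x) (dx u _)]dotC.
by do ?[move: (dot _ _) => ?]; do ?[move: (dx_inv _ _) => ?]; ring.
Qed.

End Family.

Lemma bracket_variation : exists2 M : R, 0 <= M &
  windowed M (trivector u (dF u) (dG u) v) /\
  first_variation (bracket (nonlocal_op g w) dF dG) u v
    (pairing (vderiv dF u v) (nonlocal_op g w u (dG u))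
     + pairing (dF u) (nonlocal_op g w u (vderiv dG u v))
     + itotal (trivector u (dF u) (dG u) v)).
Proof.
have [e e0 He] := field_line oU fu tv.
have [M1 M10 H1] := variational_window hF; have [M2 M20 H2] := variational_window hG.
exists (M1 + M2); first exact: addr_ge0.
apply: (bracket_variation_family e0) => // [|u' fu' x Mx|u' fu' x Mx]; first exact: addr_ge0.
  by apply: H1 => //; apply: le_lt_trans Mx; rewrite lerDl.
by apply: H2 => //; apply: le_lt_trans Mx; rewrite lerDr.
Qed.

End Bracket.

End Variation.

(** * The Jacobi identity from the Gauss and Codazzi equations *)

Section Criterion.
Context {R : realType} {n : nat}.
Variables (U : set 'rV[R]_n) (g w : 'rV[R]_n -> 'M[R]_n).
Hypotheses (oU : open U) (mg : metric_on U g).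
Hypothesis sw : forall i j, smooth_on U (fun p => w p i j).
Hypothesis w_sym : forall (a b : 'rV[R]_n) p, U p ->
  dot (a *m g p *m (w p)^T) b = dot (b *m g p *m (w p)^T) a.
Hypothesis w_codazzi : forall (v y : 'rV[R]_n) p, U p ->
  y *m (ddir w v p)^T + y *m (w p)^T *m (Gam g v p)^T =
  v *m (ddir w y p)^T + v *m (w p)^T *m (Gam g y p)^T.
Hypothesis w_gauss : forall (v y : 'rV[R]_n) p, U p -> Riem g v y p *m g p =
  outer (v *m (w p)^T) y + outer v (y *m (w p)^T)
  - outer y (v *m (w p)^T) - outer (y *m (w p)^T) v.
Implicit Types (xi eta zeta v : R -> 'rV[R]_n) (x M : R).

Section Path.
Variable u : R -> 'rV[R]_n.
Hypothesis fu : field U u.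

Let pu : path_in U u := fu.1.
Let su : smooth_path u := pu.1.
Let Uu : forall x, U (u x) := pu.2.

Let phi eta := dx_inv (fun y => dot (dx u y) (eta y)).
Let psi eta := dx_inv (fun y => dot (wx w u y) (eta y)).

(** Every term of [trivector] that contains [dx v] occurs here with [v] in its place, so that
    integration by parts takes the derivative off [v]. *)
Definition trivector_primitive xi eta v x : R :=
  - dot (xi x) (eta x *m Gam g (v x) (u x) *m g (u x))
  + dot (xi x) (v x *m (w (u x))^T) * phi eta x + dot (xi x) (v x) * psi eta x
  - dot (eta x) (v x *m (w (u x))^T) * phi xi x - dot (eta x) (v x) * psi xi x.

Definition trivector_remainder xi eta v x : R :=
  trivector_term (w (u x))^T (fun a => Gam g a (u x)) (xi x) (eta x)
    (Dcov g u xi x) (Dcov g u eta x) (phi xi x) (psi xi x) (phi eta x) (psi eta x)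
    (nonlocal_op g w u xi x) (nonlocal_op g w u eta x) (v x).

Let is_derive_inv (a : R -> 'rV[R]_n) xi x : (forall i, smooth1 (fun x => a x 0 i)) ->
  test_field xi -> sderiv x (1 : R) (dx_inv (fun y => dot (a y) (xi y))) (dot (a x) (xi x)).
Proof.
move=> sa txi; have [M [M0 xi0]] := test_field_window txi.
have [d <-] := is_derive_dx_inv x (windowed_smooth_dot sa txi xi0).
by split => //; exact/derivable1_diffP.
Qed.

Lemma is_derive_trivector_primitive xi eta v x : test_field xi -> test_field eta -> test_field v ->
  is_derive x (1 : R) (trivector_primitive xi eta v)
    (trivector g w u xi eta v x - trivector_remainder xi eta v x).
Proof.
move=> txi teta tv; apply: sderiv_is_derive.
have dxi := mderiv_path x txi.1; have deta := mderiv_path x teta.1; have dv := mderiv_path x tv.1.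
have dG := mderiv_metric_path oU mg fu x.
have dGam := mderiv_Gam_family oU mg (Uu x) dv (mderiv_path x su).
have dw : mderiv x (1 : R) (fun x => (w (u x))^T) (ddir w (dx u x) (u x))^T.
  exact: mderivT (mderiv_chain (mderiv_path x su) (mderiv_ddir sw (dx u x) (Uu x))).
have s_dx i := @smooth1_dx _ _ U u fu i.
have s_wx i := @smooth1_wx _ _ U w sw u i pu.
have d1 := sderiv_dot dxi (mderivM (mderivM deta dGam) dG).
have dvw := mderivM dv dw.
have dphi c : test_field c -> sderiv x (1 : R) (phi c) (dot (dx u x) (c x)).
  exact: is_derive_inv.
have dpsi c : test_field c -> sderiv x (1 : R) (psi c) (dot (wx w u x) (c x)).
  exact: is_derive_inv.
have d := sderivB (sderivB (sderivD (sderivD (sderivN d1)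
  (sderivM (sderiv_dot dxi dvw) (dphi _ teta))) (sderivM (sderiv_dot dxi dv) (dpsi _ teta)))
  (sderivM (sderiv_dot deta dvw) (dphi _ txi))) (sderivM (sderiv_dot deta dv) (dpsi _ txi)).
apply: sderiv_eq d; apply/esym/eqP; rewrite subr_eq addrC -subr_eq; apply/eqP.
rewrite /trivector_remainder !(nonlocal_opE w oU mg) //.
exact: (trivector_density (dx v x) (xi x) (dx xi x) (eta x) (dx eta x)
  (phi xi x) (psi xi x) (phi eta x) (psi eta x) (Gam g (dx v x) (u x))
  (metric_trmx mg (Uu x)) (GamCT oU mg _ _ (Uu x)) (w_codazzi _ _ (Uu x)) (w_gauss _ _ (Uu x))).
Qed.

Lemma trivector_remainder_cyclic xi eta zeta x :
  trivector_remainder xi eta (nonlocal_op g w u zeta) x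
  + trivector_remainder eta zeta (nonlocal_op g w u xi) x
  + trivector_remainder zeta xi (nonlocal_op g w u eta) x = 0.
Proof.
rewrite /trivector_remainder !(nonlocal_opE w oU mg) //.
apply: (@trivector_cyclic _ _ (dx u x) (g (u x)) (w (u x))^T (fun a => Gam g a (u x))).
- by move=> a b; exact: (GamCT oU mg _ _ (Uu x)).
- exact: (metric_trmx mg (Uu x)).
- by move=> a b; exact: w_sym.
Qed.

(** The primitives vanish where both covectors do, although the potentials in them need not; the
    boundary value is therefore zero. *)
Lemma itotal_trivector_cyclic M xi eta zeta :
  test_field xi -> test_field eta -> test_field zeta ->
  windowed M (trivector g w u xi eta (nonlocal_op g w u zeta)) ->
  windowed M (trivector g w u eta zeta (nonlocal_op g w u xi)) ->
  windowed M (trivector g w u zeta xi (nonlocal_op g w u eta)) ->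
  itotal (trivector g w u xi eta (nonlocal_op g w u zeta))
  + itotal (trivector g w u eta zeta (nonlocal_op g w u xi))
  + itotal (trivector g w u zeta xi (nonlocal_op g w u eta)) = 0.
Proof.
move=> txi teta tzeta w1 w2 w3.
have tJ c : test_field c -> test_field (nonlocal_op g w u c) by exact: (test_field_nonlocal oU mg sw fu).
rewrite -(itotalD w1 w2) -(itotalD (windowedD w1 w2) w3).
have [M1 [M10 xi0]] := test_field_window txi.
have [M2 [M20 eta0]] := test_field_window teta.
have [M3 [M30 zeta0]] := test_field_window tzeta.
have K0 a b v x : a x = 0 -> b x = 0 -> trivector_primitive a b v x = 0.
  by move=> a0 b0; rewrite /trivector_primitive a0 b0 !dot0l !mul0r oppr0 !addr0.
pose K x := trivector_primitive xi eta (nonlocal_op g w u zeta) x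
  + trivector_primitive eta zeta (nonlocal_op g w u xi) x
  + trivector_primitive zeta xi (nonlocal_op g w u eta) x.
(* Beyond [N] all three covectors vanish, and [N] is at least the window [M] of the densities. *)
pose N := `|M| + M1 + M2 + M3.
apply: (@itotal_derivative _ N _ 0 K).
- apply: (@windowedW _ M); last exact: windowedD (windowedD w1 w2) w3.
  by rewrite /N; have := ler_norm M; lra.
- move=> x.
  have d1 := is_derive_trivector_primitive x txi teta (tJ _ tzeta).
  have d2 := is_derive_trivector_primitive x teta tzeta (tJ _ txi).
  have d3 := is_derive_trivector_primitive x tzeta txi (tJ _ teta).
  have d := is_deriveD (is_deriveD d1 d2) d3.
  refine (@is_derive_eq _ _ _ _ _ _ _ _ d _); have := trivector_remainder_cyclic xi eta zeta x.
  by move: (trivector_remainder _ _ _ _) (trivector_remainder _ _ _ _) (trivector_remainder _ _ _ _) => a b c; lra.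
- have m0 := normr_ge0 M.
  move=> x; rewrite /N => Nx; rewrite /K !K0 ?addr0 //; by [apply: xi0; lra|apply: eta0; lra|apply: zeta0; lra].
Qed.

End Path.

Lemma hamiltonian_criterion : hamiltonian_operator U (nonlocal_op g w).
Proof.
split=> [F G dF dG hF hG u fu|F G H dF dG dH hF hG hH u fu].
  exact: (nonlocal_skew oU mg sw fu (test_field_variational hF fu) (test_field_variational hG fu)).
have le3 (a b c : R) : 0 <= a -> 0 <= b -> 0 <= c ->
    [/\ a <= a + b + c, b <= a + b + c & c <= a + b + c].
  by move=> *; split; lra.
(* [p], [q], [r] stand for the second variations of [F], [G], [H], each evaluated on the operator
   images of the other two differentials; [a], [b], [c] are the trivector integrals. *)
have alg (p q r a b c : R) : a + b + c = 0 -> p - q + a + (q - r + b) + (r - p + c) = 0.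
  by move=> <-; ring.
have tF := test_field_variational hF fu; have tG := test_field_variational hG fu.
have tH := test_field_variational hH fu.
have tJ c : test_field c -> test_field (nonlocal_op g w u c) by exact: (test_field_nonlocal oU mg sw fu).
have [Ma Ma0 [wa va]] := bracket_variation oU mg sw hF hG fu (tJ _ tH).
have [Mb Mb0 [wb vb]] := bracket_variation oU mg sw hG hH fu (tJ _ tF).
have [Mc Mc0 [wc vc]] := bracket_variation oU mg sw hH hF fu (tJ _ tG).
have [la lb lc] := le3 _ _ _ Ma0 Mb0 Mc0.
do 3 eexists; split; [exact: va|exact: vb|exact: vc|].
have sk a b : test_field a -> test_field b ->
    pairing a (nonlocal_op g w u b) = - pairing b (nonlocal_op g w u a).
  exact: (nonlocal_skew oU mg sw fu).
have tV F' dF' a : has_variational_derivative U F' dF' -> test_field a -> test_field (vderiv dF' u a).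
  by move=> hF' ta; exact: (test_field_vderiv oU hF' fu ta).
have cyc : _ = 0 := itotal_trivector_cyclic fu tF tG tH (windowedW la wa)
  (windowedW lb wb) (windowedW lc wc).
rewrite (sk _ _ tF (tV _ _ _ hG (tJ _ tH))) (sk _ _ tG (tV _ _ _ hH (tJ _ tF))).
rewrite (sk _ _ tH (tV _ _ _ hF (tJ _ tG))).
move: cyc (tJ _ tF) (tJ _ tG) (tJ _ tH).
move: (nonlocal_op g w u (dF u)) (nonlocal_op g w u (dG u)) (nonlocal_op g w u (dH u)).
move=> vF vG vH cyc tvF tvG tvH.
have E1 := second_variation_sym oU hF fu tvH tvG.
have E2 := second_variation_sym oU hG fu tvF tvH.
have E3 := second_variation_sym oU hH fu tvG tvF.
rewrite E1 E2 E3.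
exact: alg cyc.
Qed.

End Criterion.

Section Paths.
Context {R : realType} {n : nat}.
Variables (U : set 'rV[R]_n) (g : 'rV[R]_n -> 'M[R]_n).
Hypotheses (oU : open U) (mg : metric_on U g).

Lemma dx_mderiv (xi : R -> 'rV[R]_n) x d : mderiv x (1 : R) xi d -> dx xi x = d.
Proof. by move=> dxi; apply/rowP => i; rewrite mxE derive1E; have [_ <-] := dxi 0 i. Qed.

Lemma Dcov_gradient (f : 'rV[R]_n -> R) (u : R -> 'rV[R]_n) x : smooth_on U f ->
  smooth_path u -> U (u x) -> Dcov g u (gradient f \o u) x = covd g f (dx u x) (u x).
Proof.
move=> sf su Ux; rewrite /Dcov /covd; congr (_ - _).
exact: dx_mderiv (mderiv_chain (mderiv_path x su) (mderiv_gradient sf (dx u x) Ux)).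
Qed.

Lemma sum_row (M : 'M[R]_n) (v : 'rV[R]_n) i : \sum_j M i j * v 0 j = (v *m M^T) 0 i.
Proof. by rewrite mxE; apply: eq_bigr => j _; rewrite mxE mulrC. Qed.

Lemma local_op_hessian (f : 'rV[R]_n -> R) u : smooth_on U f -> path_in U u -> forall x i,
  \sum_j hessian_up g f (u x) i j * dx u x 0 j = local_op g u (gradient f \o u) x 0 i.
Proof.
move=> sf [su Uu] x i; rewrite sum_row (hessian_upE oU mg sf) //.
by rewrite (local_opE oU mg) // Dcov_gradient.
Qed.

(** Christoffel symbols depend only on the metric near the point. This is needed for a doubly
    rescaled metric, which returns to [g] only on [U]. *)
Lemma christoffel_eq_on g' : {in U, g =1 g'} -> forall j s k p, U p ->
  christoffel g j s k p = christoffel g' j s k p.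
Proof.
move=> gg j s k p Up; have E q : U q -> g q = g' q by move=> Uq; apply: gg; rewrite inE.
have L a b c : partial c (fun q => lower g q a b) p = partial c (fun q => lower g' q a b) p.
  by apply: (partial_eq_on c oU _ Up) => q Uq; rewrite /lower E.
by rewrite /christoffel; congr (_ * _); apply: eq_bigr => l _; rewrite E // !L.
Qed.

Lemma curvature_eq_on g' : {in U, g =1 g'} -> forall i j k l p, U p ->
  curvature g i j k l p = curvature g' i j k l p.
Proof.
move=> gg i j k l p Up; have E q : U q -> g q = g' q by move=> Uq; apply: gg; rewrite inE.
have C := christoffel_eq_on gg.
have D a b c d : partial d (christoffel g a b c) p = partial d (christoffel g' a b c) p.
  by apply: (partial_eq_on d oU _ Up) => q Uq; exact: C.
rewrite /curvature; apply: eq_bigr => s _; rewrite (E _ Up) !D.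
by under eq_bigr => m _ do rewrite !(C _ _ _ _ Up).
Qed.

End Paths.

(** * The reciprocal transformation *)

Section Reciprocal.
Context {R : realType} {n : nat}.
Implicit Types (f xt : R * R -> R) (z : R * R).

(** The chain rule through [y |-> (xt y, y.2)]; the second component is linear and contributes the
    coefficient [b]. *)
Lemma d_reciprocal f ft xt z (a b : R) : differentiable xt z -> differentiable ft (xt z, z.2) ->
  (\forall y \near z, f y = ft (xt y, y.2)) ->
  'D_(a, b) f z = 'D_(a, b) xt z * d_space ft (xt z, z.2) + b * d_time ft (xt z, z.2).
Proof.
move=> dxt dft E.
have d2 : differentiable (snd : R * R -> R) z 
  by apply: (@linear_differentiable _ _ _ snd) => y; exact: cvg_snd.
have dp : differentiable (fun y : R * R => (xt y, y.2)) z by exact: differentiable_pair.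
rewrite (near_eq_derive _ E) deriveE; last exact: (@differentiable_comp _ _ _ _ _ ft).
rewrite (@diff_comp _ _ _ _ (fun y : R * R => (xt y, y.2)) ft) //= diff_pair //=.
rewrite /d_space /d_time !deriveE //.
have -> : ('d xt z (a, b), 'd (snd : R * R -> R) z (a, b)) =
    'd xt z (a, b) *: ((1, 0) : R * R) + b *: ((0, 1) : R * R).
  rewrite (@diff_lin _ _ _ snd) => [|y]; last exact: cvg_snd.
  apply/eqP/andP; split; apply/eqP => /=.
    by rewrite [_ *: 1]mulr1 [b *: 0]mulr0 addr0.
  by rewrite [_ *: 0]mulr0 add0r [_ *: 1]mulr1.
move: ('d ft _) ((1, 0) : R * R) ((0, 1) : R * R) => L x y.
by rewrite linearP linearZ.
Qed.

(** At corresponding points [u_x = B ut_xt] and [u_t = A ut_xt + ut_t], so the two systems express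
    the same equality there. Both implications follow since [Wt] is the image of [W]. *)
Lemma reciprocal_transformation (U : set 'rV[R]_n) (H : 'rV[R]_n -> 'M[R]_n) (A B : 'rV[R]_n -> R)
    (W Wt : set (R * R)) (u ut : R * R -> 'rV[R]_n) :
  open W -> differentiable_into U Wt ut -> reciprocal_pair B A W u Wt ut ->
  (solves H W u <-> solves (fun p => B p *: H p - (A p)%:M) Wt ut).
Proof.
move=> oW dut [xt [dxt WtE utE]].
have key z i : W z -> 
  (d_time (fun y => u y 0 i) z == \sum_j H (u z) i j * d_space (fun y => u y 0 j) z) =
  (d_time (fun y => ut y 0 i) (xt z, z.2) ==
   \sum_j (B (u z) *: H (u z) - (A (u z))%:M) i j * d_space (fun y => ut y 0 j) (xt z, z.2)).
  move=> Wz; have [dz xtx xtt] := dxt z Wz.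
  have Wtz : Wt (xt z, z.2) by rewrite WtE; exists z.
  have E j (a b : R) : 'D_(a, b) (fun y => u y 0 j) z =
     'D_(a, b) xt z * d_space (fun y => ut y 0 j) (xt z, z.2) + b * d_time (fun y => ut y 0 j) (xt z, z.2).
    apply: d_reciprocal => //; first by have [_] := dut _ Wtz.
    by apply: filterS (open_nbhs_nbhs (conj oW Wz)) => y Wy; rewrite utE.
  have -> : \sum_j (B (u z) *: H (u z) - (A (u z))%:M) i j * d_space (fun y => ut y 0 j) (xt z, z.2)
     = \sum_j H (u z) i j * d_space (fun y => u y 0 j) z
       - A (u z) * d_space (fun y => ut y 0 i) (xt z, z.2).
    transitivity (\sum_j (H (u z) i j * d_space (fun y => u y 0 j) z
        - (A (u z) *+ (i == j)) * d_space (fun y => ut y 0 j) (xt z, z.2))).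
      apply: eq_bigr => j _; rewrite {2}/d_space E -/(d_space xt z) xtx mul0r addr0.
      by rewrite !mxE; ring.
    rewrite sumrB; congr (_ - _); rewrite (bigD1 i) //= eqxx big1 ?addr0 // => j ji.
    by rewrite eq_sym (negPf ji) mul0r.
  rewrite {1}/d_time E -/(d_time xt z) xtt mul1r.
  by rewrite [RHS]eq_sym subr_eq eq_sym addrC.
split=> sol z.
  rewrite {1}WtE => -[y Wy <-] i; apply/eqP; rewrite utE // -key //; exact/eqP/sol.
by move=> Wz i; apply/eqP; rewrite key //; apply/eqP; rewrite -utE //; apply: sol; rewrite WtE; exists z.
Qed.

End Reciprocal.

(** * The transformed system in Hamiltonian form *)

Section HamiltonianForm.
Context {R : realType} {n : nat}.
Variables (U : set 'rV[R]_n) (g : 'rV[R]_n -> 'M[R]_n) (h A B : 'rV[R]_n -> R).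
Hypotheses (oU : open U) (fg : flat_metric_on U g).
Hypotheses (sh : smooth_on U h) (sA : smooth_on U A) (sB : smooth_on U B).
Hypothesis law : conservation_law U (hessian_up g h) B A.
Hypothesis B0 : forall p, U p -> B p != 0.
Implicit Types (p v : 'rV[R]_n).

Let mg : metric_on U g := fg.1.
Let beta p := gradient B p.
Let eta p := gradient h p.
Let ht p := h p / B p.

Let smooth_ht : smooth_on U ht.
Proof. by apply: smooth_onM => //; exact: smooth_onV. Qed.

(** The conservation law contracted with [v], the affinor being replaced by the covariant derivative
    of [dh]. *)
Lemma sderiv_law p v : U p -> sderiv p v A (dot (beta p) (covd g h v p *m g p)).
Proof.
move=> Up; apply: sderiv_eq (sderiv_gradient v (smooth_onW sA Up)).
rewrite -/(dot v (gradient A p)) -(hessian_upE oU mg sh) // [RHS]dotC [RHS]dot_mulmx trmxK.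
congr dot; apply/rowP => j; rewrite !mxE law //.
by apply: eq_bigr => i _; rewrite [beta p 0 i]mxE.
Qed.

Lemma gradient_quotient p : U p ->
  gradient ht p = (B p)^-1 *: eta p - (h p / B p ^+ 2) *: beta p.
Proof.
move=> Up; have Bp := B0 Up; apply/rowP => i.
have dh : sderiv p (delta_mx 0 i) h (partial i h p) by split => //; exact: smooth_onW sh Up.
have dB : sderiv p (delta_mx 0 i) B (partial i B p) by split => //; exact: smooth_onW sB Up.
have [_] := sderivM dh (sderivV Bp dB).
by rewrite !mxE /partial => ->; field; exact: Bp.
Qed.

(** The products of [dB] with [dh] and with itself that come from the quotient are cancelled by the
    change of connection. Besides the two Hessians only a multiple of [v] remains, and its
    coefficient leads to [density_potential]. *)
Lemma covd_quotient p v : U p -> covd (conformal g B) ht v p *m conformal g B p =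
  B p *: (covd g h v p *m g p) - h p *: (covd g B v p *m g p)
  - (dot (eta p *m g p) (beta p) - h p / B p * dot (beta p *m g p) (beta p)) *: v.
Proof.
move=> Up; have Bp := B0 Up.
have dh := sderiv_dot_gradient sh v Up; have dB := sderiv_dot_gradient sB v Up.
have d2q : d2 ht v p = (B p)^-1 *: d2 h v p - (h p / B p ^+ 2) *: d2 B v p
   - (dot v (beta p) / B p ^+ 2) *: eta p
   - (dot v (eta p) / B p ^+ 2 - 2 * h p * dot v (beta p) / B p ^+ 3) *: beta p.
  have dB2 : sderiv p v (fun q => B q ^+ 2) _ := sderivM dB dB.
  have Bp2 : B p ^+ 2 != 0 by rewrite expf_neq0.
  have d := mderivB (mderivZ (sderivV Bp dB) (mderiv_gradient sh v Up))
    (mderivZ (sderivM dh (sderivV (f := fun q => B q ^+ 2) Bp2 dB2)) (mderiv_gradient sB v Up)).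
  have {}d := mderiv_near (N := gradient ht)
    (near_on oU Up (fun q Uq => esym (gradient_quotient Uq))) d.
  rewrite (mderiv_unique (mderiv_gradient smooth_ht v Up) d) -/(eta p) -/(beta p).
  move: (d2 h v p) (d2 B v p) (eta p) (beta p) (dot v _) (dot v _) => x1 x2 x3 x4 r1 r2.
  by apply/rowP => i; rewrite !mxE; field.
rewrite /covd d2q gradient_quotient // (Gam_conformal oU fg sB B0) // mulmxDr.
set S := shift_of _ _ _ _ _.
have lg : v *m lower g p *m g p = v by rewrite -mulmxA (lower_metric mg) // mulmx1.
have shiftE x : x *m S *m g p = - (B p)^-1 *: (dot v (beta p) *: (x *m g p)
    + dot x v *: (beta p *m g p) - dot x (beta p *m g p) *: v).
  rewrite /S /shift_of -scalemxAr -scalemxAl; congr (_ *: _).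
  rewrite mulmxBr mulmxDr mul_mx_scalar !row_outer mulmxBl mulmxDl -!scalemxAl.
  by rewrite lg.
have flip x y : dot x (y *m g p) = dot (x *m g p) y.
  by rewrite [RHS]dot_mulmx (metric_trmx mg).
rewrite /conformal -/(eta p) -/(beta p); clearbody S.
move: shiftE flip Bp; move: (g p) (Gam g v p) (d2 h v p) (d2 B v p) (eta p) (beta p) (B p) (h p).
move=> G C a c e bt k r shiftE flip k0.
set xi := k^-1 *: e - _.
rewrite -scalemxAr [in LHS]mulmxBl [(xi *m C + xi *m S) *m G]mulmxDl shiftE flip /xi.
rewrite !(mulmxBl, mulmxDl, =^~ scalemxAl) !(dotDl, dotNl, dotZl).
rewrite [dot e v]dotC [dot bt v]dotC.
move: (a *m G) (c *m G) (e *m C *m G) (bt *m C *m G) (e *m G) (bt *m G) => x1 x2 x3 x4 x5 x6.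
move: (dot v bt) (dot v e) (dot x5 bt) (dot x6 bt) => r1 r2 r3 r4.
by apply/rowP => i; rewrite !mxE; field.
Qed.

(** Forced by comparing the multiples of [u_x] on both sides: [- A] comes from the transformed
    system, the products of gradients from [covd_quotient], and the scalar part of [affinor],
    multiplied by [h / B], reduces the coefficient of the last product to one half. *)
Definition density_potential p : R := dot (eta p *m g p) (beta p) - A p
  - 2^-1 * (h p * (dot (beta p *m g p) (beta p) / B p)).

Lemma smooth_density_potential : smooth_on U density_potential.
Proof.
have sdot (f1 f2 : 'rV[R]_n -> R) : smooth_on U f1 -> smooth_on U f2 ->
    smooth_on U (fun p => dot (gradient f1 p *m g p) (gradient f2 p)).
  move=> s1 s2; apply: (@smooth_on_eq _ _ _
    (fun p => \sum_j (\sum_i partial i f1 p * g p i j) * partial j f2 p)) => //.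
    move=> q Uq; rewrite dotE; apply: eq_bigr => j _; rewrite !mxE; congr (_ * _).
    by apply: eq_bigr => i _; rewrite mxE.
  apply: smooth_on_sum => // j _; apply: smooth_onM => //; last exact: smooth_on_partial.
  apply: smooth_on_sum => // i _; apply: smooth_onM => //; first exact: smooth_on_partial.
  exact: smooth_metric.
apply: smooth_onB => //; first by apply: smooth_onB => //; exact: sdot.
apply: smooth_onM => //; first exact: smooth_on_cst.
apply: smooth_onM => //; apply: smooth_onM => //; first exact: sdot.
exact: smooth_onV.
Qed.

(** Differentiating [(dh, dB)] produces a term with the Hessian of [h], which has no counterpart on
    the right; by the conservation law it is exactly the derivative of [A] and cancels. *)
Lemma sderiv_density_potential p v : U p ->
  sderiv p v density_potential (dot (v *m (affinor g B p)^T) (gradient ht p)).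
Proof.
move=> Up; have Bp := B0 Up.
have dh := sderiv_dot_gradient sh v Up; have dB := sderiv_dot_gradient sB v Up.
have db := mderivM (mderiv_gradient sB v Up) (mderiv_metric oU mg v Up).
have de := mderivM (mderiv_gradient sh v Up) (mderiv_metric oU mg v Up).
have dbe := mderiv_gradient sB v Up.
have d := sderivB (sderivB (sderiv_dot de dbe) (sderiv_law v Up))
  (sderivM (sderiv_cst p v 2^-1) (sderivM dh (sderivM (sderiv_dot db dbe) (sderivV Bp dB)))).
apply: sderiv_eq d.
rewrite (row_affinor oU fg sB) // gradient_quotient // /covd -/(eta p) -/(beta p) -/mg.
have flip x y : dot x (y *m g p) = dot (x *m g p) y.
  by rewrite [RHS]dot_mulmx (metric_trmx mg).
move: flip Bp; move: (metric_trmx mg Up).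
move: (g p) (Gam g v p) (d2 h v p) (d2 B v p) (eta p) (beta p) (B p) (h p).
move=> G C a c e bt k r GT flip k0.
rewrite !(mulmxN, mulmxDr, mulmxBl, mulmxA) !(dotDl, dotNl, dotDr, dotNr, dotZl, dotZr).
have tr x y : dot (x *m C^T) y = dot x (y *m C) by rewrite dot_mulmx trmxK.
have gs x y : dot (x *m G) y = dot (y *m G) x by rewrite -flip dotC.
rewrite !tr [dot bt (a *m G)]dotC [dot bt (e *m C *m G)]dotC.
rewrite [dot (e *m G) (bt *m C)]gs [dot (e *m G) c]gs [dot (bt *m G) (bt *m C)]gs [dot (bt *m G) c]gs.
by do ?[move: (dot _ _) => ?]; field.
Qed.

Lemma hamiltonian_form_reciprocal :
  hamiltonian_form U (fun p => B p *: hessian_up g h p - (A p)%:M) (conformal g B) (affinor g B) ht.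
Proof.
exists ht, density_potential; split=> //; first exact: smooth_density_potential.
move=> u [su Uu] x; split=> [||i].
- rewrite density1E; apply: sderiv_is_derive.
  exact: sderiv_chain (mderiv_path x su) (sderiv_dot_gradient smooth_ht _ (Uu x)).
- rewrite densitywE; apply: sderiv_is_derive.
  exact: sderiv_chain (mderiv_path x su) (sderiv_density_potential _ (Uu x)).
- have mc := metric_conformal oU fg sB B0.
  rewrite sum_row [RHS]mxE (local_opE oU mc) // (Dcov_gradient _ smooth_ht) // covd_quotient //.
  rewrite sum_row (row_affinor oU fg sB) // linearB linearZ /= tr_scalar_mx mulmxBr mul_mx_scalar.
  rewrite -scalemxAr (hessian_upE oU mg sh) // /density_potential /ht -/(beta _) /=.
  have Bx := B0 (Uu x).
  move: (dx u x) (covd g h _ _ *m g _) (covd g B _ _ *m g _) (dot _ _) (dot _ _).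
  move=> x1 x2 x3 r1 r2.
  by rewrite !mxE; field.
Qed.

End HamiltonianForm.

(** * Conformal flatness of the new metric *)

Section Flatness.
Context {R : realType} {n : nat}.
Variables (U : set 'rV[R]_n) (g : 'rV[R]_n -> 'M[R]_n) (B : 'rV[R]_n -> R).
Hypotheses (oU : open U) (fg : flat_metric_on U g) (sB : smooth_on U B).
Hypothesis B0 : forall p, U p -> B p != 0.

(** The positive factor [B ^- 2] undoes the rescaling on all of [U], so [U] itself serves as the
    neighbourhood. *)
Lemma conformally_flat_conformal : conformally_flat_on U (conformal g B).
Proof.
move=> p Up; have sB2 : smooth_on U (fun q => B q ^+ 2) by exact: smooth_onM.
have B20 q : U q -> B q ^+ 2 != 0 by move=> Uq; rewrite expf_neq0 // B0.
have gE q : U q -> (B q ^+ 2)^-1 *: conformal g B q = g q.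
  by move=> Uq; rewrite /conformal scalerA mulVf ?scale1r // B20.
exists U, (fun q => (B q ^+ 2)^-1); split=> //.
- by split.
- exact: smooth_onV.
- by move=> q Uq; rewrite invr_gt0 lt_def B20 // sqr_ge0.
have [mg fl] := fg; split; first split.
- move=> i j; apply: smooth_on_eq (smooth_metric mg i j) => // q Uq.
  by rewrite gE.
- by move=> q Uq; rewrite gE //; exact: mg.2.
move=> q Uq i j k l; rewrite -(fl q Uq i j k l).
by apply: (curvature_eq_on oU) => // r; rewrite inE; exact: gE.
Qed.

End Flatness.

Theorem theorem2 (R : realType) (n : nat) (U : set 'rV[R]_n)
    (g : 'rV[R]_n -> 'M[R]_n) (h A B : 'rV[R]_n -> R) :
  open U -> flat_metric_on U g ->
  smooth_on U h -> smooth_on U A -> smooth_on U B ->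
  conservation_law U (hessian_up g h) B A ->
  (forall p, U p -> B p != 0) ->
  let vt := fun p => B p *: hessian_up g h p - (A p)%:M in
  let gt := fun p => B p ^+ 2 *: g p in
  let wt := fun p => B p *: hessian_up g B p - (2^-1 * grad_sq g B p)%:M in
  let ht := fun p => h p / B p in
  [/\ (* v(u) u_x = J dh/du for the initial system *)
      forall u, path_in U u -> forall x i,
        \sum_j hessian_up g h (u x) i j * dx u x 0 j =
        local_op g u (gradient h \o u) x 0 i,
      (* the reciprocal transformation turns the initial system into
         u_t = vt(u) u_xt *)
      forall (W Wt : set (R * R)) (u ut : R * R -> 'rV[R]_n),
        open W -> open Wt ->
        differentiable_into U W u -> differentiable_into U Wt ut ->
        reciprocal_pair B A W u Wt ut ->
        (solves (hessian_up g h) W u <-> solves vt Wt ut),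
      hamiltonian_operator U (nonlocal_op gt wt) /\
        hamiltonian_form U vt gt wt ht,
      conformally_flat_on U gt
    & forall p, U p -> forall i j k l,
        curvature gt i j k l p =
          wt p i k * (j == l)%:R + wt p j l * (i == k)%:R
          - wt p j k * (i == l)%:R - wt p i l * (j == k)%:R].
Proof.
move=> oU fg sh sA sB law B0 vt gt wt ht; have mg := fg.1; split.
- move=> u pu x i; exact: (local_op_hessian oU mg sh pu).
- move=> W Wt u ut oW _ _ dut; exact: (@reciprocal_transformation _ _ U (hessian_up g h) A B W Wt u ut oW dut).
- split; last exact: (hamiltonian_form_reciprocal oU fg sh sA sB law B0).
  (* [gt] and [wt] unfold to [conformal g B] and [affinor g B]; the remaining goals are smoothness,
     self-adjointness, the Codazzi equation and the Gauss equation for them. *)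
  apply: (hamiltonian_criterion oU (metric_conformal oU fg sB B0)).
  + exact: (smooth_affinor oU fg sB).
  + by move=> a b p Up; exact: (dot_affinor oU fg sB).
  + by move=> v y p Up; exact: (codazzi oU fg sB B0).
  + by move=> v y p Up; exact: (gauss_conformal oU fg sB B0).
- exact: (conformally_flat_conformal oU fg sB B0).
- move=> p Up i j k l; exact: (curvature_conformal oU fg sB B0).
Qed.
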